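(* Let $\alpha\in(0,2]$, $E\in Q(\mathbb{R}^d)$ and $D\in Q(\mathbb{R}^m)$. Suppose $\phi:\mathbb{R}^d\to[0,\infty)$ is an $E$-homogeneous, $(\beta,E)$-admissible function for some constant $\beta>0$. Let $q$ be the trace of $E$, let $H$ be the maximum of the real parts of the eigenvalues of $D$, and let $I$ be the identity operator on $\mathbb{R}^m$. If $H<\beta$, then the random field $$X_\phi(x)=\int_{\mathbb{R}^d}\Big[\phi(x-y)^{D-qI/\alpha}-\phi(-y)^{D-qI/\alpha}\Big]\,M(\mathrm{d}y),\qquad x\in\mathbb{R}^d,$$ is well defined (as a stochastic integral with respect to the $\mathbb{R}^m$-valued symmetric $\alpha$-stable random measure $M$; that is, for each $x$ the integrand $Q_x(y)$ satisfies $\int_{\mathbb{R}^d}\|Q_x(y)\|^\alpha\,\mathrm{d}y<\infty$). Furthermore, $X_\phi=\{X_\phi(x),x\in\mathbb{R}^d\}$ is a stochastically continuous $(E,D)$-operator-self-similar symmetric $\alpha$-stable random field with stationary increments.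
   Context: $d\ge2$, $m\ge2$ are fixed integers. For a square matrix $A$ and $r>0$, $r^A:=\exp((\ln r)A)$. $Q(\mathbb{R}^n)$ is the set of invertible real $n\times n$ matrices all of whose eigenvalues have positive real parts. $\|\cdot\|$ is the operator norm for the Euclidean norm $|\cdot|$, and $A^*$ denotes the adjoint. $\lambda_d$ is Lebesgue measure on $\mathbb{R}^d$. $\stackrel{d}{=}$ means equality of all finite-dimensional distributions. Polar coordinates under $E$: every $x\in\mathbb{R}^d\setminus\{0\}$ can be written uniquely as $x=\tau(x)^E l(x)$ with radial part $\tau(x)>0$ and direction $l(x)\in\Sigma_0=\{x:\tau(x)=1\}$, where $\tau$ and $l$ are continuous, $\Sigma_0$ is compact, $\tau(-x)=\tau(x)$, $\tau(r^Ex)=r\tau(x)$ for $r>0$, $\tau(x)\to\infty$ as $|x|\to\infty$ and $\tau(x)\to0$ as $|x|\to0$ (so $\tau(0)=0$). Such a $\tau$ is fixed. A function $\phi$ is $E$-homogeneous if $\phi(r^Ex)=r\phi(x)$ for all $r>0$ and $x\in\mathbb{R}^d\setminus\{0\}$. A function $\phi:\mathbb{R}^d\to[0,\infty)$ is $(\beta,E)$-admissible if $\phi(x)>0$ for all $x\ne0$ and for any $0<A<B$ there is a constant $C_1>0$ such that, for $A\le|y|\le B$, $\tau(x)\le1$ implies $|\phi(x+y)-\phi(y)|\le C_1\tau(x)^\beta$. Random measure: $M$ is an $\mathbb{R}^m$-valued set function on Borel sets of finite Lebesgue measure (values are random vectors on one probability space), independently scattered (values on disjoint sets are independent) and $\sigma$-additive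 (a.s. on countable disjoint unions of finite measure), such that for disjoint $A_1,\dots,A_k$ and $\theta_1,\dots,\theta_k\in\mathbb{R}^m$, $\mathbb{E}\exp\{i\sum_j\langle\theta_j,M(A_j)\rangle\}=\exp\{-\sum_j\lambda_d(A_j)|\theta_j|^\alpha\}$. Stochastic integral: for a simple function $Q=\sum_jR_j\mathbf{1}_{A_j}$ (real $m\times m$ matrices $R_j$, disjoint $A_j$ of finite measure), $\int Q\,\mathrm{d}M=\sum_jR_jM(A_j)$. For a Borel measurable matrix-valued $Q$ with $\int\|Q(u)\|^\alpha\mathrm{d}u<\infty$, $I(Q)=\int Q\,\mathrm{d}M$ is the limit in probability of $\int Q_n\,\mathrm{d}M$ for simple $Q_n$ with $\int\|Q-Q_n\|^\alpha\mathrm{d}u\to0$; it is a symmetric $\alpha$-stable vector with $\mathbb{E}e^{i\langle\theta,I(Q)\rangle}=\exp\{-\int_{\mathbb{R}^d}|Q(u)^*\theta|^\alpha\mathrm{d}u\}$, $\theta\in\mathbb{R}^m$. (The integrand defining $X_\phi(x)$ is defined for $y\notin\{0,x\}$, i.e. almost everywhere.) A random field $X$ is $(E,D)$-operator-self-similar if $\{X(r^Et),t\in\mathbb{R}^d\}\stackrel{d}{=}\{r^DX(t),t\in\mathbb{R}^d\}$ for all $r>0$. It has stationary increments if $\{X(t+h)-X(h),t\in\mathbb{R}^d\}\stackrel{d}{=}\{X(t),t\in\mathbb{R}^d\}$ for all $h\in\mathbb{R}^d$. It is stochastically continuous if it is continuous in probability at every point. It is a symmetric $\alpha$-stable random field if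 all its finite-dimensional distributions are symmetric $\alpha$-stable (centered Gaussian when $\alpha=2$). *)

(* Defs.v *)
From HB Require Import structures.
From mathcomp Require Import all_boot all_order all_algebra.
From mathcomp Require Import complex.
From mathcomp Require Import all_classical all_reals all_analysis.

Set Implicit Arguments.
Unset Strict Implicit.
Unset Printing Implicit Defensive.

Import Order.TTheory GRing.Theory Num.Theory.
Import numFieldNormedType.Exports.

Local Open Scope classical_set_scope.
Local Open Scope ring_scope.

Fact mx_borel_display : measure_display.
Proof. exact: default_measure_display. Qed.

Section mx_borel.
Context {R : realType} {m n : nat}.

Definition mx_borel : set (set 'M[R]_(m, n)) := <<s open >>.

Let mx_borel0 : mx_borel set0.
Proof. exact: sigma_algebra0. Qed.

Let mx_borelC A : mx_borel A -> mx_borel (~` A).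
Proof. exact: sigma_algebraC. Qed.

Let mx_borel_bigcup (F : (set 'M[R]_(m, n))^nat) :
  (forall i, mx_borel (F i)) -> mx_borel (\bigcup_i F i).
Proof. exact: sigma_algebra_bigcup. Qed.

HB.instance Definition _ := @isMeasurable.Build mx_borel_display
  'M[R]_(m, n) mx_borel mx_borel0 mx_borelC mx_borel_bigcup.

End mx_borel.

Section mx_measurability.
Context {R : realType}.

Lemma measurable_fun_coord m n (i : 'I_m) (j : 'I_n) :
  measurable_fun [set: 'M[R]_(m, n)] (fun A : 'M[R]_(m, n) => A i j).
Proof.
apply: (measurability _ (measurable_realfun.RGenOpens.measurableE R)).
move=> _ [_ [a [b ->]] <-]; rewrite setTI; apply: sub_sigma_algebra.
by apply: open_comp; [move=> A _; exact: coord_continuous|exact: interval_open].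
Qed.

Let box m n (p : 'M[rat]_(m, n) * nat) : set 'M[R]_(m, n) :=
  [set A | forall i j, `|A i j - ratr (p.1 i j)| < p.2.+1%:R^-1].

Let open_bigcup_box m n (U : set 'M[R]_(m, n)) : open U ->
  U = \bigcup_(p in [set p | box p `<=` U]) box p.
Proof.
move=> oU; apply/seteqP; split => [A UA|A [p /= pU] /pU//].
have /nbhs_ballP[e /= e0 eU] : nbhs A U by exact: open_nbhs_nbhs.
have [k ke] : exists k : nat, (0 : R) + k.+1%:R^-1 < e / 2.
  by apply: ltr_add_invr; rewrite divr_gt0.
rewrite add0r in ke.
have /choice[q Hq] (ij : 'I_m * 'I_n) :
    exists q : rat, `|A ij.1 ij.2 - ratr q| < k.+1%:R^-1.
  have : A ij.1 ij.2 - k.+1%:R^-1 < A ij.1 ij.2 + k.+1%:R^-1.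
    by rewrite ltrD2l gtrN// invr_gt0.
  move=> /rat_in_itvoo[q]; rewrite in_itv/= => /andP[q1 q2]; exists q.
  by rewrite distrC ltr_distl q1.
exists (\matrix_(i, j) q (i, j), k) => /= [B AB|i j]; last first.
  by rewrite mxE; exact: (Hq (i, j)).
apply: eU; split => // i j.
rewrite /ball/=.
have -> : A i j - B i j = (A i j - ratr (q (i, j))) - (B i j - ratr (q (i, j))).
  by rewrite opprB addrA subrK.
rewrite (le_lt_trans (ler_normB _ _))// [ltRHS](splitr e) ltrD//.
  exact: lt_trans (Hq (i, j)) ke.
by apply: lt_trans ke; have := AB i j; rewrite /= mxE.
Qed.

Lemma measurable_fun_mxP d (T : measurableType d) m n (f : T -> 'M[R]_(m, n)) :
  (forall i j, measurable_fun [set: T] (fun x => f x i j)) ->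
  measurable_fun [set: T] f.
Proof.
move=> mf.
have mE : @measurable _ 'M[R]_(m, n) = <<s open >> by [].
apply: (measurability _ mE) => _ [U oU <-].
rewrite setTI (open_bigcup_box oU) bigcup_mkcond preimage_bigcup.
apply: countable_bigcupT_measurable => // -[q k]; case: ifPn => _; last first.
  by rewrite preimage_set0.
rewrite [X in measurable X](_ : _ = \bigcap_(ij in [set: 'I_m * 'I_n])
    [set x | `|f x ij.1 ij.2 - ratr (q ij.1 ij.2)| < k.+1%:R^-1]); last first.
  by apply/seteqP; split => [x fx [i j] _|x fx i j]; [exact: fx|exact: (fx (i, j))].
apply: fin_bigcap_measurable => // -[i j] _ /=.
rewrite [X in measurable X](_ : _ = (fun x => f x i j) @^-1`
   `](ratr (q i j) - k.+1%:R^-1), (ratr (q i j) + k.+1%:R^-1)[%classic).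
  by rewrite -[X in measurable X]setTI; exact: mf.
by apply/seteqP; split => x /=; rewrite in_itv/= -ltr_distl.
Qed.

End mx_measurability.

(* Lebesgue measure on the space of column vectors, by induction on the
   dimension: the image of the product measure under stacking. *)
Section lebesgue_cV.
Context {R : realType}.

Section step.
Context {n : nat} (mu : {sigma_finite_measure set 'cV[R]_n -> \bar R}).

Let stack (z : R * 'cV[R]_n) : 'cV[R]_n.+1 := col_mx z.1%:M z.2.
Let unstack (v : 'cV[R]_n.+1) : R * 'cV[R]_n :=
  (v ord0 0, @dsubmx _ 1 n 1 v).

Let unstackK : cancel stack unstack.
Proof.
move=> [x v]; rewrite /stack /unstack [dsubmx _]col_mxKd; congr pair.
transitivity (@col_mx _ 1 n 1 x%:M v (lshift n (ord0 : 'I_1)) 0).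
  by congr (col_mx _ _ _ _); exact/val_inj.
by rewrite col_mxEu mxE eqxx mulr1n.
Qed.

Let measurable_stack : measurable_fun [set: R * 'cV[R]_n] stack.
Proof.
apply: measurable_fun_mxP => i j; rewrite /stack.
case: (@splitP 1 n i) => k ik.
  have -> : (fun z : R * 'cV[R]_n => col_mx z.1%:M z.2 i j) = fst.
    apply/funext => z.
    transitivity (@col_mx _ 1 n 1 z.1%:M z.2 (lshift n k) j).
      by congr (col_mx _ _ _ _); exact/val_inj.
    by rewrite col_mxEu !ord1 mxE eqxx mulr1n.
  exact: measurable_fst.
have -> : (fun z : R * 'cV[R]_n => col_mx z.1%:M z.2 i j) =
    (fun v : 'cV[R]_n => v k j) \o snd.
  apply/funext => z.
  transitivity (@col_mx _ 1 n 1 z.1%:M z.2 (rshift 1 k) j).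
    by congr (col_mx _ _ _ _); exact/val_inj.
  by rewrite col_mxEd.
by apply: measurableT_comp; [exact: measurable_fun_coord|exact: measurable_snd].
Qed.

Let measurable_unstack : measurable_fun [set: 'cV[R]_n.+1] unstack.
Proof.
apply: measurable_fun_pair; first exact: measurable_fun_coord.
apply: measurable_fun_mxP => i j; under eq_fun do rewrite mxE.
exact: measurable_fun_coord.
Qed.

Definition lebesgue_step : set 'cV[R]_n.+1 -> \bar R :=
  pushforward (lebesgue_measure \x mu)%E stack.

HB.instance Definition _ := Measure.copy lebesgue_step
  (measure_function_pushforward__canonical__measure_function_Measure
    (lebesgue_measure \x mu)%E measurable_stack).

Let lebesgue_step_sigma_finite : sigma_finite [set: 'cV[R]_n.+1] lebesgue_step.
Proof.
have /sigma_finiteP[F [TF ndF Foo]] := sigma_finiteT (@lebesgue_measure R).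
have /sigma_finiteP[G [TG ndG Goo]] := sigma_finiteT mu.
have FGT : [set: R * 'cV[R]_n] = \bigcup_k (F k `*` G k).
  rewrite -setXTT TF TG predeqE => -[x y]; split.
    move=> [/= [i _ Fx] [j _ Gy]]; exists (maxn i j) => //; split.
    - by move: x Fx; exact/subsetPset/ndF/leq_maxl.
    - by move: y Gy; exact/subsetPset/ndG/leq_maxr.
  by move=> [i _ []/= ? ?]; split; exists i.
exists (fun k => unstack @^-1` (F k `*` G k)) => [|k].
  by rewrite -preimage_bigcup -FGT preimage_setT.
have [mF Fk] := Foo k; have [mG Gk] := Goo k; split.
  rewrite -[X in measurable X]setTI; apply: measurable_unstack => //.
  exact: measurableX.
rewrite /lebesgue_step /pushforward -comp_preimage.
rewrite (_ : unstack \o stack = id); last exact/funext.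
by rewrite product_measure1E// lte_mul_pinfty// ge0_fin_numE.
Qed.

HB.instance Definition _ := Measure_isSigmaFinite.Build _ _ _ lebesgue_step
  lebesgue_step_sigma_finite.

End step.

Fixpoint lebesgue_cV (n : nat) : {sigma_finite_measure set 'cV[R]_n -> \bar R} :=
  if n is k.+1 then lebesgue_step (lebesgue_cV k) else dirac (0 : 'cV[R]_0).

End lebesgue_cV.
Arguments lebesgue_cV {R} n.

Section euclidean.
Context {R : realType}.

Definition dot n (u v : 'cV[R]_n) : R := \sum_i u i 0 * v i 0.

(* The library norm [`|v|] on matrices is the max norm. *)
Definition enorm n (v : 'cV[R]_n) : R := Num.sqrt (dot v v).

Definition opnorm m n (A : 'M[R]_(m, n)) : R :=
  sup [set enorm (A *m v) | v in [set v : 'cV[R]_n | enorm v <= 1]].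

Definition mexp n (A : 'M[R]_n) : 'M[R]_n :=
  limn (series (fun k => k`!%:R^-1 *: A ^+ k)).

Definition mpow n (r : R) (A : 'M[R]_n) : 'M[R]_n := mexp (ln r *: A).

Definition spectrum n (A : 'M[R]_n) : set R[i] :=
  [set z | eigenvalue (map_mx (real_complex R) A) z].

Definition positive_spectrum n (A : 'M[R]_n) : Prop :=
  A \in unitmx /\ forall z, spectrum A z -> 0 < complex.Re z.

Definition is_max_Re n (A : 'M[R]_n) (h : R) : Prop :=
  (exists2 z, spectrum A z & complex.Re z = h) /\
  (forall z, spectrum A z -> complex.Re z <= h).

End euclidean.

Section polar.
Context {R : realType} {d : nat}.

Record polar_coordinates (E : 'M[R]_d) (tau : 'cV[R]_d -> R)
    (l : 'cV[R]_d -> 'cV[R]_d) : Prop := {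
  polar_gt0 : forall x, x != 0 -> 0 < tau x ;
  polar_dir : forall x, x != 0 -> tau (l x) = 1 ;
  polar_dec : forall x, x != 0 -> x = mpow (tau x) E *m l x ;
  polar_uniq : forall x r u, x != 0 -> 0 < r -> tau u = 1 ->
    x = mpow r E *m u -> r = tau x /\ u = l x ;
  polar_cont_tau : forall x, x != 0 -> {for x, continuous tau} ;
  polar_cont_l : forall x, x != 0 -> {for x, continuous l} ;
  polar_compact : compact [set x | tau x = 1] ;
  polar_opp : forall x, tau (- x) = tau x ;
  polar_homo : forall r x, 0 < r -> tau (mpow r E *m x) = r * tau x ;
  polar_infty : forall K, exists r, forall x, r < enorm x -> K < tau x ;
  polar_zero : tau x @[x --> (0 : 'cV[R]_d)] --> (0 : R) ;
  polar_tau0 : tau 0 = 0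
}.

Definition homogeneous (E : 'M[R]_d) (phi : 'cV[R]_d -> R) : Prop :=
  forall r x, 0 < r -> x != 0 -> phi (mpow r E *m x) = r * phi x.

(* The matrix [E] enters only through the radial part [tau]. *)
Definition admissible (tau : 'cV[R]_d -> R) (beta : R) (phi : 'cV[R]_d -> R) :
    Prop :=
  [/\ forall x, 0 <= phi x,
      forall x, x != 0 -> 0 < phi x &
      forall A B, 0 < A -> A < B -> exists2 C1, 0 < C1 &
        forall x y, A <= enorm y <= B -> tau x <= 1 ->
          `|phi (x + y) - phi y| <= C1 * tau x `^ beta].

End polar.

Section probability_notions.
Context {dO : measure_display} {Omega : measurableType dO} {R : realType}.
Variable P : probability Omega R.

Definition charfun (Z : Omega -> R) : R[i] :=
  Complex (fine 'E_P[cos \o Z]) (fine 'E_P[sin \o Z]).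

Definition independent m k (Y : 'I_k -> Omega -> 'cV[R]_m) : Prop :=
  forall B : 'I_k -> set 'cV[R]_m, (forall i, measurable (B i)) ->
    fine (P (\bigcap_i (Y i @^-1` B i))) = \prod_i fine (P (Y i @^-1` B i)).

Definition cvg_in_probability T (F : set_system T) m
    (Y_ : T -> Omega -> 'cV[R]_m) (Y : Omega -> 'cV[R]_m) : Prop :=
  forall e : R, 0 < e ->
    P [set w | e < enorm (Y_ t w - Y w)] @[t --> F] --> 0%E.

(* The second disjunct is the degenerate case of variance zero, for which
   [normal_prob] is not the Dirac mass. *)
Definition centered_gaussian m k (V : Omega -> 'M[R]_(m, k)) : Prop :=
  forall theta : 'M[R]_(m, k),
    (exists2 s : R, 0 < s & forall B : set R, measurable B ->
       P [set w | B (\tr (theta^T *m V w))] = normal_prob 0 s B) \/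
    P [set w | \tr (theta^T *m V w) = 0] = 1%E.

Definition symmetric_law m k (V : Omega -> 'M[R]_(m, k)) : Prop :=
  forall B : set 'M[R]_(m, k), measurable B ->
    P [set w | B (- V w)] = P [set w | B (V w)].

(* On [Omega * Omega] with the product probability, [V w.1] and [V w.2] are
   independent copies of [V]. *)
Definition stable_law (alpha : R) m k (V : Omega -> 'M[R]_(m, k)) : Prop :=
  forall a b : R, 0 < a -> 0 < b -> exists c : 'M[R]_(m, k),
    forall B : set 'M[R]_(m, k), measurable B ->
      (P \x P)%E [set w | B (a *: V w.1 + b *: V w.2)] =
      P [set w | B ((a `^ alpha + b `^ alpha) `^ alpha^-1 *: V w + c)].

Definition sas_vector (alpha : R) m k (V : Omega -> 'M[R]_(m, k)) : Prop :=
  measurable_fun setT V /\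
  if alpha == 2 then centered_gaussian V
  else symmetric_law V /\ stable_law alpha V.

Section random_fields.
Context {d m : nat}.
Implicit Types X Y : 'cV[R]_d -> Omega -> 'cV[R]_m.

(* The joint vector (X(t_1), ..., X(t_k)), with X(t_j) as j-th column. *)
Definition joint X k (t : 'I_k -> 'cV[R]_d) : Omega -> 'M[R]_(m, k) :=
  fun w => \matrix_(i, j) X (t j) w i 0.

Definition eq_fdd X Y : Prop :=
  forall k (t : 'I_k -> 'cV[R]_d) (B : set 'M[R]_(m, k)), measurable B ->
    P [set w | B (joint X t w)] = P [set w | B (joint Y t w)].

Definition operator_self_similar (E : 'M[R]_d) (D : 'M[R]_m) X : Prop :=
  forall r : R, 0 < r ->
    eq_fdd (fun t => X (mpow r E *m t)) (fun t w => mpow r D *m X t w).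

Definition stationary_increments X : Prop :=
  forall h, eq_fdd (fun t w => X (t + h) w - X h w) X.

Definition stochastically_continuous X : Prop :=
  forall x, cvg_in_probability (nbhs x) X (X x).

Definition sas_field (alpha : R) X : Prop :=
  forall k (t : 'I_k -> 'cV[R]_d), sas_vector alpha (joint X t).

End random_fields.

Section random_measure.
Context {d m : nat}.
Variable alpha : R.

Definition finite_borel (A : set 'cV[R]_d) : Prop :=
  measurable A /\ (lebesgue_cV d A < +oo)%E.

(* The values of [M] on sets that are not [finite_borel] are irrelevant. *)
Record sas_random_measure (M : set 'cV[R]_d -> {RV P >-> 'cV[R]_m}) : Prop := {
  rm_independently_scattered : forall k (A : 'I_k -> set 'cV[R]_d),
    (forall j, finite_borel (A j)) -> trivIset setT A ->
    independent (fun j => M (A j)) ;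
  rm_sigma_additive : forall A : nat -> set 'cV[R]_d,
    (forall j, measurable (A j)) -> trivIset setT A ->
    finite_borel (\bigcup_j A j) ->
    {ae P, forall w, series (fun j => M (A j) w) @ \oo --> M (\bigcup_j A j) w} ;
  rm_charfun : forall k (A : 'I_k -> set 'cV[R]_d) (theta : 'I_k -> 'cV[R]_m),
    (forall j, finite_borel (A j)) -> trivIset setT A ->
    charfun (fun w => \sum_j dot (theta j) (M (A j) w)) =
    real_complex R
      (expR (- \sum_j fine (lebesgue_cV d (A j)) * enorm (theta j) `^ alpha))
}.

Record simple_integrand := {
  simple_size : nat ;
  simple_coef : 'I_simple_size -> 'M[R]_m ;
  simple_set : 'I_simple_size -> set 'cV[R]_d ;
  simple_finite : forall j, finite_borel (simple_set j) ;
  simple_disjoint : trivIset setT simple_set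
}.

Definition simple_fun (S : simple_integrand) (y : 'cV[R]_d) : 'M[R]_m :=
  \sum_j \1_(@simple_set S j) y *: simple_coef j.

Definition simple_integral (M : set 'cV[R]_d -> {RV P >-> 'cV[R]_m})
    (S : simple_integrand) (w : Omega) : 'cV[R]_m :=
  \sum_j simple_coef j *m M (@simple_set S j) w.

Definition is_integrand (Q : 'cV[R]_d -> 'M[R]_m) : Prop :=
  measurable_fun setT Q /\
  (\int[lebesgue_cV d]_u (opnorm (Q u) `^ alpha)%:E < +oo)%E.

Definition approximates (S : nat -> simple_integrand)
    (Q : 'cV[R]_d -> 'M[R]_m) : Prop :=
  (fun n => \int[lebesgue_cV d]_u (opnorm (Q u - simple_fun (S n) u) `^ alpha)%:E)%E
    @ \oo --> 0%E.

Definition stochastic_integral (M : set 'cV[R]_d -> {RV P >-> 'cV[R]_m})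
    (Q : 'cV[R]_d -> 'M[R]_m) (Y : {RV P >-> 'cV[R]_m}) : Prop :=
  [/\ is_integrand Q,
      exists S, approximates S Q &
      forall S, approximates S Q ->
        cvg_in_probability \oo (fun n => simple_integral M (S n)) Y].

End random_measure.

End probability_notions.

(* Since [ln 0 = 0] in the library, [mpow 0 A] is the identity; the integrand
   thus takes an irrelevant value at [y = x] or [y = 0] when [phi 0 = 0]. *)
Definition moving_average_kernel {R : realType} {d m : nat} (alpha : R)
    (E : 'M[R]_d) (D : 'M[R]_m) (phi : 'cV[R]_d -> R) (x y : 'cV[R]_d) :
    'M[R]_m :=
  let A := D - (\tr E / alpha)%:M in
  mpow (phi (x - y)) A - mpow (phi (- y)) A.

(* Main.v *)
Require Import Defs.
From HB Require Import structures.
From mathcomp Require Import all_boot all_order all_algebra.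
From mathcomp Require Import complex perm.
From mathcomp Require Import all_classical all_reals all_analysis.
From mathcomp Require Import measurable_realfun.
From mathcomp Require Import ring lra zify.

Set Implicit Arguments.
Unset Strict Implicit.
Unset Printing Implicit Defensive.

Import Order.TTheory GRing.Theory Num.Theory.
Import numFieldNormedType.Exports.

Local Open Scope classical_set_scope.
Local Open Scope ring_scope.

(** The field is a moving average against a random measure whose control measure, Lebesgue measure,
is invariant under translations and is multiplied by [r ^ tr E] under [v |-> r^E v]. Every
finite-dimensional law of the field is read off from its characteristic function, the exponential
of minus
  [int | sum_j Q (t j) u ^T theta j | ^ alpha du],
and the statements about the field become statements about this integral of the kernel [Q].

Integrability of the kernel. Since the radial part [tau] and [phi] are both of degree one for the
scaling [r^E], they are comparable away from 0 ([admissible_radial]), and integrals of powers of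
[tau] over [tau <= 1] or [tau > 1] are geometric series over dyadic shells
([radial_power_integral]). Near the singularities 0 and [x] the kernel is controlled by
[r^(D - q / alpha)], whose [alpha]-th power is integrable because the eigenvalues of [D] have
positive real parts. At infinity, admissibility makes the two terms of the kernel cancel up to a
relative error of order [tau ^ (- beta)] ([kernel_far]), which is enough because [H < beta]. Both
regimes use the fact that [r^D] grows or decays like a power of [r] governed by the spectrum
([mpow_growth_ge1], [mpow_growth_le1]). The bound is uniform over lags with [tau x = 1];
scaling transports it to all lags and shows that the integral tends to 0 with the lag
([kernel_integral_le], [kernel_integral_small]).

Stochastic integrals. The tail of a random variable is bounded by the behaviour of its
characteristic function near 0 ([tail_bound]), so simple integrals of functions close in
[L^alpha] are close in probability ([vector_tail]); this gives existence of the integral, and the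
joint characteristic function of several integrals passes to the limit from simple functions
([stochastic_integral_exists], [charfun_integrals]).

The four properties. The identities [Q (t + h) u - Q h u = Q t (u - h)] and
[Q (r^E t) (r^E v) = r^(D - q / alpha) Q t v], together with translation and scaling of Lebesgue
measure, show that the characteristic functions of the two sides of stationarity of increments and
of operator self-similarity agree, and a law on matrices is determined by its Fourier transform
([eq_measure_fourier]). Stochastic continuity follows from the tail bound applied to an increment,
because the integral of its kernel is that of a small lag. The characteristic function is
[exp (- a)] with [a] homogeneous of degree [alpha], which yields symmetry and stability, and for
[alpha = 2] the Gaussian law, whose characteristic function is computed from a differential
equation ([normal_prob_charfun]). *)


(** * Lebesgue measure under translations and linear maps *)

Section affine_real.
Context {R : realType}.
Local Notation mu := (@lebesgue_measure R).
Local Open Scope ereal_scope.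

Let aff (a b : R) (x : measurableTypeR R) : measurableTypeR R := (a * x + b)%R.

Let measurable_aff a b : measurable_fun [set: measurableTypeR R] (aff a b).
Proof.
change (measurable_fun [set: R] (aff a b)). by apply: measurable_funD => //; exact: measurable_funM. Qed.

Lemma lebesgue_measure_affine (a b : R) (A : set R) : a != 0%R -> measurable A ->
  mu A = `|a|%:E * mu (aff a b @^-1` A).
Proof.
move=> a0 mA.
pose m := measure_function_mscale__canonical__measure_function_Measure (NngNum (normr_ge0 a)) (measure_function_pushforward__canonical__measure_function_Measure mu (measurable_aff a b)).
apply: (@lebesgue_measure_unique R m) => // _ [[x y]] _ <-.
rewrite /m/= /mscale/= /pushforward/=.
rewrite lebesgue_measure_itv/= lte_fin.
have [a0'|a0'] := ltP 0%R a.
  rewrite (_ : aff a b @^-1` `]x, y] = `](x - b) / a, (y - b) / a]%classic)%R; last first.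
  apply/seteqP; split => z/=; rewrite !in_itv/= /aff => /andP[h1 h2].
   by rewrite ltr_pdivrMr// ler_pdivlMr// ltrBlDr lerBrDr (mulrC z) h1.
   by move: h1 h2; rewrite ltr_pdivrMr// ler_pdivlMr// ltrBlDr lerBrDr (mulrC z) => -> ->.
  rewrite lebesgue_measure_itv/= lte_fin ltr_pM2r ?invr_gt0// ltrD2r gtr0_norm//.
  case: ifPn => _; last by rewrite mule0.
  by rewrite -!EFinB -EFinM; congr EFin; field.
have {}a0' : (a < 0)%R by rewrite lt_neqAle a0.
rewrite (_ : aff a b @^-1` `]x, y] = `[(y - b) / a, (x - b) / a[%classic)%R; last first.
  apply/seteqP; split => z/=; rewrite !in_itv/= /aff => /andP[h1 h2].
   by rewrite ltr_ndivlMr// ler_ndivrMr// ltrBlDr lerBrDr (mulrC z) h1 h2.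
   by move: h1 h2; rewrite ltr_ndivlMr// ler_ndivrMr// ltrBlDr lerBrDr (mulrC z) => -> ->.
rewrite lebesgue_measure_itv/= lte_fin ltr_nM2r ?invr_lt0// ltrD2r ltr0_norm//.
case: ifPn => _; last by rewrite mule0.
by rewrite -!EFinB -EFinM; congr EFin; field.
Qed.

Lemma ge0_integral_affine (a b : R) (f : R -> \bar R) : a != 0%R ->
  measurable_fun [set: R] f -> (forall x, 0 <= f x) ->
  `|a|%:E * \int[mu]_x f (a * x + b)%R = \int[mu]_x f x.
Proof.
move=> a0 mf f0.
pose P := measure_function_pushforward__canonical__measure_function_Measure mu (measurable_aff a b).
pose m := measure_function_mscale__canonical__measure_function_Measure (NngNum (normr_ge0 a)) P.
transitivity (\int[m]_x (f : measurableTypeR R -> \bar R) x); last first.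
  by apply: eq_measure_integral => A mA _; exact/esym/(lebesgue_measure_affine b a0 mA).
rewrite (@ge0_integral_mscale _ _ _ P setT measurableT)//=; congr *%E.
rewrite /= ge0_integral_pushforward// preimage_setT//.
Qed.

End affine_real.

Section lebesgue_cV_theory.
Context {R : realType}.
Local Open Scope ereal_scope.
Local Notation mu := (@lebesgue_measure R).

Definition scons n (x : R) (v : 'cV[R]_n) : 'cV[R]_n.+1 := col_mx x%:M v.

Lemma scons0 n x (v : 'cV[R]_n) : scons x v 0%R 0%R = x.
Proof.
transitivity (@col_mx _ 1 n 1 x%:M v (lshift n (ord0 : 'I_1)) 0%R).
  by congr (col_mx _ _ _ _); exact/val_inj.
by rewrite col_mxEu mxE eqxx mulr1n.
Qed.

Lemma sconsS n x (v : 'cV[R]_n) i j : scons x v (lift 0%R i) j = v i j.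
Proof.
transitivity (@col_mx _ 1 n 1 x%:M v (rshift 1 i) j).
  by congr (col_mx _ _ _ _); exact/val_inj.
by rewrite col_mxEd.
Qed.

Lemma scons_onto n (z : 'cV[R]_n.+1) : exists x v, z = scons x v.
Proof.
exists (z 0%R 0%R), (\col_i z (lift 0%R i) 0%R); apply/colP => i.
by case: (unliftP 0%R i) => [j|] ->; rewrite ?scons0 // sconsS mxE.
Qed.

Lemma measurable_fun_scons d (T : measurableType d) n (f : T -> R)
    (g : T -> 'cV[R]_n) : measurable_fun [set: T] f ->
  measurable_fun [set: T] g -> measurable_fun [set: T] (fun t => scons (f t) (g t)).
Proof.
move=> mf mg; apply: measurable_fun_mxP => i j; rewrite ord1.
case: (unliftP 0%R i) => [k|] ->; last by under eq_fun do rewrite scons0.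
under eq_fun do rewrite sconsS.
exact: (measurableT_comp (measurable_fun_coord k 0%R) mg).
Qed.

Lemma measurable_fun_mulmx d (T : measurableType d) m n p (A : 'M[R]_(m, n))
    (f : T -> 'M[R]_(n, p)) : measurable_fun [set: T] f ->
  measurable_fun [set: T] (fun t => A *m f t).
Proof.
move=> mf; apply: measurable_fun_mxP => i j.
under eq_fun do rewrite mxE.
apply: measurable_sum => k; apply: measurable_funM => //.
exact: (measurableT_comp (measurable_fun_coord k j) mf).
Qed.

Lemma measurable_fun_mxD d (T : measurableType d) m n
    (f g : T -> 'M[R]_(m, n)) : measurable_fun [set: T] f ->
  measurable_fun [set: T] g -> measurable_fun [set: T] (fun t => f t + g t)%R.
Proof.
move=> mf mg; apply: measurable_fun_mxP => i j.
under eq_fun do rewrite mxE.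
by apply: measurable_funD; [exact: (measurableT_comp (measurable_fun_coord i j) mf)|
  exact: (measurableT_comp (measurable_fun_coord i j) mg)].
Qed.

Lemma ge0_integral_cVS n (f : 'cV[R]_n.+1 -> \bar R) :
  measurable_fun [set: _] f -> (forall z, 0 <= f z) ->
  \int[lebesgue_cV n.+1]_z f z =
  \int[mu]_x \int[lebesgue_cV n]_v f (scons x v).
Proof.
move=> mf f0.
have ms : measurable_fun [set: measurableTypeR R * 'cV[R]_n]
    (fun z => scons z.1 z.2).
  change (measurable_fun [set: R * 'cV[R]_n] (fun z => scons z.1 z.2)).
  exact: measurable_fun_scons.
transitivity (\int[pushforward (mu \x lebesgue_cV n) (fun z => scons z.1 z.2)]_z f z) => //.
rewrite ge0_integral_pushforward// preimage_setT.
rewrite fubini_tonelli1//; first exact: measurableT_comp.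
by move=> z; exact: f0.
Qed.

Section sections_of_functions.
Context {n : nat} (g : R -> 'cV[R]_n -> \bar R).
Hypothesis mg : measurable_fun [set: R * 'cV[R]_n] (fun z => g z.1 z.2).
Hypothesis g0 : forall x v, 0 <= g x v.

Let mg' : measurable_fun [set: measurableTypeR R * 'cV[R]_n] (fun z => g z.1 z.2).
Proof. exact: mg. Qed.

Lemma tonelli_cV :
  \int[mu]_x \int[lebesgue_cV n]_v g x v = \int[lebesgue_cV n]_v \int[mu]_x g x v.
Proof. by apply: (fubini_tonelli _ mg') => z; exact: g0. Qed.

Lemma measurable_integral_cV :
  measurable_fun [set: R] (fun x => \int[lebesgue_cV n]_v g x v).
Proof.
by apply: (measurable_fun_fubini_tonelli_F _ mg') => z; exact: g0.
Qed.

Lemma measurable_integral_R :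
  measurable_fun [set: 'cV[R]_n] (fun v => \int[mu]_x g x v).
Proof.
by apply: (measurable_fun_fubini_tonelli_G _ mg') => z; exact: g0.
Qed.

Lemma measurable_section_R v : measurable_fun [set: R] (g ^~ v).
Proof.
apply: (@measurableT_comp _ _ _ _ _ _ (fun z => g z.1 z.2) _ (fun x => (x, v))) => //.
Qed.

Lemma measurable_section_cV x : measurable_fun [set: 'cV[R]_n] (g x).
Proof.
apply: (@measurableT_comp _ _ _ _ _ _ (fun z => g z.1 z.2) _ (fun v => (x, v))) => //.
exact: measurable_fun_pair.
Qed.

End sections_of_functions.

Lemma sconsD n x y (v w : 'cV[R]_n) :
  (scons x v + scons y w = scons (x + y) (v + w))%R.
Proof.
apply/colP => i; rewrite mxE.
by case: (unliftP 0%R i) => [k|] ->; rewrite ?scons0 // !sconsS mxE.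
Qed.

Lemma ge0_integral_translate n (b : 'cV[R]_n) (f : 'cV[R]_n -> \bar R) :
  measurable_fun [set: _] f -> (forall z, 0 <= f z) ->
  \int[lebesgue_cV n]_z f (z + b)%R = \int[lebesgue_cV n]_z f z.
Proof.
elim: n b f => [|n IH] b f mf f0.
  by apply: eq_integral => z _; congr f; apply/colP => -[].
have [x0 [v0 ->]] := scons_onto b.
have mid k := @measurable_id _ 'cV[R]_k [set: _].
rewrite (ge0_integral_cVS mf f0) (@ge0_integral_cVS _ (fun z => f (z + scons x0 v0)%R)); last 2 first.
- by apply: measurableT_comp => //; exact: measurable_fun_mxD.
- by move=> z; exact: f0.
have mfs : measurable_fun [set: R * 'cV[R]_n] (fun z => f (scons z.1 z.2)).
  by apply: measurableT_comp => //; exact: measurable_fun_scons.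
transitivity (\int[mu]_x \int[lebesgue_cV n]_v f (scons (x + x0) v)).
  apply: eq_integral => x _.
  rewrite -[RHS](IH v0)//; last exact: (@measurable_section_cV _ (fun x v => f (scons x v)) mfs).
  by apply: eq_integral => v _; rewrite sconsD.
have := @ge0_integral_affine R 1%R x0 (fun x => \int[lebesgue_cV n]_v f (scons x v)).
rewrite oner_neq0 normr1 => /(_ isT) <- //.
- by rewrite mul1e; apply: eq_integral => x _; rewrite mul1r.
- exact: (@measurable_integral_cV _ (fun x v => f (scons x v)) mfs).
- by move=> x; exact: integral_ge0.
Qed.

Definition transforms_lebesgue n (T : 'M[R]_n) :=
  forall f : 'cV[R]_n -> \bar R, measurable_fun [set: _] f -> (forall z, 0 <= f z) ->
  `|\det T|%:E * \int[lebesgue_cV n]_z f (T *m z) = \int[lebesgue_cV n]_z f z.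

Lemma transforms_lebesgueM n (S T : 'M[R]_n) :
  transforms_lebesgue S -> transforms_lebesgue T -> transforms_lebesgue (S *m T).
Proof.
move=> hS hT f mf f0; rewrite -[RHS]hS//.
rewrite -(hT (fun z => f (S *m z))) //; last first.
  by apply: measurableT_comp => //; exact: measurable_fun_mulmx.
rewrite det_mulmx normrM EFinM muleA; congr *%E.
by apply: eq_integral => z _; rewrite mulmxA.
Qed.

Lemma transforms_lebesgue1 n : transforms_lebesgue (1%:M : 'M[R]_n).
Proof.
move=> f mf f0; rewrite det1 normr1 mul1e.
by apply: eq_integral => z _; rewrite mul1mx.
Qed.

Lemma block_mx00 n (a : R) (w : 'rV[R]_n) (c : 'cV[R]_n) (B : 'M[R]_n) :
  (block_mx a%:M w c B : 'M[R]_n.+1) 0%R 0%R = a.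
Proof.
rewrite -[RHS](_ : @block_mx R 1 n 1 n a%:M w c B (lshift n 0%R) (lshift n 0%R) = a).
  by congr (block_mx _ _ _ _ _ _); exact/val_inj.
by rewrite block_mxEul mxE eqxx mulr1n.
Qed.

Lemma block_mx0S n (a : R) (w : 'rV[R]_n) (c : 'cV[R]_n) (B : 'M[R]_n) i :
  (block_mx a%:M w c B : 'M[R]_n.+1) 0%R (lift 0%R i) = w 0%R i.
Proof.
rewrite -(@block_mxEur R 1 n 1 n a%:M w c B).
by congr (block_mx _ _ _ _ _ _); exact/val_inj.
Qed.

Lemma mul_ublock_scons n (a : R) (w : 'rV[R]_n) (B : 'M[R]_n) x v :
  ((block_mx a%:M w 0 B : 'M[R]_n.+1) *m scons x v =
   scons (a * x + (w *m v) 0 0) (B *m v))%R.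
Proof.
rewrite /scons (mul_block_col (a%:M : 'M[R]_1)) mul0mx add0r.
have -> : (a%:M *m x%:M + w *m v = (a * x + (w *m v) 0 0)%:M :> 'M[R]_1)%R.
  by rewrite -scalar_mxM [X in (_ + X)%R]mx11_scalar -raddfD.
by [].
Qed.

Lemma transforms_lebesgue_ublock n (a : R) (w : 'rV[R]_n) (B : 'M[R]_n) :
  a != 0%R -> transforms_lebesgue B ->
  transforms_lebesgue (block_mx a%:M w 0 B : 'M[R]_n.+1).
Proof.
move=> a0 hB f mf f0.
have mfs : measurable_fun [set: R * 'cV[R]_n] (fun z => f (scons z.1 z.2)).
  by apply: measurableT_comp => //; exact: measurable_fun_scons.
have mTs : measurable_fun [set: R * 'cV[R]_n]
    (fun z => f ((block_mx a%:M w 0 B : 'M[R]_n.+1) *m scons z.1 z.2)).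
  apply: measurableT_comp => //; apply: measurable_fun_mulmx.
  exact: measurable_fun_scons.
rewrite !ge0_integral_cVS//; last first.
  by apply: measurableT_comp => //; exact: measurable_fun_mulmx.
rewrite (@tonelli_cV _ (fun x v => f ((block_mx a%:M w 0 B : 'M[R]_n.+1) *m scons x v)) mTs)// (@tonelli_cV _ (fun x v => f (scons x v)) mfs)//.
rewrite -(hB (fun v => \int[mu]_x f (scons x v))); last 2 first.
- exact: (@measurable_integral_R _ (fun x v => f (scons x v)) mfs).
- by move=> v; exact: integral_ge0.
rewrite (@det_ublock _ 1 n) det_scalar expr1 normrM EFinM [_%:E * _]muleC -muleA.
congr *%E; rewrite -ge0_integralZl//; last 2 first.
- exact: (@measurable_integral_R _ (fun x v => f ((block_mx a%:M w 0 B : 'M[R]_n.+1) *m scons x v)) mTs).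
- by move=> v _; exact: integral_ge0.
apply: eq_integral => v _.
rewrite -(@ge0_integral_affine R a ((w *m v) 0 0)%R (fun x => f (scons x (B *m v)))) //.
  by congr *%E; apply: eq_integral => x _; rewrite mul_ublock_scons.
exact: (@measurable_section_R _ (fun x v => f (scons x v)) mfs).
Qed.

Lemma transforms_lebesgue_lblock n (c : 'cV[R]_n) :
  transforms_lebesgue (block_mx 1%:M 0 c 1%:M : 'M[R]_n.+1).
Proof.
move=> f mf f0.
have mfs : measurable_fun [set: R * 'cV[R]_n] (fun z => f (scons z.1 z.2)).
  by apply: measurableT_comp => //; exact: measurable_fun_scons.
rewrite !ge0_integral_cVS//; last first.
  by apply: measurableT_comp => //; exact: measurable_fun_mulmx.
rewrite (@det_lblock _ 1 n) !det1 mul1r normr1 mul1e.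
apply: eq_integral => x _.
rewrite -[RHS](ge0_integral_translate (x *: c))//; last first.
  exact: (@measurable_section_cV _ (fun x v => f (scons x v)) mfs).
apply: eq_integral => v _; congr f.
rewrite /scons (mul_block_col (1%:M : 'M[R]_1)) !mul1mx mul0mx addr0 addrC.
by rewrite mul_mx_scalar.
Qed.

(** By induction on the dimension: an invertible matrix with a nonzero corner factors into block
triangular ones, which act on one block of coordinates by a linear map followed by a translation
depending on the other block; a zero corner is first removed by a row operation. *)
Lemma transforms_lebesgue_unitmx n (T : 'M[R]_n) :
  T \in unitmx -> transforms_lebesgue T.
Proof.
elim: n T => [|n IH] T uT.
  rewrite (_ : T = 1%:M); first exact: transforms_lebesgue1.
  by apply/matrixP => -[].
wlog a0 : T uT / T 0%R 0%R != 0%R.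
  move=> hwlog; have [a0|a0] := eqVneq (T 0%R 0%R) 0%R; last exact: hwlog.
  (* Adding to row 0 the other rows weighted by the entries below the corner
     makes the corner the squared length of that column. *)
  pose c : 'cV[R]_n := dlsubmx (T : 'M[R]_(1 + n)).
  pose w : 'rV[R]_n := c^T.
  pose W (s : R) : 'M[R]_n.+1 := block_mx 1%:M (s *: w) 0 1%:M.
  have hW s : transforms_lebesgue (W s).
    have := @transforms_lebesgue_ublock n 1%R (s *: w) 1%:M (oner_neq0 _).
    by move=> /(_ (@transforms_lebesgue1 n)).
  have WK : (W (-1) *m W 1 = 1%:M)%R.
    rewrite /W (@mulmx_block R 1 n 1 n 1 n) !mul1mx !mulmx1 !mul0mx !mulmx0 !addr0.
    by rewrite add0r -scalerDl subrr scale0r -scalar_mx_block.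
  have uW s : W s \in unitmx.
    by rewrite unitmxE (@det_ublock _ 1 n) !det1 mulr1 unitr1.
  rewrite -[T]mul1mx -WK -mulmxA; apply: transforms_lebesgueM => //.
  apply: hwlog; first by rewrite unitmx_mul uW.
  have c0 : c != 0%R.
    apply: contraTneq uT => c0; rewrite unitmxE.
    rewrite (expand_det_col _ 0%R) big1 ?unitr0// => i _.
    case: (unliftP 0%R i) => [k|] ->; last by rewrite a0 mul0r.
    suff -> : T (lift 0%R k) 0%R = 0%R by rewrite mul0r.
    have /colP/(_ k) := c0; rewrite !mxE => <-; congr (T _ _); exact/val_inj.
  have -> : ((W 1 *m T) 0 0 = \sum_i (c i 0) ^+ 2)%R.
    rewrite mxE big_ord_recl /W block_mx00 mul1r a0 add0r.
    apply: eq_bigr => i _; rewrite block_mx0S scale1r /w expr2 !mxE.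
    by congr (T _ _ * T _ _)%R; exact/val_inj.
  apply: contra c0; rewrite psumr_eq0; last by move=> i _; exact: sqr_ge0.
  move=> /allP c0; apply/eqP/colP => i; rewrite [RHS]mxE; apply/eqP.
  by rewrite -sqrf_eq0; apply: c0; rewrite mem_index_enum.
pose a := T 0%R 0%R.
pose T' : 'M[R]_(1 + n) := T.
pose w := ursubmx T'; pose c := dlsubmx T'; pose B := drsubmx T'.
have Tul : ulsubmx T' = a%:M.
  rewrite [LHS]mx11_scalar; congr scalar_mx; rewrite !mxE /T' /a.
  by congr (T _ _); exact/val_inj.
have TE : T = ((block_mx 1%:M 0 (a^-1 *: c) 1%:M : 'M[R]_n.+1) *m
    (block_mx a%:M w 0 (B - a^-1 *: c *m w) : 'M[R]_n.+1))%R.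
  rewrite (@mulmx_block R 1 n 1 n 1 n) !mul1mx !mul0mx !addr0.
  rewrite mul_mx_scalar scalerA mulfV// scale1r addrCA subrr addr0 -Tul.
  by rewrite /w /c /B submxK.
have uB : (B - a^-1 *: c *m w)%R \in unitmx.
  move: uT; rewrite TE unitmx_mul => /andP[_].
  rewrite !unitmxE (@det_ublock _ 1 n) det_scalar expr1 unitrM.
  by move=> /andP[].
rewrite TE; apply: transforms_lebesgueM; first exact: transforms_lebesgue_lblock.
by apply: transforms_lebesgue_ublock => //; exact: IH.
Qed.

Lemma ge0_integral_mulmx n (T : 'M[R]_n) (f : 'cV[R]_n -> \bar R) :
  T \in unitmx -> measurable_fun [set: _] f -> (forall z, 0 <= f z) ->
  `|\det T|%:E * \int[lebesgue_cV n]_z f (T *m z) = \int[lebesgue_cV n]_z f z.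
Proof. by move=> /transforms_lebesgue_unitmx; exact. Qed.

Lemma preimage_scons_box n (B : 'I_n.+1 -> set R) :
  (fun z : R * 'cV[R]_n => scons z.1 z.2) @^-1` [set v | forall i, B i (v i 0%R)] =
  B 0%R `*` [set v : 'cV[R]_n | forall i, B (lift 0%R i) (v i 0%R)].
Proof.
apply/seteqP; split => [[x v]/= h|[x v]/= [h0 h] i].
  split=> [|i]; first by have := h 0%R; rewrite scons0.
  by have := h (lift 0%R i); rewrite sconsS.
by case: (unliftP 0%R i) => [k|] ->; rewrite ?scons0 // sconsS.
Qed.

Lemma measurable_box n (B : 'I_n -> set R) : (forall i, measurable (B i)) ->
  measurable [set v : 'cV[R]_n | forall i, B i (v i 0%R)].
Proof.
move=> mB; rewrite (_ : mkset _ =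
    \bigcap_(i in [set: 'I_n]) ((fun v : 'cV[R]_n => v i 0%R) @^-1` B i)); last first.
  by apply/seteqP; split => v /= h i *; exact: h.
apply: fin_bigcap_measurable => // i _; rewrite -[X in measurable X]setTI.
by apply: measurable_fun_coord => //; exact: mB.
Qed.

Lemma lebesgue_cV_boxS n (B : 'I_n.+1 -> set R) : (forall i, measurable (B i)) ->
  lebesgue_cV n.+1 [set v | forall i, B i (v i 0%R)] =
  mu (B 0%R) * lebesgue_cV n [set v : 'cV[R]_n | forall i, B (lift 0%R i) (v i 0%R)].
Proof.
move=> mB; transitivity ((mu \x lebesgue_cV n)
  ((fun z : R * 'cV[R]_n => scons z.1 z.2) @^-1` [set v | forall i, B i (v i 0%R)])) => //.
rewrite preimage_scons_box product_measure1E//; first exact: mB.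
by apply: (measurable_box (B := fun i => B (lift 0%R i))) => i; exact: mB.
Qed.

Lemma lebesgue_cV_box_fin n (B : 'I_n -> set R) : (forall i, measurable (B i)) ->
  (forall i, mu (B i) < +oo) -> lebesgue_cV n [set v | forall i, B i (v i 0%R)] < +oo.
Proof.
elim: n B => [|n IH] B mB Boo.
  by rewrite /= diracE ltry.
rewrite lebesgue_cV_boxS//; apply: lte_mul_pinfty => //.
  by rewrite ge0_fin_numE.
by apply: (IH (fun i => B (lift 0%R i))) => i; [exact: mB|exact: Boo].
Qed.

Lemma lebesgue_cV_cube n (r : R) :
  lebesgue_cV n [set v : 'cV[R]_n | forall i, (`|v i 0%R| <= r)%R] < +oo.
Proof.
have -> : [set v : 'cV[R]_n | forall i, (`|v i 0%R| <= r)%R] =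
    [set v : 'cV[R]_n | forall i, `[(- r)%R, r]%classic (v i 0%R)].
  by apply/seteqP; split => v /= h i; have := h i; rewrite /= in_itv/= ler_norml.
apply: (lebesgue_cV_box_fin (B := fun=> `[(- r)%R, r]%classic)) => // i.
by rewrite lebesgue_measure_itv/=; case: ifPn => _; rewrite ?ltry// -EFinB ltry.
Qed.

Lemma lebesgue_cV_point n (a : 'cV[R]_n) : (0 < n)%N -> lebesgue_cV n [set a] = 0.
Proof.
case: n a => // n a _.
have -> : [set a] = [set v : 'cV[R]_n.+1 | forall i, [set a i 0%R] (v i 0%R)].
  apply/seteqP; split => [v /= -> //|v /= h]; apply/colP => i; exact: h.
by rewrite (lebesgue_cV_boxS (B := fun i => [set a i 0%R]))// lebesgue_measure_set1 mul0e.
Qed.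

End lebesgue_cV_theory.

(** * Finite measures are determined by their Fourier transforms *)

Section bounded_integrals.
Context d (T : measurableType d) {R : realType} (mu : {measure set T -> \bar R}).
Hypothesis mu_fin : (mu setT < +oo)%E.

Lemma bounded_integrable (f : T -> R) (K : R) : measurable_fun setT f ->
  (forall x, `|f x| <= K) -> mu.-integrable setT (EFin \o f).
Proof.
move=> mf fK; apply: measurable_bounded_integrable => //.
exists K; split; first by rewrite num_real.
by move=> x Kx y _; apply: le_trans (ltW Kx).
Qed.

Lemma bounded_convergence (F : nat -> T -> R) (G : T -> R) (K : R) :
  (forall n, measurable_fun setT (F n)) -> (forall n x, `|F n x| <= K) ->
  (forall x, F n x @[n --> \oo] --> G x) ->
  \int[mu]_x F n x @[n --> \oo] --> \int[mu]_x G x.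
Proof.
move=> mF FK FG.
have mG : measurable_fun setT G by apply: (measurable_fun_cvg mF) => x _; exact: FG.
have GK x : `|G x| <= K.
  have : `|F n x| @[n --> \oo] --> `|G x| by apply: cvg_norm; exact: FG.
  move=> h; rewrite -(cvg_lim _ h)//; apply: limr_le; last exact: nearW.
  by apply: cvgP h.
have iK : mu.-integrable setT (cst K%:E).
  apply: (bounded_integrable (f := cst K) (K := `|K|)) => //.
apply: fine_cvg; rewrite fineK; last first.
  by apply: integrable_fin_num => //; exact: bounded_integrable mG GK.
apply: (@dominated_cvg _ _ _ mu setT measurableT (fun n x => (F n x)%:E) _ (cst K%:E)) => //.
- by move=> n; apply/measurable_EFinP.
- by move=> x _; apply: cvg_EFin; [exact: nearW|exact: FG].
- by move=> n x _; rewrite lee_fin.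
Qed.

End bounded_integrals.

Section smooth_step.
Context {R : realType}.

Definition smooth_step (s : R) : R := (3 * s - s ^+ 3) / 2.

Lemma smooth_stepN s : smooth_step (- s) = - smooth_step s.
Proof. by rewrite /smooth_step; field. Qed.

Lemma iter_smooth_stepN n s : iter n smooth_step (- s) = - iter n smooth_step s.
Proof. by elim: n => // n IH; rewrite !iterS IH smooth_stepN. Qed.

Let ss s : 0 <= s <= 1 -> s <= smooth_step s <= 1.
Proof.
rewrite /smooth_step => /andP[s0 s1].
have h1 : 0 <= (1 - s) ^+ 2 * (2 + s) by rewrite mulr_ge0 ?sqr_ge0//; lra.
have h2 : 0 <= s * ((1 - s) * (1 + s)) by rewrite !mulr_ge0//; lra.
apply/andP; split; rewrite -subr_ge0.
  by rewrite (_ : _ - _ = s * ((1 - s) * (1 + s)) / 2) ?divr_ge0//; field.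
by rewrite (_ : _ - _ = (1 - s) ^+ 2 * (2 + s) / 2) ?divr_ge0//; field.
Qed.

Lemma iter_smooth_step_itv n s : 0 <= s <= 1 -> s <= iter n smooth_step s <= 1.
Proof.
move=> /andP[s0 s1]; elim: n => [|n /andP[h1 h2]]; first by rewrite /= lexx.
rewrite iterS; set u := iter n _ s in h1 h2 *.
have /ss/andP[h3 ->] : 0 <= u <= 1 by rewrite (le_trans s0).
by rewrite (le_trans h1).
Qed.

Lemma norm_iter_smooth_step n s : `|s| <= 1 -> `|iter n smooth_step s| <= 1.
Proof.
wlog s0 : s / 0 <= s => [hwlog|].
  have [/hwlog//|/ltW s0] := leP 0 s.
  move=> s1; rewrite -(opprK s) iter_smooth_stepN normrN.
  by apply: hwlog; rewrite ?oppr_ge0// normrN.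
rewrite ger0_norm// => s1.
have /(iter_smooth_step_itv n)/andP[h1 h2] : 0 <= s <= 1 by rewrite s0.
by rewrite ger0_norm// (le_trans s0).
Qed.

(** The factor in [1 - smooth_step u = (1 - u) * ((1 - u) * (2 + u) / 2)] is at
    most [1 - s / 2] once [u >= s], and the iterates stay above [s]. *)
Lemma cvg_iter_smooth_step s : `|s| <= 1 ->
  iter n smooth_step s @[n --> \oo] --> Num.sg s.
Proof.
wlog s0 : s / 0 <= s => [hwlog|].
  have [/hwlog//|/ltW s0 s1] := leP 0 s.
  have : - iter n smooth_step (- s) @[n --> \oo] --> - Num.sg (- s).
    by apply: cvgN; apply: hwlog; rewrite ?oppr_ge0// normrN.
  rewrite sgrN opprK; apply: cvg_trans; apply: near_eq_cvg; apply: nearW => n.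
  by rewrite iter_smooth_stepN opprK.
rewrite ger0_norm// => s1; move: s0; rewrite le_eqVlt => /predU1P[<-|s0].
  rewrite sgr0 (_ : (fun n => _) = cst 0); first exact: cvg_cst.
  apply/funext; elim=> //= n ->; rewrite /smooth_step; by field.
rewrite gtr0_sg//.
have key n : 1 - iter n smooth_step s <= (1 - s / 2) ^+ n.
  elim: n => [|n IH] /=; first by rewrite expr0; lra.
  have /(iter_smooth_step_itv n)/andP[h1 h2] : 0 <= s <= 1 by rewrite ltW.
  rewrite exprS; set u := iter n _ s in IH h1 h2 *.
  apply: (@le_trans _ _ ((1 - s / 2) * (1 - u))).
    rewrite -subr_ge0 (_ : _ - _ = (1 - u) * (u - s + u * u) / 2).
      by rewrite divr_ge0// mulr_ge0 ?subr_ge0//; nra.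
    by rewrite /smooth_step; field.
  by rewrite ler_wpM2l//; lra.
have : (1 - s / 2) ^+ n @[n --> \oo] --> (0 : R).
  by apply: cvg_expr; rewrite ger0_norm; lra.
move=> h0; have h : 1 - (1 - s / 2) ^+ n @[n --> \oo] --> (1 : R).
  by rewrite -[X in _ --> X]subr0; apply: cvgB => //; exact: cvg_cst.
apply: (squeeze_cvgr _ h (cvg_cst (1 : R))).
apply: nearW => n.
have /(iter_smooth_step_itv n)/andP[h1 h2] : 0 <= s <= 1 by rewrite ltW.
by rewrite h2 andbT lerBlDr -lerBlDl.
Qed.

End smooth_step.

Section trigonometric_polynomials.
Context {R : realType} {m k : nat}.
Local Notation V := 'M[R]_(m, k).

Definition mxdot (A B : V) : R := \tr (A^T *m B).

Lemma mxdotE A B : mxdot A B = \sum_j \sum_i A i j * B i j.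
Proof.
by apply: eq_bigr => j _; rewrite mxE; apply: eq_bigr => i _; rewrite !mxE.
Qed.

Lemma mxdotDl A B C : mxdot (A + B) C = mxdot A C + mxdot B C.
Proof. by rewrite /mxdot linearD/= mulmxDl mxtraceD. Qed.

Lemma mxdotBl A B C : mxdot (A - B) C = mxdot A C - mxdot B C.
Proof. by rewrite /mxdot linearB/= mulmxBl raddfB. Qed.

Lemma mxdotZl a A C : mxdot (a *: A) C = a * mxdot A C.
Proof. by rewrite /mxdot linearZ/= -scalemxAl mxtraceZ. Qed.

Lemma mxdot0l C : mxdot 0 C = 0.
Proof. by rewrite /mxdot trmx0 mul0mx raddf0. Qed.

Lemma mxdot_delta i j C : mxdot (delta_mx i j) C = C i j.
Proof.
rewrite mxdotE (bigD1 j)//= (bigD1 i)//= big1 ?big1 => [|j' j'j|i' i'i].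
- by rewrite !mxE !eqxx mul1r !addr0.
- by apply: big1 => i' _; rewrite mxE (negbTE j'j) andbF mul0r.
- by rewrite mxE (negbTE i'i) mul0r.
Qed.

Lemma measurable_mxdot A : measurable_fun setT (mxdot A).
Proof.
rewrite (funext (mxdotE A)).
apply: measurable_sum => j; apply: measurable_sum => i.
by apply: measurable_funM => //; exact: measurable_fun_coord.
Qed.

(** The span of the functions [v |-> cos (<A, v> + c)]; the phases [c] make it
    contain the sines, and it is an algebra. *)
Inductive trigpoly : (V -> R) -> Prop :=
| trigpoly_cos A c : trigpoly (fun v => cos (mxdot A v + c))
| trigpolyD F G : trigpoly F -> trigpoly G -> trigpoly (fun v => F v + G v)
| trigpolyZ a F : trigpoly F -> trigpoly (fun v => a * F v).

Lemma trigpoly_ext F G : F =1 G -> trigpoly F -> trigpoly G.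
Proof. by move=> /funext ->. Qed.

Lemma trigpoly_cst c : trigpoly (fun=> c).
Proof.
apply: (trigpoly_ext _ (trigpolyZ c (trigpoly_cos 0 0))) => v.
by rewrite mxdot0l addr0 cos0 mulr1.
Qed.

Lemma trigpolyM F G : trigpoly F -> trigpoly G -> trigpoly (fun v => F v * G v).
Proof.
move=> + tG; elim=> [A c|F1 F2 _ h1 _ h2|a F1 _ h1]; last 2 first.
- by apply: (trigpoly_ext _ (trigpolyD h1 h2)) => v; rewrite mulrDl.
- by apply: (trigpoly_ext _ (trigpolyZ a h1)) => v; rewrite mulrA.
elim: tG => [B e|F1 F2 _ h1 _ h2|a F1 _ h1]; last 2 first.
- by apply: (trigpoly_ext _ (trigpolyD h1 h2)) => v; rewrite mulrDr.
- by apply: (trigpoly_ext _ (trigpolyZ a h1)) => v; rewrite mulrCA.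
apply: (trigpoly_ext _ (trigpolyZ 2^-1
  (trigpolyD (trigpoly_cos (A + B) (c + e)) (trigpoly_cos (A - B) (c - e))))) => v.
rewrite mxdotDl mxdotBl; set x := mxdot A v; set y := mxdot B v.
have -> : x + y + (c + e) = (x + c) + (y + e) by ring.
have -> : x - y + (c - e) = (x + c) - (y + e) by ring.
by rewrite cosD cosB; field.
Qed.

Lemma trigpoly_iter n F : trigpoly F -> trigpoly (fun v => iter n smooth_step (F v)).
Proof.
move=> tF; elim: n => //= n IH.
apply: (trigpoly_ext _ (trigpolyZ 2^-1 (trigpolyD (trigpolyZ 3 IH)
  (trigpolyZ (-1) (trigpolyM IH (trigpolyM IH IH)))))) => v.
by rewrite /smooth_step; field.
Qed.

Lemma trigpoly_prod (I : Type) (s : seq I) (F : I -> V -> R) :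
  (forall i, trigpoly (F i)) -> trigpoly (fun v => \prod_(i <- s) F i v).
Proof.
move=> tF; elim: s => [|i s IH].
  by apply: (trigpoly_ext _ (trigpoly_cst 1)) => v; rewrite big_nil.
by apply: (trigpoly_ext _ (trigpolyM (tF i) IH)) => v; rewrite big_cons.
Qed.

Lemma trigpoly_sin A c : trigpoly (fun v => sin (mxdot A v + c)).
Proof.
by apply: (trigpoly_ext _ (trigpoly_cos A (c - pi / 2))) => v; rewrite addrA cosBpihalf.
Qed.

Lemma trigpoly_measurable F : trigpoly F -> measurable_fun setT F.
Proof.
elim=> [A c|F1 F2 _ h1 _ h2|a F1 _ h1].
- apply: (@measurableT_comp _ _ _ _ _ _ (@cos R)).
    by apply: continuous_measurable_fun; exact: continuous_cos.
  by apply: measurable_funD => //; exact: measurable_mxdot.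
- exact: measurable_funD.
- exact: measurable_funM.
Qed.

Lemma trigpoly_bounded F : trigpoly F -> exists K, forall v, `|F v| <= K.
Proof.
elim=> [A c|F1 F2 _ [K1 h1] _ [K2 h2]|a F1 _ [K1 h1]].
- by exists 1 => v; exact: cos_max.
- by exists (K1 + K2) => v; rewrite (le_trans (ler_normD _ _))// lerD.
- by exists (`|a| * K1) => v; rewrite normrM ler_wpM2l.
Qed.

End trigonometric_polynomials.

Section law_uniqueness.
Context {R : realType} {m k : nat}.
Local Notation V := 'M[R]_(m, k).
Variables mu nu : {measure set V -> \bar R}.
Hypothesis mu_fin : (mu setT < +oo)%E.
Hypothesis nu_fin : (nu setT < +oo)%E.
Hypothesis eq_cos : forall A, \int[mu]_v cos (mxdot A v) = \int[nu]_v cos (mxdot A v).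
Hypothesis eq_sin : forall A, \int[mu]_v sin (mxdot A v) = \int[nu]_v sin (mxdot A v).

Let mC A : measurable_fun setT (fun v : V => cos (mxdot A v)).
Proof.
have := trigpoly_measurable (trigpoly_cos A 0).
by under eq_fun do rewrite addr0.
Qed.

Let mS A : measurable_fun setT (fun v : V => sin (mxdot A v)).
Proof.
have := trigpoly_measurable (trigpoly_sin A 0).
by under eq_fun do rewrite addr0.
Qed.

Let intC (la : {measure set V -> \bar R}) A c : (la setT < +oo)%E ->
  \int[la]_v cos (mxdot A v + c) =
  cos c * \int[la]_v cos (mxdot A v) - sin c * \int[la]_v sin (mxdot A v).
Proof.
move=> la_fin; under eq_Rintegral do rewrite cosD.
rewrite RintegralB//; last 2 first.
- apply: (bounded_integrable la_fin (K := 1)) => [|v].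
    by apply: measurable_funM => //; exact: mC.
  by rewrite normrM mulr_ile1// cos_max.
- apply: (bounded_integrable la_fin (K := 1)) => [|v].
    by apply: measurable_funM => //; exact: mS.
  by rewrite normrM mulr_ile1// sin_max.
under eq_Rintegral do rewrite mulrC.
under [in X in _ - X]eq_Rintegral do rewrite mulrC.
rewrite !RintegralZl//.
- by apply: (bounded_integrable la_fin (K := 1)) => // v; exact: sin_max.
- by apply: (bounded_integrable la_fin (K := 1)) => // v; exact: cos_max.
Qed.

Lemma eq_integral_trigpoly F : trigpoly F -> \int[mu]_v F v = \int[nu]_v F v.
Proof.
have iT (la : {measure set V -> \bar R}) (G : V -> R) : (la setT < +oo)%E ->
    trigpoly G -> la.-integrable setT (EFin \o G).
  move=> la_fin tG; have [K GK] := trigpoly_bounded tG.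
  exact: (bounded_integrable la_fin (trigpoly_measurable tG) GK).
elim=> [A c|F1 F2 t1 h1 t2 h2|a F1 t1 h1].
- by rewrite !intC// eq_cos eq_sin.
- by rewrite !RintegralD ?h1 ?h2//; exact: iT.
- by rewrite !RintegralZl ?h1//; exact: iT.
Qed.

Let eq_integral_lim (F : nat -> V -> R) G : (forall n, measurable_fun setT (F n)) ->
  (forall n v, `|F n v| <= 1) -> (forall v, F n v @[n --> \oo] --> G v) ->
  (forall n, \int[mu]_v F n v = \int[nu]_v F n v) ->
  \int[mu]_v G v = \int[nu]_v G v.
Proof.
move=> mF F1 FG FE.
have := bounded_convergence nu_fin mF F1 FG.
have := bounded_convergence mu_fin mF F1 FG.
under eq_fun do rewrite FE.
by move=> /cvg_lim <- // /cvg_lim <-.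
Qed.

Let cvg_prod_seq (I : Type) (s : seq I) (f : nat -> I -> R) (g : I -> R) :
  (forall i, f n i @[n --> \oo] --> g i) ->
  \prod_(i <- s) f n i @[n --> \oo] --> \prod_(i <- s) g i.
Proof.
move=> fg; elim: s => [|i s IH].
  by under eq_fun do rewrite big_nil; rewrite big_nil; exact: cvg_cst.
by under eq_fun do rewrite big_cons; rewrite big_cons; exact: cvgM.
Qed.

Let norm_prod_le1 (I : Type) (s : seq I) (f : I -> R) :
  (forall i, `|f i| <= 1) -> `|\prod_(i <- s) f i| <= 1.
Proof.
move=> f1; elim: s => [|i s IH]; first by rewrite big_nil normr1.
by rewrite big_cons normrM mulr_ile1.
Qed.

Let pos_step (x : R) := (Num.sg x ^+ 2 + Num.sg x) / 2.

Let pos_stepE x : pos_step x = (0 < x)%R%:R.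
Proof. by rewrite /pos_step; case: sgrP => _ /=; field. Qed.

Let orthant (A : V) : set V := [set v | forall i j, A i j < v i j].

Let measurable_orthant A : measurable (orthant A).
Proof.
rewrite (_ : orthant A = \bigcap_(p in [set: 'I_m * 'I_k])
    ((fun v : V => v p.1 p.2) @^-1` `]A p.1 p.2, +oo[%classic)); last first.
  apply/seteqP; split => v /= h; first by move=> [i j] _ /=; rewrite in_itv/= andbT.
  by move=> i j; have /= := h (i, j) I; rewrite in_itv/= andbT.
apply: fin_bigcap_measurable => // -[i j] _; rewrite -[X in measurable X]setTI.
exact: measurable_fun_coord.
Qed.

(** The indicator of an orthant is an iterated bounded limit of trigonometric
    polynomials: first smooth the square waves [sin ((v i j - A i j) / L)], then
    let the period [L] grow. *)
Lemma eq_measure_orthant A : mu (orthant A) = nu (orthant A).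
Proof.
pose J := enum [set: 'I_m * 'I_k].
pose a (p : 'I_m * 'I_k) := A p.1 p.2.
pose w L (p : 'I_m * 'I_k) (v : V) := sin ((v p.1 p.2 - a p) / L.+1%:R).
have tw L p : trigpoly (w L p).
  apply: (trigpoly_ext _ (trigpoly_sin (L.+1%:R^-1 *: delta_mx p.1 p.2)
    (- a p / L.+1%:R))) => v.
  by rewrite mxdotZl mxdot_delta /w mulrBl mulrC mulNr.
have w1 L p v : `|w L p v| <= 1 by exact: sin_max.
pose f L n (v : V) := \prod_(p <- J)
  (((iter n smooth_step (w L p v)) ^+ 2 + iter n smooth_step (w L p v)) / 2).
have tf L n : trigpoly (f L n).
  apply: trigpoly_prod => p; have t := trigpoly_iter n (tw L p).
  apply: (trigpoly_ext _ (trigpolyZ 2^-1 (trigpolyD (trigpolyM t t) t))) => v.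
  by rewrite mulrC expr2.
have f1 L n v : `|f L n v| <= 1.
  apply: norm_prod_le1 => p; have := norm_iter_smooth_step n (w1 L p v).
  by rewrite !ler_norml => /andP[? ?]; apply/andP; split; nra.
pose g L (v : V) := \prod_(p <- J) pos_step (w L p v).
have fg L v : f L n v @[n --> \oo] --> g L v.
  apply: cvg_prod_seq => p; have h := cvg_iter_smooth_step (w1 L p v).
  by apply: cvgM; [apply: cvgD => //; exact: (cvgM h h)|exact: cvg_cst].
have Eg L : \int[mu]_v g L v = \int[nu]_v g L v.
  apply: (eq_integral_lim (F := f L)) => [n|n v|v|n] //.
  - exact: (trigpoly_measurable (tf L n)).
  - exact: (eq_integral_trigpoly (tf L n)).
have g1 L v : `|g L v| <= 1.
  by apply: norm_prod_le1 => p; rewrite pos_stepE; case: ltP => _ /=; rewrite ?normr1 ?normr0.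
have mg L : measurable_fun setT (g L).
  have mf n : measurable_fun setT (f L n) by exact: (trigpoly_measurable (tf L n)).
  by apply: (measurable_fun_cvg mf) => v _; exact: fg.
pose h (v : V) : R := \prod_(p <- J) (0 < v p.1 p.2 - a p)%R%:R.
have gh v : g L v @[L --> \oo] --> h v.
  apply: cvg_prod_seq => p; rewrite /w; set x := v _ _ - _.
  suff e : \forall L \near \oo, pos_step (sin (x / L.+1%:R)) = (0 < x)%R%:R.
    by apply: cvg_near_cst.
  near=> L; rewrite pos_stepE; congr (_%:R); congr nat_of_bool.
  have L0 : (0 : R) < L.+1%:R by rewrite ltr0n.
  have xL : `|x| / L.+1%:R < pi.
    rewrite ltr_pdivrMr// -ltr_pdivrMl ?pi_gt0//.
    apply: (@lt_trans _ _ L%:R); last by rewrite ltr_nat.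
    by near: L; exact: nbhs_infty_gtr.
  have [x0|x0] := ltP 0 x.
    by apply: sin_gt0_pi; rewrite divr_gt0//= -(gtr0_norm x0).
  apply/negbTE; rewrite -leNgt -oppr_ge0 -sinN -mulNr; apply: sin_ge0_pi.
  by apply/andP; split; [rewrite divr_ge0 ?oppr_ge0// ltW|rewrite ltW// -(ler0_norm x0)].
have hE v : h v = \1_(orthant A) v.
  rewrite /h indicE; have [vA|vA] := boolP (v \in orthant A).
    rewrite big1// => -[i j] _; rewrite subr_gt0.
    by move: vA; rewrite inE => /(_ i j) /= ->.
  have [i [j vij]] : exists i j, ~~ (A i j < v i j).
    apply/not_existsP => h1; move/negP: vA; apply; rewrite inE => i j.
    by apply: contrapT => nv; apply: (h1 i); exists j; exact/negP.
  have jJ : (i, j) \in J by rewrite mem_enum inE.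
  by rewrite (big_rem _ jJ)/= subr_gt0 (negbTE vij) mul0r.
have : \int[mu]_v h v = \int[nu]_v h v.
  exact: (eq_integral_lim mg g1 gh).
under eq_Rintegral do rewrite hE.
under [RHS]eq_Rintegral do rewrite hE.
rewrite /Rintegral !integral_indic//= !setIT => e.
rewrite -(@fineK _ (mu _)) ?e ?fineK// ge0_fin_numE//.
- by apply: le_lt_trans nu_fin; apply: le_measure => //; rewrite inE.
- by apply: le_lt_trans mu_fin; apply: le_measure => //; rewrite inE.
Unshelve. all: by end_near. Qed.

Let orthantI : setI_closed (range orthant).
Proof.
move=> _ _ [A _ <-] [B _ <-]; exists (\matrix_(i, j) Num.max (A i j) (B i j)) => //.
apply/seteqP; split => [v h|v [hA hB] i j] /=.
  by split => i j; have := h i j; rewrite /= mxE gt_max => /andP[].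
by rewrite mxE gt_max hA hB.
Qed.

Let low (n : nat) : V := const_mx (- n%:R).

Let low_cover : \bigcup_n orthant (low n) = setT.
Proof.
apply/seteqP; split => // v _.
exists (Num.truncn (\sum_i \sum_j `|v i j|)).+1 => // i j; rewrite mxE.
rewrite ltrNl; apply: (@le_lt_trans _ _ `|v i j|); first by rewrite -normrN ler_norm.
apply: (@le_lt_trans _ _ (\sum_i \sum_j `|v i j|)); last exact: truncnS_gt.
by rewrite (bigD1 i)//= (bigD1 j)//= -addrA lerDl addr_ge0// ?sumr_ge0// => i' _; rewrite sumr_ge0.
Qed.

Let borel_orthant : @measurable _ V = <<s range orthant >>.
Proof.
apply/seteqP; split => [B mB|]; last first.
  by apply: smallest_sub; [exact: sigma_algebra_measurable|move=> _ [A _ <-]].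
pose W := g_sigma_algebraType (range orthant).
suff mid : measurable_fun [set: W] (id : W -> V).
  by have := mid measurableT B mB; rewrite setTI.
apply: measurable_fun_mxP => i j.
apply: (measurability _ (RGenOInfty.measurableE R)).
move=> _ [_ [a ->] <-]; rewrite setTI.
rewrite (_ : _ @^-1` _ = \bigcup_n orthant (\matrix_(i', j')
  if (i' == i) && (j' == j) then a else - n%:R)).
  by apply: bigcup_measurable => n _; apply: sub_sigma_algebra; eexists.
apply/seteqP; split => v /=.
  rewrite in_itv/= andbT => av; have [n _ vn] : (\bigcup_n orthant (low n)) v by rewrite low_cover.
  exists n => // i' j'; rewrite mxE; case: ifPn => [/andP[/eqP -> /eqP ->] //|_].
  by have := vn i' j'; rewrite mxE.
by move=> [n _] /(_ i j); rewrite mxE !eqxx/= in_itv/= andbT.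
Qed.

(** The orthants form a generating system stable under intersection, and the Fourier transform
determines a finite measure on each of them. *)
Theorem eq_measure_fourier B : measurable B -> mu B = nu B.
Proof.
apply: (measure_unique (range orthant) (fun n => orthant (low n))) => //.
- by move=> _ [A _ <-]; exact: eq_measure_orthant.
- by move=> n; apply: le_lt_trans mu_fin; apply: le_measure; rewrite ?inE.
Qed.

End law_uniqueness.

(** * The matrix exponential *)

Section entry_norm.
Context {R : realType}.

(** The sum of the absolute values of the entries: a submultiplicative norm that
    is easier to compute with than the operator norm. *)
Definition norm1 m n (A : 'M[R]_(m, n)) : R := \sum_i \sum_j `|A i j|.

Lemma norm1_ge0 m n (A : 'M[R]_(m, n)) : 0 <= norm1 A.
Proof. by apply: sumr_ge0 => i _; apply: sumr_ge0. Qed.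

Lemma entry_le_norm1 m n (A : 'M[R]_(m, n)) i j : `|A i j| <= norm1 A.
Proof.
rewrite /norm1 (bigD1 i)//= (bigD1 j)//= -addrA lerDl addr_ge0 ?sumr_ge0//.
by move=> k _; apply: sumr_ge0.
Qed.

Lemma norm1D m n (A B : 'M[R]_(m, n)) : norm1 (A + B) <= norm1 A + norm1 B.
Proof.
rewrite /norm1 -big_split/=; apply: ler_sum => i _; rewrite -big_split/=.
by apply: ler_sum => j _; rewrite mxE; exact: ler_normD.
Qed.

Lemma norm1Z m n a (A : 'M[R]_(m, n)) : norm1 (a *: A) = `|a| * norm1 A.
Proof.
rewrite /norm1 mulr_sumr; apply: eq_bigr => i _; rewrite mulr_sumr.
by apply: eq_bigr => j _; rewrite mxE normrM.
Qed.

Lemma norm1_eq0 m n (A : 'M[R]_(m, n)) : (norm1 A == 0) = (A == 0).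
Proof.
apply/eqP/eqP => [A0|->]; last first.
  by rewrite /norm1 big1// => i _; rewrite big1// => j _; rewrite mxE normr0.
apply/matrixP => i j; rewrite mxE; apply/eqP; rewrite -normr_le0 -A0.
exact: entry_le_norm1.
Qed.

Lemma norm1M m n p (A : 'M[R]_(m, n)) (B : 'M[R]_(n, p)) :
  norm1 (A *m B) <= norm1 A * norm1 B.
Proof.
rewrite /norm1 mulr_suml; apply: ler_sum => i _.
apply: (@le_trans _ _ (\sum_j \sum_k `|A i k| * `|B k j|)).
  apply: ler_sum => j _; rewrite mxE (le_trans (ler_norm_sum _ _ _))//.
  by apply: ler_sum => k _; rewrite normrM.
rewrite exchange_big/= mulr_suml; apply: ler_sum => k _; rewrite -mulr_sumr.
apply: ler_wpM2l => //.
by rewrite [leRHS](bigD1 k)//= lerDl sumr_ge0// => k' _; exact: sumr_ge0.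
Qed.

Lemma cvg_mx m n (F : nat -> 'M[R]_(m, n)) (L : 'M[R]_(m, n)) :
  (forall i j, F k i j @[k --> \oo] --> L i j) -> F k @[k --> \oo] --> L.
Proof.
move=> FL; apply/cvg_ballP => e e0.
have h : \forall k \near \oo, forall ij : 'I_m * 'I_n,
    ball (L ij.1 ij.2) e (F k ij.1 ij.2).
  by apply: filter_forall => -[i j]; move/cvg_ballP: (FL i j); apply.
by near=> k; split=> // i j; have := near h k => /(_ _ (i, j)); apply.
Unshelve. all: by end_near. Qed.

Lemma cvg_sumr (I : Type) (s : seq I) (f : nat -> I -> R) (g : I -> R) :
  (forall i, f k i @[k --> \oo] --> g i) ->
  \sum_(i <- s) f k i @[k --> \oo] --> \sum_(i <- s) g i.
Proof.
move=> fg; elim: s => [|i s IH].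
  by under eq_fun do rewrite big_nil; rewrite big_nil; exact: cvg_cst.
by under eq_fun do rewrite big_cons; rewrite big_cons; exact: cvgD.
Qed.

End entry_norm.

Section matrix_exponential.
Context {R : realType} {n : nat}.
Implicit Types A B C : 'M[R]_n.

Let coef B A i j : nat -> R := fun k => (B *m A ^+ k) i j * k`!%:R^-1.

Let power_entry A k i j : `|(A ^+ k) i j| <= norm1 A ^+ k.
Proof.
elim: k i j => [|k IH] i j.
  by rewrite !expr0 mxE; case: eqP => _; rewrite ?normr1 ?normr0.
rewrite !exprS mxE (le_trans (ler_norm_sum _ _ _))//.
rewrite /norm1 mulr_suml.
apply: (@le_trans _ _ (\sum_l `|A i l| * norm1 A ^+ k)).
  by apply: ler_sum => l _; rewrite normrM ler_wpM2l// IH.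
rewrite -mulr_suml [leRHS](bigD1 i)//= lerDl.
by rewrite sumr_ge0// => i' _; rewrite mulr_ge0 ?sumr_ge0 ?exprn_ge0 ?norm1_ge0.
Qed.

Let scale_power A x k : (x *: A) ^+ k = x ^+ k *: A ^+ k.
Proof.
elim: k => [|k IH]; first by rewrite !expr0 scale1r.
by rewrite !exprS IH -!mulmxE -scalemxAl -scalemxAr scalerA.
Qed.

Let coef_bound A i j k x :
  `|coef 1%:M A i j k * x ^+ k| <= exp_coeff (norm1 A * `|x|) k.
Proof.
rewrite /coef mul1mx !normrM normrX exp_coeffE/= exprMn.
rewrite [`|_^-1|]ger0_norm ?invr_ge0//.
rewrite -mulrA mulrCA ler_wpM2l ?invr_ge0//.
by rewrite ler_wpM2r ?exprn_ge0// power_entry.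
Qed.

Let cvg_coef1 A i j x : cvgn (pseries (coef 1%:M A i j) x).
Proof.
apply: normed_cvg; apply: (@series_le_cvg _ _ (exp_coeff (norm1 A * `|x|))).
- by move=> k; exact: normr_ge0.
- by move=> k; rewrite exp_coeff_ge0// mulr_ge0 ?norm1_ge0.
- by move=> k; exact: coef_bound.
- exact: is_cvg_series_exp_coeff.
Qed.

Let pseries_coefE B A i j x N : pseries (coef B A i j) x N =
  \sum_l B i l * pseries (coef 1%:M A l j) x N.
Proof.
rewrite /pseries /series/=; under [RHS]eq_bigr do rewrite mulr_sumr.
rewrite exchange_big/=; apply: eq_bigr => k _.
rewrite /coef mxE !mulr_suml; apply: eq_bigr => l _.
by rewrite mul1mx !mulrA.
Qed.

Lemma mexpE A i j x : mexp (x *: A) i j = limn (pseries (coef 1%:M A i j) x).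
Proof.
rewrite /mexp.
have cv : (series (fun k => k`!%:R^-1 *: (x *: A) ^+ k) : nat -> 'M[R]_n) N @[N --> \oo] -->
    (\matrix_(i, j) limn (pseries (coef 1%:M A i j) x) : 'M[R]_n).
  apply: cvg_mx => i' j'; rewrite mxE.
  rewrite (_ : (fun _ => _) = pseries (coef 1%:M A i' j') x); first exact: cvg_coef1.
  apply/funext => N; rewrite /pseries /series/= summxE; apply: eq_bigr => k _.
  by rewrite mxE scale_power mxE /coef mul1mx; ring.
have -> : limn (series (fun k => k`!%:R^-1 *: (x *: A) ^+ k) : nat -> 'M[R]_n) =
    (\matrix_(i, j) limn (pseries (coef 1%:M A i j) x) : 'M[R]_n).
  by apply: cvg_lim; [exact: norm_hausdorff|exact: cv].
by rewrite mxE.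
Qed.

Let cvg_coef B A i j x :
  pseries (coef B A i j) x N @[N --> \oo] --> (B *m mexp (x *: A)) i j.
Proof.
rewrite (_ : pseries _ _ = fun N => \sum_l B i l * pseries (coef 1%:M A l j) x N).
  rewrite mxE; apply: cvg_sumr => l; apply: cvgMr.
  by rewrite mexpE; exact: cvg_coef1.
by apply/funext => N; exact: pseries_coefE.
Qed.

Lemma is_derive_mulmx_mexp B A i j (t : R) :
  is_derive t (1 : R) (fun x : R => (B *m mexp (x *: A)) i j) ((B *m A *m mexp (t *: A)) i j).
Proof.
have diffE C : pseries_diffs (coef C A i j) = coef (C *m A) A i j.
  apply/funext => k; rewrite /pseries_diffs /coef exprS -mulmxE mulmxA.
  rewrite factS natrM invfM mulrCA; congr (_ * _).
  by rewrite mulrA mulfV ?mul1r// pnatr_eq0.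
have cC C K : cvgn (pseries (coef C A i j) K).
  by apply/cvg_ex; exists ((C *m mexp (K *: A)) i j); exact: cvg_coef.
have := @pseries_snd_diffs R (coef B A i j) (`|t| + 1) t (cC _ _).
rewrite !diffE => /(_ (cC _ _) (cC _ _)).
rewrite (ger0_norm (addr_ge0 (normr_ge0 t) ler01)) ltrDl ltr01 => /(_ isT).
rewrite (_ : (fun x => limn _) = (fun x => (B *m mexp (x *: A)) i j)).
  by rewrite (cvg_lim _ (@cvg_coef (B *m A) A i j t)).
by apply/funext => x; apply/cvg_lim => //; exact: cvg_coef.
Qed.

Lemma is_derive_mexp A i j (t : R) :
  is_derive t (1 : R) (fun x : R => mexp (x *: A) i j) ((A *m mexp (t *: A)) i j).
Proof.
have := is_derive_mulmx_mexp 1%:M A i j t.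
by under eq_fun do rewrite mul1mx; rewrite mul1mx.
Qed.

Lemma mexp_comm A t : A *m mexp (t *: A) = mexp (t *: A) *m A.
Proof.
apply/matrixP => i j.
have h : pseries (coef A A i j) t N @[N --> \oo] --> (mexp (t *: A) *m A) i j.
  rewrite mxE (_ : pseries _ _ = fun N => \sum_l pseries (coef 1%:M A i l) t N * A l j).
    by apply: cvg_sumr => l; apply: cvgMl; rewrite mexpE; exact: cvg_coef1.
  apply/funext => N; rewrite /pseries /series/=.
  under [RHS]eq_bigr do rewrite mulr_suml.
  rewrite exchange_big/=; apply: eq_bigr => k _.
  rewrite /coef mulmxE -exprS exprSr -mulmxE mxE !mulr_suml; apply: eq_bigr => l _.
  by rewrite mul1mx; ring.
by rewrite -(cvg_lim _ h)// -(cvg_lim _ (@cvg_coef A A i j t)).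
Qed.

Lemma mexp_norm_le A t i j : `|mexp (t *: A) i j| <= expR (norm1 A * `|t|).
Proof.
rewrite mexpE.
have h : `|pseries (coef 1%:M A i j) t N| @[N --> \oo] -->
    `|limn (pseries (coef 1%:M A i j) t)|.
  by apply: cvg_norm; exact: cvg_coef1.
rewrite -(cvg_lim _ h)//; apply: limr_le; first exact: cvgP h.
apply: nearW => N; rewrite /pseries /series/= (le_trans (ler_norm_sum _ _ _))//.
apply: (@le_trans _ _ (series (exp_coeff (norm1 A * `|t|)) N)).
  by apply: ler_sum => k _; exact: coef_bound.
apply: nondecreasing_cvgn_le; last exact: is_cvg_series_exp_coeff.
apply: nondecreasing_series => k _ _.
by rewrite exp_coeff_ge0// mulr_ge0 ?norm1_ge0.
Qed.

Lemma mexp0 : mexp (0 : 'M[R]_n) = 1%:M.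
Proof.
apply/matrixP => i j; rewrite -(scale0r (1%:M : 'M[R]_n)) mexpE.
apply/cvg_lim => //; rewrite -(cvg_shiftS _).
rewrite (_ : (fun _ => _) = cst ((1%:M : 'M[R]_n) i j)); first exact: cvg_cst.
apply/funext => N; rewrite /pseries /series/= big_nat_recl// expr0 mulr1 big1 ?addr0.
  by rewrite /coef expr0 mul1mx fact0 invr1 mulr1.
by move=> k _; rewrite exprS mul0r mulr0.
Qed.

End matrix_exponential.

Section mx_derivative.
Context {R : realType}.

Definition is_mx_derive m n (F : R -> 'M[R]_(m, n)) (t : R) (G : 'M[R]_(m, n)) :=
  forall i j, is_derive t (1 : R) (fun x : R => F x i j : R) (G i j : R).

Lemma is_derive_eq' (f : R -> R) (t a b : R) :
  is_derive t (1 : R) f a -> a = b -> is_derive t (1 : R) f b.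
Proof. by move=> + <-. Qed.

Lemma is_mx_derive_eq m n (F : R -> 'M[R]_(m, n)) t G G' :
  is_mx_derive F t G -> G = G' -> is_mx_derive F t G'.
Proof. by move=> + <-. Qed.

Lemma is_mx_derive_mul m n p (F : R -> 'M[R]_(m, n)) (H : R -> 'M[R]_(n, p)) t F' H' :
  is_mx_derive F t F' -> is_mx_derive H t H' ->
  is_mx_derive (fun x => F x *m H x) t (F' *m H t + F t *m H').
Proof.
move=> dF dH i j.
rewrite (_ : (fun x => _) = \sum_k ((fun x => F x i k) * (fun x => H x k j))); last first.
  by apply/funext => x; rewrite mxE fct_sumE.
apply: is_derive_eq'; first by apply: is_derive_sum => k; apply: is_deriveM.
rewrite !mxE -big_split/=; apply: eq_bigr => k _.
by rewrite addrC; congr (_ + _); exact: mulrC.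
Qed.

Lemma is_mx_derive_rev m n (F : R -> 'M[R]_(m, n)) c t G :
  is_mx_derive F (c - t) G -> is_mx_derive (fun x => F (c - x)) t (- G).
Proof.
move=> dF i j.
have d1 : is_derive t (1 : R) (fun x : R => c - x) (-1 : R).
  by have := is_deriveB (is_derive_cst c t (1 : R)) (is_derive_id t (1 : R)); rewrite sub0r.
have := @is_derive1_comp R (fun x => F x i j) (fun x : R => c - x) _ _ _ (dF i j) d1.
by rewrite mulrN1 mxE.
Qed.

Lemma is_mx_derive_scale m n (f : R -> R) (F : R -> 'M[R]_(m, n)) t f' G :
  is_derive t (1 : R) f f' -> is_mx_derive F t G ->
  is_mx_derive (fun x => f x *: F x) t (f' *: F t + f t *: G).
Proof.
move=> df dF i j.
rewrite (_ : (fun x => _) = f * (fun x => F x i j)); last first.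
  by apply/funext => x; rewrite mxE.
apply: (is_derive_eq' (is_deriveM df (dF i j))).
by rewrite !mxE addrC; congr (_ + _); exact: mulrC.
Qed.

Lemma is_mx_derive0_cst m n (F : R -> 'M[R]_(m, n)) (x y : R) :
  (forall t, is_mx_derive F t 0) -> F x = F y.
Proof.
move=> dF; apply/matrixP => i j.
apply: (is_derive_0_is_cst (f := fun x => F x i j)) => t.
by have := dF t i j; rewrite mxE.
Qed.

Lemma is_derive_expRMr (c x : R) :
  is_derive x (1 : R) (fun y : R => expR (y * c)) (expR (x * c) * c).
Proof.
have d1 : is_derive x (1 : R) (fun y : R => y * c) c.
  by apply: is_derive_eq; rewrite scaler0 add0r /GRing.scale/= mulr1.
exact: (@is_derive1_comp R expR (fun y : R => y * c) x _ _ (is_derive_expR _) d1).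
Qed.

End mx_derivative.

Section mexp_group.
Context {R : realType} {n : nat}.
Implicit Types A : 'M[R]_n.

Lemma is_mx_derive_mexp A t : is_mx_derive (fun x => mexp (x *: A)) t (A *m mexp (t *: A)).
Proof. by move=> i j; exact: is_derive_mexp. Qed.

Lemma mexpDl A s t : mexp ((s + t) *: A) = mexp (s *: A) *m mexp (t *: A).
Proof.
pose F x := mexp (x *: A) *m mexp ((s + t - x) *: A).
have dF x : is_mx_derive F x 0.
  apply: is_mx_derive_eq.
    apply: is_mx_derive_mul; first exact: is_mx_derive_mexp.
    apply: (is_mx_derive_rev (F := fun x => mexp (x *: A))); exact: is_mx_derive_mexp.
  by rewrite mulmxN mulmxA -mexp_comm subrr.
have := is_mx_derive0_cst 0 s dF.
rewrite /F scale0r mexp0 mul1mx subr0 => ->.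
by rewrite addrAC subrr add0r.
Qed.

Lemma mexpNK A t : mexp (t *: A) *m mexp (- t *: A) = 1%:M.
Proof. by rewrite -mexpDl subrr scale0r mexp0. Qed.

Lemma mexp_unitmx A t : mexp (t *: A) \in unitmx.
Proof. by have /mulmx1_unit[] := mexpNK A t. Qed.

Lemma mexp_shift A c t : mexp (t *: (A + c%:M)) = expR (t * c) *: mexp (t *: A).
Proof.
pose F x := mexp (x *: (A + c%:M)) *m (expR (x * - c) *: mexp ((0 - x) *: A)).
have dF x : is_mx_derive F x 0.
  apply: is_mx_derive_eq.
    apply: is_mx_derive_mul; first exact: is_mx_derive_mexp.
    apply: (is_mx_derive_scale (is_derive_expRMr (- c) x)).
    apply: (is_mx_derive_rev (F := fun x => mexp (x *: A))); exact: is_mx_derive_mexp.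
  rewrite mexp_comm -mulmxA -mulmxDr.
  set E := mexp ((0 - x) *: A); set e := expR _.
  suff -> : (A + c%:M) *m (e *: E) + (e * - c *: E + e *: - (A *m E)) = 0 by rewrite mulmx0.
  rewrite mulmxDl mul_scalar_mx -scalemxAr scalerN scalerA mulrN scaleNr.
  by rewrite [X in _ + X]addrC addrACA subrr add0r mulrC subrr.
have := is_mx_derive0_cst t 0 dF.
rewrite /F !scale0r !subr0 mul0r expR0 scale1r scale0r mexp0 mulmx1 sub0r => Ft.
have : mexp (t *: (A + c%:M)) *m (expR (t * - c) *: mexp (- t *: A)) *m
  (expR (t * c) *: mexp (t *: A)) = expR (t * c) *: mexp (t *: A).
  by rewrite Ft mul1mx.
have -> : mexp (t *: (A + c%:M)) *m (expR (t * - c) *: mexp (- t *: A)) *m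
    (expR (t * c) *: mexp (t *: A)) = mexp (t *: (A + c%:M)).
  rewrite -!scalemxAr -!scalemxAl scalerA -expRD mulrN subrr -mulmxA.
  rewrite expR0 scale1r; have := mexpNK A (- t); rewrite opprK => ->.
  by rewrite mulmx1.
by [].
Qed.

End mexp_group.

Section determinant.
Context {R : realType}.

Lemma is_derive_prod_ord n (f : 'I_n -> R -> R) (f' : 'I_n -> R) (t : R) :
  (forall i, is_derive t (1 : R) (f i) (f' i)) ->
  is_derive t (1 : R) (fun x => \prod_i f i x)
    (\sum_i f' i * \prod_(k | k != i) f k t).
Proof.
elim: n f f' => [|n IH] f f' df.
  rewrite big_ord0 (_ : (fun x => _) = cst 1); first exact: is_derive_cst.
  by apply/funext => x; rewrite big_ord0.
have := is_deriveM (df ord0) (IH _ _ (fun i => df (lift ord0 i))).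
rewrite (_ : f ord0 * _ = (fun x => \prod_i f i x)); last first.
  by apply/funext => x; rewrite big_ord_recl.
move=> d1; apply: (is_derive_eq' d1).
rewrite addrC big_ord_recl; congr (_ + _).
  rewrite /GRing.scale/= mulrC; congr (_ * _).
  by rewrite [RHS]big_mkcond big_ord_recl/= mul1r.
rewrite /GRing.scale/= mulr_sumr; apply: eq_bigr => i _.
rewrite mulrCA; congr (_ * _).
rewrite [RHS]big_mkcond big_ord_recl/=; congr (_ * _).
by rewrite [LHS]big_mkcond; apply: eq_bigr => k _; rewrite (inj_eq lift_inj).
Qed.

Lemma is_derive_sum_seq (I : Type) (s : seq I) (f : I -> R -> R) (f' : I -> R) (t : R) :
  (forall i, is_derive t (1 : R) (f i) (f' i)) ->
  is_derive t (1 : R) (fun x => \sum_(i <- s) f i x) (\sum_(i <- s) f' i).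
Proof.
move=> df; elim: s => [|i s IH].
  rewrite big_nil (_ : (fun x => _) = cst 0); first exact: is_derive_cst.
  by apply/funext => x; rewrite big_nil.
have := is_deriveD (df i) IH; rewrite big_cons.
by rewrite (_ : f i + _ = fun x => \sum_(i <- i :: s) f i x)//; apply/funext => x; rewrite big_cons.
Qed.

Lemma is_derive_det1 n (F : R -> 'M[R]_n) (t : R) (G : 'M[R]_n) :
  F t = 1%:M -> is_mx_derive F t G ->
  is_derive t (1 : R) (fun x => \det (F x)) (\tr G).
Proof.
move=> Ft dF.
pose P (s : {perm 'I_n}) x := \prod_i F x i (s i).
have dP (s : {perm 'I_n}) : is_derive t (1 : R) (P s) (\tr G *+ (s == perm_one _)).
  apply: (is_derive_eq' (@is_derive_prod_ord n (fun i x => F x i (s i))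
    (fun i => G i (s i)) t (fun i => dF i (s i)))).
  rewrite Ft; have [->|s1] := eqVneq s.
    rewrite mulr1n; apply: eq_bigr => i _; rewrite perm1 big1 ?mulr1// => k _.
    by rewrite perm1 mxE eqxx.
  rewrite mulr0n big1// => i _.
  have [k ki sk] : exists2 k, k != i & s k != k.
    apply: contrapT => h; move/eqP: s1; apply; apply/permP => j; rewrite perm1.
    have fix_ k : k != i -> s k = k.
      by move=> ki; apply/eqP; apply: contrapT => /negP sk; apply: h; exists k.
    have [ji|/fix_//] := eqVneq j i.
    have [sj|/fix_] := eqVneq (s j) i; first by rewrite sj ji.
    by move=> /perm_inj.
  by rewrite (bigD1 k)//= mxE eq_sym (negbTE sk) mul0r mulr0.
have dS (s : {perm 'I_n}) : is_derive t (1 : R) (fun x => (-1) ^+ s * P s x)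
    ((-1) ^+ s * (\tr G *+ (s == perm_one _))).
  have := is_deriveM (is_derive_cst ((-1) ^+ s : R) t (1 : R)) (dP s).
  by rewrite scaler0 addr0.
have d1 := @is_derive_sum_seq _ (index_enum {perm 'I_n}) _ _ t dS.
apply: (is_derive_eq' d1).
rewrite (bigD1 (perm_one _))//= eqxx mulr1n odd_perm1 expr0 mul1r big1 ?addr0// => s s1.
by rewrite (negbTE s1) mulr0n mulr0.
Qed.

(** Liouville's formula. *)
Lemma det_mexp n (A : 'M[R]_n) t : \det (mexp (t *: A)) = expR (t * \tr A).
Proof.
pose f x := \det (mexp (x *: A)) * expR (x * - \tr A).
have df x : is_derive x (1 : R) f 0.
  have d0 : is_derive (0 : R) (1 : R) (fun h => \det (mexp (h *: A))) (\tr A).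
    apply: is_derive_det1; first by rewrite scale0r mexp0.
    by have := is_mx_derive_mexp A 0; rewrite scale0r mexp0 mulmx1.
  have d1 : is_derive x (1 : R) (fun y : R => y - x) (1 : R).
    by have := is_deriveB (is_derive_id x (1 : R)) (is_derive_cst x x (1 : R)); rewrite subr0.
  have d2 : is_derive x (1 : R) (fun y => \det (mexp ((y - x) *: A))) (\tr A).
    have d0' : is_derive (x - x) (1 : R) (fun h => \det (mexp (h *: A))) (\tr A).
      by rewrite subrr.
    have := @is_derive1_comp R (fun h => \det (mexp (h *: A))) (fun y : R => y - x) _ _ _ d0' d1.
    by rewrite mulr1.
  have d3 : is_derive x (1 : R) (fun y => \det (mexp (y *: A)))
      (\det (mexp (x *: A)) * \tr A).
    have := is_deriveM (is_derive_cst (\det (mexp (x *: A))) x (1 : R)) d2.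
    rewrite scaler0 addr0.
    rewrite (_ : cst _ * _ = fun y => \det (mexp (y *: A))) //.
    by apply/funext => y; rewrite -[in RHS](subrK x y) addrC mexpDl det_mulmx.
  have := is_deriveM d3 (is_derive_expRMr (- \tr A) x).
  move=> d4; apply: (is_derive_eq' d4).
  by rewrite /GRing.scale/=; ring.
have := is_derive_0_is_cst t 0 df.
rewrite /f scale0r mexp0 det1 mul0r expR0 mulr1 => /(congr1 (fun z => z * expR (t * \tr A))).
by rewrite -mulrA -expRD mulrN addNr expR0 mulr1 mul1r.
Qed.

End determinant.

(** * Matrix powers and their growth *)

Section growth.
Context {R : realType}.

(** A damped planar rotation with a bounded forcing term stays bounded: for
    [delta = - la] and [M = 2 K^2 / delta^2], the quantity
    [exp (delta t) (a^2 + b^2 - M)] decreases. *)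
Lemma damped_bounded (a b p q : R -> R) (la mu K : R) : la < 0 ->
  (forall t, is_derive t (1 : R) a (la * a t - mu * b t + p t)) ->
  (forall t, is_derive t (1 : R) b (la * b t + mu * a t + q t)) ->
  (forall t, 0 <= t -> `|p t| <= K) -> (forall t, 0 <= t -> `|q t| <= K) ->
  exists K', forall t, 0 <= t -> `|a t| <= K' /\ `|b t| <= K'.
Proof.
move=> la0 da db pK qK.
pose g t := a t * a t + b t * b t.
pose M := 2 * K ^+ 2 / la ^+ 2.
pose g' t := 2 * (la * g t + (a t * p t + b t * q t)).
have dg t : is_derive t (1 : R) g (g' t).
  have d1 := is_deriveD (is_deriveM (da t) (da t)) (is_deriveM (db t) (db t)).
  apply: (is_derive_eq' d1).
  by rewrite /g' /g /GRing.scale/=; ring.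
pose h t := expR (t * - la) * (g t - M).
pose h' t := expR (t * - la) * (- la * (g t - M) + g' t).
have dh t : is_derive t (1 : R) h (h' t).
  have d1 := is_deriveB (dg t) (is_derive_cst M t (1 : R)).
  have d2 := is_deriveM (is_derive_expRMr (- la) t) d1.
  apply: (is_derive_eq' d2).
  rewrite /h' (_ : (g - cst M) t = g t - M)// subr0 /GRing.scale/=; ring.
have h'0 t : 0 <= t -> h' t <= 0.
  move=> t0; rewrite /h' pmulr_rle0 ?expR_gt0//.
  have pq : p t ^+ 2 + q t ^+ 2 <= 2 * K ^+ 2.
    have := pK _ t0; have := qK _ t0; rewrite !ler_norml => /andP[? ?] /andP[? ?].
    by nra.
  have e : - la * (g t - M) + g' t =
     (la * (a t + p t / la) ^+ 2 + la * (b t + q t / la) ^+ 2) +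
     (p t ^+ 2 + q t ^+ 2 - 2 * K ^+ 2) / - la.
    by rewrite /g' /g /M; field; rewrite lt_eqF.
  rewrite e -[leRHS]addr0 lerD//.
    by rewrite -mulrDr nmulr_rle0// addr_ge0 ?sqr_ge0.
  by rewrite pmulr_lle0 ?invr_gt0 ?oppr_gt0// subr_le0.
have hle t : 0 <= t -> h t <= h 0.
  rewrite le_eqVlt => /predU1P[<-//|t0].
  have hc : {within `[0, t], continuous h}.
    by apply: derivable_within_continuous => x _; have [] := dh x.
  have [c] := MVT t0 (fun x _ => dh x) hc.
  rewrite in_itv/= => /andP[c0 _] hh.
  by rewrite -subr_le0 hh subr0 pmulr_lle0// h'0// ltW.
exists (1 + (g 0 + M)) => t t0.
have M0 : 0 <= M by rewrite divr_ge0 ?sqr_ge0// mulr_ge0 ?sqr_ge0.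
have g00 : 0 <= g 0 by rewrite /g -!expr2 addr_ge0 ?sqr_ge0.
have gt : g t <= g 0 + M.
  have := hle t t0; rewrite /h mul0r expR0 mul1r.
  have e1 : 1 <= expR (t * - la).
    by rewrite -expR0 ler_expR mulr_ge0// oppr_ge0 ltW.
  set e := expR _ in e1 *; move=> ?; nra.
have sq x : x ^+ 2 <= g t -> `|x| <= 1 + (g 0 + M).
  move=> xg; rewrite ler_norml; apply/andP; split; nra.
by split; apply: sq; rewrite /g -!expr2 ?lerDl ?lerDr sqr_ge0.
Qed.

Local Notation Cx := R[i].
Local Notation toC := (map_mx (real_complex R)).

Let mulmx_toC_Re m n p (B : 'M[Cx]_(m, n)) (D : 'M[R]_(n, p)) :
  map_mx (@complex.Re R) (B *m toC D) = map_mx (@complex.Re R) B *m D.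
Proof.
apply/matrixP => i j; rewrite !mxE raddf_sum; apply: eq_bigr => k _.
by rewrite !mxE; case: (B i k) => x y /=; rewrite mulr0 subr0.
Qed.

Let mulmx_toC_Im m n p (B : 'M[Cx]_(m, n)) (D : 'M[R]_(n, p)) :
  map_mx (@complex.Im R) (B *m toC D) = map_mx (@complex.Im R) B *m D.
Proof.
apply/matrixP => i j; rewrite !mxE raddf_sum; apply: eq_bigr => k _.
by rewrite !mxE; case: (B i k) => x y /=; rewrite mulr0 add0r.
Qed.

(** Multiplying by one factor [D - z] of the characteristic polynomial turns the
    evolution of [B *m exp (t D)] into [w' = z w + w1] with [w1] one factor
    closer to zero, so that boundedness propagates back from the zero matrix. *)
Lemma bounded_annihilated n (D : 'M[R]_n.+1) (s : seq Cx) (B : 'M[Cx]_n.+1) :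
  (forall z, z \in s -> complex.Re z < 0) ->
  B *m horner_mx (toC D) (\prod_(z <- s) ('X - z%:P)) = 0 ->
  forall i j, exists K, forall t, 0 <= t ->
    `|(map_mx (@complex.Re R) B *m mexp (t *: D)) i j| <= K /\
    `|(map_mx (@complex.Im R) B *m mexp (t *: D)) i j| <= K.
Proof.
elim: s B => [|z s IH] B sB.
  rewrite big_nil rmorph1 -[1]/(1%:M) mulmx1 => -> i j; exists 0 => t _.
  by rewrite !map_mx0 !mul0mx mxE normr0.
rewrite big_cons rmorphM/= -mulmxE mulmxA.
rewrite rmorphB/= horner_mx_X horner_mx_C mulmxBr mul_mx_scalar.
set B' := (_ - _) => B'0 i j.
have zs w : w \in s -> complex.Re w < 0 by move=> ws; apply: sB; rewrite inE ws orbT.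
have [K BK] := IH B' zs B'0 i j.
set B1 := map_mx (@complex.Re R) B; set B2 := map_mx (@complex.Im R) B.
pose x := complex.Re z; pose y := complex.Im z.
have e1 : B1 *m D = x *: B1 - y *: B2 + map_mx (@complex.Re R) B'.
  apply/matrixP => i' j'; rewrite -mulmx_toC_Re /B' !mxE /x /y.
  by case: (B i' j') => a b; case: (z) => c d; rewrite raddfB/=; ring.
have e2 : B2 *m D = x *: B2 + y *: B1 + map_mx (@complex.Im R) B'.
  apply/matrixP => i' j'; rewrite -mulmx_toC_Im /B' !mxE /x /y.
  by case: (B i' j') => a b; case: (z) => c d; rewrite raddfB/=; ring.
have x0 : x < 0 by apply: sB; rewrite inE eqxx.
apply: (@damped_bounded (fun t => (B1 *m mexp (t *: D)) i j)
  (fun t => (B2 *m mexp (t *: D)) i j)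
  (fun t => (map_mx (@complex.Re R) B' *m mexp (t *: D)) i j)
  (fun t => (map_mx (@complex.Im R) B' *m mexp (t *: D)) i j) x y K x0) => t.
- apply: (is_derive_eq' (is_derive_mulmx_mexp B1 D i j t)).
  by rewrite e1 !mulmxDl mulNmx -!scalemxAl !mxE.
- apply: (is_derive_eq' (is_derive_mulmx_mexp B2 D i j t)).
  by rewrite e2 !mulmxDl -!scalemxAl !mxE.
- by move=> /BK[].
- by move=> /BK[].
Qed.

Lemma bounded_mexp n (D : 'M[R]_n) :
  (forall z, spectrum D z -> complex.Re z < 0) ->
  exists K, forall t, 0 <= t -> norm1 (mexp (t *: D)) <= K.
Proof.
case: n D => [|n] D sD.
  by exists 0 => t _; rewrite /norm1 big_ord0.
have [s] := closed_field_poly_normal (char_poly (toC D)).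
rewrite (monicP (char_poly_monic _)) scale1r => sE.
have zs z : z \in s -> complex.Re z < 0.
  move=> zs; apply: sD; rewrite /spectrum/= eigenvalue_root_char sE.
  by rewrite root_prod_XsubC.
have : 1%:M *m horner_mx (toC D) (\prod_(z <- s) ('X - z%:P)) = 0.
  by rewrite -sE mul1mx Cayley_Hamilton.
move=> /(bounded_annihilated zs) h.
have /choice[K hK] (p : 'I_n.+1 * 'I_n.+1) : exists K, forall t, 0 <= t ->
    `|mexp (t *: D) p.1 p.2| <= K.
  have [K hK] := h p.1 p.2; exists K => t t0; have [+ _] := hK t t0.
  rewrite (_ : map_mx _ _ = 1%:M) ?mul1mx//.
  by apply/matrixP => i j; rewrite !mxE raddfMn.
exists (\sum_i \sum_j K (i, j)) => t t0.
by apply: ler_sum => i _; apply: ler_sum => j _; exact: (hK (i, j)).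
Qed.

Lemma mexp_growth n (D : 'M[R]_n) (c : R) :
  (forall z, spectrum D z -> complex.Re z < c) ->
  exists2 K, 0 < K & forall t, 0 <= t -> norm1 (mexp (t *: D)) <= K * expR (t * c).
Proof.
move=> sD; have [|K hK] := @bounded_mexp n (D + (- c)%:M).
  move=> z zD.
  have : spectrum D (z + (c%:C)%C).
    have [v + v0] := eigenvalueP zD => vD; apply/eigenvalueP; exists v => //.
    rewrite scalerDl -vD map_mxD/= mulmxDr map_scalar_mx/= mul_mx_scalar.
    by rewrite rmorphN/= scaleNr subrK.
  by move=> /sD; case: (z) => a b /=; rewrite -subr_lt0 addrK.
exists (`|K| + 1) => [|t t0]; first by rewrite ltr_wpDl.
rewrite (_ : D = (D + (- c)%:M) + c%:M); last by rewrite raddfN/= subrK.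
rewrite mexp_shift norm1Z ger0_norm ?expR_ge0// mulrC ler_wpM2r ?expR_ge0//.
by rewrite (le_trans (hK t t0))// (le_trans (ler_norm _))// lerDl.
Qed.

End growth.

Section matrix_power.
Context {R : realType} {n : nat}.
Implicit Types A D E : 'M[R]_n.

Lemma mpow1 A : mpow 1 A = 1%:M.
Proof. by rewrite /mpow ln1 scale0r mexp0. Qed.

Lemma mpowM A (r s : R) : 0 < r -> 0 < s -> mpow (r * s) A = mpow r A *m mpow s A.
Proof. by move=> r0 s0; rewrite /mpow lnM ?posrE// mexpDl. Qed.

Lemma mpow_unitmx A r : mpow r A \in unitmx.
Proof. exact: mexp_unitmx. Qed.

Lemma mpowVK A r : 0 < r -> mpow r A *m mpow r^-1 A = 1%:M.
Proof. by move=> r0; rewrite -mpowM ?invr_gt0// mulfV ?gt_eqF// mpow1. Qed.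

Lemma mpowKV A r : 0 < r -> mpow r^-1 A *m mpow r A = 1%:M.
Proof. by move=> r0; rewrite -mpowM ?invr_gt0// mulVf ?gt_eqF// mpow1. Qed.

Lemma det_mpow A (r : R) : 0 < r -> \det (mpow r A) = r `^ \tr A.
Proof.
by move=> r0; rewrite /mpow det_mexp /powR gt_eqF// mulrC.
Qed.

Lemma mpow_shift A (c r : R) : 0 < r -> mpow r (A + c%:M) = r `^ c *: mpow r A.
Proof. by move=> r0; rewrite /mpow mexp_shift /powR gt_eqF// mulrC. Qed.

(** The growth bound for the exponential of [ln r] times the matrix, read in the variable [r]. *)
Lemma mpow_growth_ge1 D (c : R) : (forall z, spectrum D z -> complex.Re z < c) ->
  exists2 K, 0 < K & forall r : R, 1 <= r -> norm1 (mpow r D) <= K * r `^ c.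
Proof.
move=> /mexp_growth[K K0 hK]; exists K => // r r1.
have r0 : 0 < r by rewrite (lt_le_trans ltr01).
by rewrite /powR gt_eqF// [c * _]mulrC; apply: hK; rewrite ln_ge0.
Qed.

Lemma mpow_growth_le1 D (c : R) : (forall z, spectrum D z -> c < complex.Re z) ->
  exists2 K, 0 < K & forall r : R, 0 < r <= 1 -> norm1 (mpow r D) <= K * r `^ c.
Proof.
move=> sD; have [|K K0 hK] := @mexp_growth R n (- D) (- c).
  move=> z zD; have : spectrum D (- z).
    have [v + v0] := eigenvalueP zD => vD; apply/eigenvalueP; exists v => //.
    by rewrite scaleNr -vD map_mxN mulmxN opprK.
  by move=> /sD; rewrite raddfN ltrNr.
exists K => // r /andP[r0 r1].
have := hK (- ln r); rewrite oppr_ge0 ln_le0// => /(_ isT).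
by rewrite scaleNr scalerN opprK mulrNN /powR gt_eqF// [c * _]mulrC.
Qed.

Lemma mpow_lipschitz A (a b : R) : 0 < a -> exists2 L, 0 < L &
  forall r s, a <= r <= b -> a <= s <= b -> norm1 (mpow r A - mpow s A) <= L * `|r - s|.
Proof.
move=> a0.
pose T : R := `|ln a| + `|ln b|.
have lnT (r : R) : a <= r <= b -> `|ln r| <= T.
  move=> /andP[ar rb]; rewrite /T.
  have r0 : 0 < r by exact: lt_le_trans ar.
  have b0 : 0 < b by exact: lt_le_trans rb.
  have : ln a <= ln r by rewrite ler_ln// posrE.
  have : ln r <= ln b by rewrite ler_ln// posrE.
  have := ler_norm (ln b); have := ler_norm (- ln a); rewrite normrN.
  have := normr_ge0 (ln a); have := normr_ge0 (ln b).
  by rewrite ler_norml => *; apply/andP; split; lra.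
pose K := norm1 A * (\sum_(i < n) \sum_(j < n) expR (norm1 A * T)) / a.
have K0 : 0 <= K.
  rewrite divr_ge0 ?(ltW a0)// mulr_ge0 ?norm1_ge0// sumr_ge0// => i _.
  by rewrite sumr_ge0// => j _; exact: expR_ge0.
have dm (i j : 'I_n) (x : R) : 0 < x -> is_derive x (1 : R) (fun r : R => mpow r A i j)
    ((A *m mpow x A) i j * x^-1).
  move=> x0; exact: (@is_derive1_comp R (fun t => mexp (t *: A) i j) (@ln R) x _ _
    (is_derive_mexp A i j (ln x)) (is_derive1_ln x0)).
have dK (i j : 'I_n) (x : R) : a <= x <= b -> `|(A *m mpow x A) i j * x^-1| <= K.
  move=> /[dup] xab /andP[ax _]; have x0 : 0 < x by exact: lt_le_trans ax.
  rewrite normrM [`|x^-1|]ger0_norm ?invr_ge0 ?(ltW x0)//.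
  rewrite /K ler_pM ?invr_ge0 ?(ltW x0)// ?lef_pV2 ?posrE//.
  rewrite (le_trans (entry_le_norm1 _ _ _))// (le_trans (norm1M _ _))//.
  rewrite ler_wpM2l ?norm1_ge0// ler_sum// => i' _; rewrite ler_sum// => j' _.
  rewrite (le_trans (mexp_norm_le _ _ _ _))// ler_expR ler_wpM2l ?norm1_ge0//.
  exact: lnT.
have lip (i j : 'I_n) (r s : R) : a <= r <= b -> a <= s <= b ->
    `|mpow r A i j - mpow s A i j| <= K * `|r - s|.
  wlog rs : r s / r < s => [hwlog rab sab|rab sab].
    have [rs|rs|->] := ltgtP r s; [exact: hwlog| |by rewrite !subrr normr0 mulr0].
    by rewrite distrC [`|r - s|]distrC; exact: hwlog.
  have r0 : 0 < r by move: rab => /andP[ar _]; exact: lt_le_trans ar.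
  have h1 (x : R) : x \in `]r, s[ -> is_derive x (1 : R) (fun r : R => mpow r A i j)
      ((A *m mpow x A) i j * x^-1).
    by rewrite in_itv/= => /andP[rx _]; apply: dm; exact: lt_trans rx.
  have h2 : {within `[r, s], continuous (fun r : R => mpow r A i j)}.
    apply: derivable_within_continuous => x; rewrite in_itv/= => /andP[rx _].
    by have [] := dm i j x (lt_le_trans r0 rx).
  have [c] := MVT rs h1 h2; rewrite in_itv/= => /andP[rc cs] e.
  rewrite distrC e normrM [`|r - s|]distrC ler_wpM2r//; apply: dK.
  move: rab sab => /andP[ar _] /andP[_ sb].
  by rewrite (le_trans ar (ltW rc)) (le_trans (ltW cs) sb).
exists (\sum_(i < n) \sum_(j < n) K + 1) => [|r s rab sab].
  by rewrite ltr_wpDl// sumr_ge0// => i _; rewrite sumr_ge0.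
apply: (@le_trans _ _ ((\sum_(i < n) \sum_(j < n) K) * `|r - s|)); last first.
  by rewrite ler_wpM2r// lerDl.
rewrite mulr_suml ler_sum// => i _; rewrite mulr_suml ler_sum// => j _.
by rewrite !mxE; exact: lip.
Qed.

Lemma continuous_mpow_entry A i j (r : R) : 0 < r ->
  {for r, continuous (fun r : R => mpow r A i j)}.
Proof.
move=> r0.
have d : is_derive r (1 : R) (fun r : R => mpow r A i j) ((A *m mpow r A) i j * r^-1).
  exact: (@is_derive1_comp R (fun t => mexp (t *: A) i j) (@ln R) r _ _
    (is_derive_mexp A i j (ln r)) (is_derive1_ln r0)).
by apply: differentiable_continuous; apply/derivable1_diffP; have [] := d.
Qed.

End matrix_power.

(** * Euclidean and operator norms *)

Section euclidean_norms.
Context {R : realType}.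

Lemma dotC n (u v : 'cV[R]_n) : dot u v = dot v u.
Proof. by apply: eq_bigr => i _; rewrite mulrC. Qed.

Lemma dotDl n (u v w : 'cV[R]_n) : dot (u + v) w = dot u w + dot v w.
Proof. by rewrite /dot -big_split/=; apply: eq_bigr => i _; rewrite mxE mulrDl. Qed.

Lemma dotDr n (u v w : 'cV[R]_n) : dot w (u + v) = dot w u + dot w v.
Proof. by rewrite !(dotC w) dotDl. Qed.

Lemma dotZl n a (u w : 'cV[R]_n) : dot (a *: u) w = a * dot u w.
Proof. by rewrite /dot mulr_sumr; apply: eq_bigr => i _; rewrite mxE mulrA. Qed.

Lemma dotZr n a (u w : 'cV[R]_n) : dot w (a *: u) = a * dot w u.
Proof. by rewrite !(dotC w) dotZl. Qed.

Lemma dotNr n (u w : 'cV[R]_n) : dot w (- u) = - dot w u.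
Proof. by rewrite -scaleN1r dotZr mulN1r. Qed.

Lemma dot0l n (w : 'cV[R]_n) : dot 0 w = 0.
Proof. by rewrite /dot big1// => i _; rewrite mxE mul0r. Qed.

Lemma dot_suml n (I : Type) (s : seq I) (Q : pred I) (F : I -> 'cV[R]_n) w :
  dot (\sum_(i <- s | Q i) F i) w = \sum_(i <- s | Q i) dot (F i) w.
Proof. by elim/big_rec2: _ => [|i y1 y2 _ <-]; rewrite ?dot0l ?dotDl. Qed.

Lemma dot_sumr n (I : Type) (s : seq I) (Q : pred I) (F : I -> 'cV[R]_n) w :
  dot w (\sum_(i <- s | Q i) F i) = \sum_(i <- s | Q i) dot w (F i).
Proof. by rewrite dotC dot_suml; apply: eq_bigr => i _; rewrite dotC. Qed.

Lemma dot_mulmx m n (A : 'M[R]_(m, n)) u v : dot u (A *m v) = dot (A^T *m u) v.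
Proof.
rewrite /dot; under eq_bigr do rewrite mxE mulr_sumr.
rewrite exchange_big/=; apply: eq_bigr => j _; rewrite mxE mulr_suml.
by apply: eq_bigr => i _; rewrite !mxE mulrA (mulrC (u i 0)).
Qed.

Lemma dot_delta n i (v : 'cV[R]_n) : dot (delta_mx i 0) v = v i 0.
Proof.
rewrite /dot (bigD1 i)//= mxE !eqxx mul1r big1 ?addr0// => j ji.
by rewrite mxE (negbTE ji) mul0r.
Qed.

Lemma dot_ge0 n (v : 'cV[R]_n) : 0 <= dot v v.
Proof. by apply: sumr_ge0 => i _; rewrite -expr2 sqr_ge0. Qed.

Lemma enorm_ge0 n (v : 'cV[R]_n) : 0 <= enorm v.
Proof. exact: sqrtr_ge0. Qed.

Lemma sqr_enorm n (v : 'cV[R]_n) : enorm v ^+ 2 = dot v v.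
Proof. by rewrite sqr_sqrtr// dot_ge0. Qed.

Lemma entry_le_enorm n (v : 'cV[R]_n) i : `|v i 0| <= enorm v.
Proof.
rewrite -sqrtr_sqr ler_wsqrtr// /dot (bigD1 i)//= expr2 lerDl.
by apply: sumr_ge0 => j _; rewrite -expr2 sqr_ge0.
Qed.

Lemma norm1_cV n (v : 'cV[R]_n) : norm1 v = \sum_i `|v i 0|.
Proof. by rewrite /norm1; apply: eq_bigr => i _; rewrite big_ord1. Qed.

Lemma enorm_le_norm1 n (v : 'cV[R]_n) : enorm v <= norm1 v.
Proof.
rewrite -(ger0_norm (norm1_ge0 v)) -sqrtr_sqr ler_wsqrtr// /dot norm1_cV expr2 mulr_suml.
apply: ler_sum => i _; rewrite -[leLHS]ger0_norm -?expr2 ?sqr_ge0// normrX expr2 ler_wpM2l//.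
by rewrite (bigD1 i)//= lerDl sumr_ge0.
Qed.

Lemma enorm0 n : enorm (0 : 'cV[R]_n) = 0.
Proof. by rewrite /enorm dot0l sqrtr0. Qed.

Lemma enormZ n a (v : 'cV[R]_n) : enorm (a *: v) = `|a| * enorm v.
Proof. by rewrite /enorm dotZl dotZr mulrA -expr2 sqrtrM ?sqr_ge0// sqrtr_sqr. Qed.

Lemma enormN n (v : 'cV[R]_n) : enorm (- v) = enorm v.
Proof. by rewrite -scaleN1r enormZ normrN normr1 mul1r. Qed.

Lemma cauchy_schwarz n (u v : 'cV[R]_n) : dot u v <= enorm u * enorm v.
Proof.
have [u0|u0] := eqVneq (enorm u) 0.
  rewrite u0 mul0r /dot big1// => i _.
  by have := entry_le_enorm u i; rewrite u0 normr_le0 => /eqP ->; rewrite mul0r.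
have [v0|v0] := eqVneq (enorm v) 0.
  rewrite v0 mulr0 /dot big1// => i _.
  by have := entry_le_enorm v i; rewrite v0 normr_le0 => /eqP ->; rewrite mulr0.
have ab : 0 < enorm u * enorm v by rewrite mulr_gt0// lt_neqAle eq_sym ?u0 ?v0 enorm_ge0.
have := dot_ge0 (enorm v *: u - enorm u *: v).
rewrite !dotDl !dotDr !dotNr -!scaleNr !dotZl !dotZr -!sqr_enorm (dotC v u).
set a := enorm u in ab *; set b := enorm v in ab *; set c := dot u v.
move=> h; rewrite -(ler_pM2l ab); move: h; nra.
Qed.

Lemma enormD n (u v : 'cV[R]_n) : enorm (u + v) <= enorm u + enorm v.
Proof.
rewrite -(@ler_pXn2r _ 2)// ?nnegrE ?addr_ge0 ?enorm_ge0//.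
rewrite sqr_enorm dotDl !dotDr (dotC v u) sqrrD -!sqr_enorm.
have := cauchy_schwarz u v; lra.
Qed.

Lemma enorm_sum n (I : Type) (s : seq I) (F : I -> 'cV[R]_n) :
  enorm (\sum_(i <- s) F i) <= \sum_(i <- s) enorm (F i).
Proof.
elim: s => [|i s IH]; first by rewrite !big_nil enorm0.
by rewrite !big_cons (le_trans (enormD _ _))// lerD2l.
Qed.

Lemma norm1_tr m n (A : 'M[R]_(m, n)) : norm1 A^T = norm1 A.
Proof.
rewrite /norm1 exchange_big/=; apply: eq_bigr => i _.
by apply: eq_bigr => j _; rewrite mxE.
Qed.

Lemma enorm_mulmx m n (A : 'M[R]_(m, n)) v : enorm (A *m v) <= norm1 A * enorm v.
Proof.
rewrite (le_trans (enorm_le_norm1 _))// norm1_cV /norm1 mulr_suml ler_sum// => i _.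
rewrite mxE (le_trans (ler_norm_sum _ _ _))// mulr_suml ler_sum// => j _.
by rewrite normrM ler_wpM2l// entry_le_enorm.
Qed.

Lemma enorm_delta n i : enorm (delta_mx i 0 : 'cV[R]_n) = 1.
Proof. by rewrite /enorm dot_delta mxE !eqxx sqrtr1. Qed.

Let opset m n (A : 'M[R]_(m, n)) :=
  [set enorm (A *m v) | v in [set v : 'cV[R]_n | enorm v <= 1]].

Let opset_sup m n (A : 'M[R]_(m, n)) : has_sup (opset A).
Proof.
split; first by exists (enorm (A *m 0)); exists 0 => //=; rewrite enorm0 ler01.
exists (norm1 A) => _ [v /= v1 <-]; rewrite (le_trans (enorm_mulmx _ _))//.
by rewrite ler_piMr// norm1_ge0.
Qed.

Lemma opnorm_le_norm1 m n (A : 'M[R]_(m, n)) : opnorm A <= norm1 A.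
Proof.
apply: ge_sup; first by have [] := opset_sup A.
move=> _ [v /= v1 <-]; rewrite (le_trans (enorm_mulmx _ _))//.
by rewrite ler_piMr// norm1_ge0.
Qed.

Lemma enorm_le_opnorm m n (A : 'M[R]_(m, n)) v : enorm v <= 1 -> enorm (A *m v) <= opnorm A.
Proof.
by move=> v1; apply: ub_le_sup; [have [] := opset_sup A|exists v].
Qed.

Lemma opnorm_ge0 m n (A : 'M[R]_(m, n)) : 0 <= opnorm A.
Proof.
apply: le_trans (enorm_le_opnorm A (v := 0) _); first exact: enorm_ge0.
by rewrite enorm0.
Qed.

Lemma entry_le_opnorm m n (A : 'M[R]_(m, n)) i j : `|A i j| <= opnorm A.
Proof.
apply: le_trans (enorm_le_opnorm A (v := delta_mx j 0) _); last by rewrite enorm_delta.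
by rewrite -colE; apply: le_trans (entry_le_enorm _ i); rewrite mxE.
Qed.

Lemma norm1_le_opnorm m n (A : 'M[R]_(m, n)) : norm1 A <= (m * n)%:R * opnorm A.
Proof.
apply: (@le_trans _ _ (\sum_(i < m) \sum_(j < n) opnorm A)).
  by apply: ler_sum => i _; apply: ler_sum => j _; exact: entry_le_opnorm.
by rewrite !sumr_const !card_ord -mulrnA mulnC -[leLHS]mulr_natl.
Qed.

Lemma opnormD m n (A B : 'M[R]_(m, n)) : opnorm (A + B) <= opnorm A + opnorm B.
Proof.
apply: ge_sup; first by have [] := opset_sup (A + B).
move=> _ [v /= v1 <-]; rewrite mulmxDl (le_trans (enormD _ _))//.
by rewrite lerD// enorm_le_opnorm.
Qed.

Lemma norm1N m n (A : 'M[R]_(m, n)) : norm1 (- A) = norm1 A.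
Proof. by rewrite -scaleN1r norm1Z normrN normr1 mul1r. Qed.

Lemma measurable_fun_norm1_lipschitz m n (f : 'M[R]_(m, n) -> R) :
  (forall A B, f A - f B <= norm1 (A - B)) -> measurable_fun setT f.
Proof.
move=> fL.
have cf : continuous f.
  move=> A; apply/(@cvgrPdist_lt R R _ (nbhs A) (nbhs_filter A)) => e e0.
  have K0 : 0 < (\sum_(i < m) \sum_(j < n) (1 : R)) + 1.
    by rewrite ltr_wpDl// sumr_ge0// => i _; rewrite sumr_ge0.
  set K := (_ + 1) in K0.
  have eK : 0 < e / K by rewrite divr_gt0.
  apply/nbhs_ballP; exists (e / K) => //= B [_ AB].
  have AB1 : norm1 (A - B) < e.
    apply: (@le_lt_trans _ _ ((\sum_(i < m) \sum_(j < n) (1 : R)) * (e / K))).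
      rewrite mulr_suml ler_sum// => i _; rewrite mulr_suml ler_sum// => j _.
      by rewrite mul1r !mxE; apply/ltW; exact: AB.
    by rewrite mulrA ltr_pdivrMr// mulrC ltr_pM2l// ltrDl.
  rewrite ltr_norml; apply/andP; split; last by apply: le_lt_trans AB1.
  rewrite ltrNl opprB; apply: le_lt_trans AB1.
  by rewrite -norm1N opprB.
apply: (measurability _ (measurable_realfun.RGenOpens.measurableE R)).
move=> _ [_ [a [b ->]] <-]; rewrite setTI; apply: sub_sigma_algebra.
by apply: open_comp; [move=> A _; exact: cf|exact: interval_open].
Qed.

Lemma measurable_opnorm m n : measurable_fun setT (@opnorm R m n).
Proof.
apply: measurable_fun_norm1_lipschitz => A B.
rewrite lerBlDr (le_trans _ (lerD (opnorm_le_norm1 _) (lexx _)))//.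
by rewrite -{1}(subrK B A) opnormD.
Qed.

Lemma measurable_norm1 m n : measurable_fun setT (@norm1 R m n).
Proof.
apply: measurable_fun_norm1_lipschitz => A B.
by rewrite lerBlDr -{1}(subrK B A) norm1D.
Qed.

Lemma measurable_enorm n : measurable_fun setT (@enorm R n).
Proof.
apply: measurable_fun_norm1_lipschitz => A B.
rewrite lerBlDr (le_trans _ (lerD (enorm_le_norm1 _) (lexx _)))//.
by rewrite -{1}(subrK B A) enormD.
Qed.

Lemma measurable_dot n (u : 'cV[R]_n) : measurable_fun setT (dot u).
Proof.
by apply: measurable_sum => i; apply: measurable_funM => //; exact: measurable_fun_coord.
Qed.

Lemma powRD_le (al x y : R) : 0 < al -> 0 <= x -> 0 <= y ->
  (x + y) `^ al <= 2 `^ al * (x `^ al + y `^ al).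
Proof.
move=> al0 x0 y0; wlog xy : x y x0 y0 / x <= y => [hwlog|].
  have [xy|/ltW yx] := leP x y; first exact: hwlog.
  by rewrite addrC [X in _ * X]addrC; exact: hwlog.
apply: (@le_trans _ _ ((2 * y) `^ al)).
  apply: ge0_ler_powR; rewrite ?nnegrE ?addr_ge0 ?mulr_ge0 ?(ltW al0)//.
  by rewrite mulr_natl mulr2n lerD2r.
by rewrite powRM// ler_wpM2l ?powR_ge0// lerDr powR_ge0.
Qed.

End euclidean_norms.

(** * Characteristic functions and tails *)

Section characteristic_functions.
Context {dO : measure_display} {Omega : measurableType dO} {R : realType}.
Variable P : probability Omega R.
Implicit Types Z : Omega -> R.

Definition has_charfun Z (a : R) :=
  \int[P]_w cos (Z w) = a /\ \int[P]_w sin (Z w) = 0.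

Lemma charfunP Z a : charfun P Z = real_complex R a <-> has_charfun Z a.
Proof.
rewrite /charfun unlock /has_charfun /Rintegral.
by split => [[-> ->]|[-> ->]].
Qed.

Let P_fin : (P setT < +oo)%E.
Proof. by rewrite probability_setT ltry. Qed.

Lemma measurable_cos_comp d' (T : measurableType d') (f : T -> R) :
  measurable_fun setT f -> measurable_fun setT (fun w => cos (f w)).
Proof.
move=> mf; apply: (measurableT_comp (f := @cos R)) => //.
by apply: continuous_measurable_fun; exact: continuous_cos.
Qed.

Lemma measurable_sin_comp d' (T : measurableType d') (f : T -> R) :
  measurable_fun setT f -> measurable_fun setT (fun w => sin (f w)).
Proof.
move=> mf; apply: (measurableT_comp (f := @sin R)) => //.
by apply: continuous_measurable_fun; exact: continuous_sin.
Qed.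

Lemma integrable_cos Z : measurable_fun setT Z ->
  P.-integrable setT (EFin \o (fun w => cos (Z w))).
Proof.
move=> mZ; apply: (bounded_integrable P_fin (K := 1)) => [|w]; last exact: cos_max.
exact: measurable_cos_comp.
Qed.

Lemma has_charfun_ae Z Z' a : measurable_fun setT Z -> measurable_fun setT Z' ->
  {ae P, forall w, Z w = Z' w} -> has_charfun Z a -> has_charfun Z' a.
Proof.
move=> mZ mZ' ZZ' [c s]; split.
  rewrite -c /Rintegral; congr fine; apply: ae_eq_integral => //.
  - by apply/measurable_EFinP; exact: measurable_cos_comp.
  - by apply/measurable_EFinP; exact: measurable_cos_comp.
  - by apply: filterS ZZ' => w + _ => /= ->.
rewrite -s /Rintegral; congr fine; apply: ae_eq_integral => //.
- by apply/measurable_EFinP; exact: measurable_sin_comp.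
- by apply/measurable_EFinP; exact: measurable_sin_comp.
- by apply: filterS ZZ' => w + _ => /= ->.
Qed.

Lemma lipschitz_cos (x y : R) : `|cos x - cos y| <= `|x - y|.
Proof.
wlog xy : x y / x < y => [hwlog|].
  have [xy|xy|->] := ltgtP x y; [exact: hwlog| |by rewrite !subrr].
  by rewrite distrC [leRHS]distrC; exact: hwlog.
have h : {within `[x, y], continuous (@cos R)}.
  by apply: continuous_subspaceT => z; exact: continuous_cos.
have [c _] := MVT xy (fun z _ => is_derive_cos z) h.
by rewrite distrC => ->; rewrite normrM normrN distrC ler_piMl// sin_max.
Qed.

Lemma lipschitz_sin (x y : R) : `|sin x - sin y| <= `|x - y|.
Proof.
rewrite -!cosBpihalf (le_trans (lipschitz_cos _ _))//.
by rewrite (_ : x - pi / 2 - (y - pi / 2) = x - y)//; ring.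
Qed.

Let mdist Z Z' (e : R) : measurable_fun setT Z -> measurable_fun setT Z' ->
  measurable [set w | e < `|Z w - Z' w|].
Proof.
move=> mZ mZ'.
rewrite (_ : mkset _ = (fun w => `|Z w - Z' w|) @^-1` `]e, +oo[%classic); last first.
  by apply/seteqP; split => w /=; rewrite in_itv/= andbT.
rewrite -[X in measurable X]setTI; apply: measurableT_comp => //.
exact: measurable_funB.
Qed.

Lemma cvg_in_prob_integral (f : R -> R) (Zn : nat -> Omega -> R) Z :
  (forall x, `|f x| <= 1) -> (forall x y, `|f x - f y| <= `|x - y|) ->
  (forall Y, measurable_fun setT Y -> measurable_fun setT (fun w : Omega => f (Y w))) ->
  (forall n, measurable_fun setT (Zn n)) -> measurable_fun setT Z ->
  (forall e, 0 < e -> P [set w | e < `|Zn n w - Z w|] @[n --> \oo] --> 0%E) ->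
  \int[P]_w f (Zn n w) @[n --> \oo] --> \int[P]_w f (Z w).
Proof.
move=> f1 fL mf mZn mZ ZnZ; apply/cvgrPdist_le => e e0.
have e4 : 0 < e / 2 by rewrite divr_gt0.
have e8 : 0 < e / 4 by rewrite divr_gt0.
have /fine_cvgP[_ /cvgrPdist_le/(_ _ e8) hP] := ZnZ _ e4.
near=> n.
have PA0 : `|0 - fine (P [set w | e / 2 < `|Zn n w - Z w|])| <= e / 4 by near: n.
set A := [set w | e / 2 < `|Zn n w - Z w|] in PA0.
have mA : measurable A by exact: mdist.
have PA : fine (P A) <= e / 4.
  by move: PA0; rewrite sub0r normrN ger0_norm// fine_ge0.
have iZ Y : measurable_fun setT Y -> P.-integrable setT (EFin \o (fun w => f (Y w))).
  by move=> mY; exact: (bounded_integrable P_fin (mf _ mY) (K := 1)).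
rewrite -RintegralB//; [|exact: iZ|exact: iZ].
have mB : measurable_fun setT (fun w => f (Z w) - f (Zn n w)).
  by apply: measurable_funB; exact: mf.
have bB w : `|f (Z w) - f (Zn n w)| <= 2.
  by rewrite (le_trans (ler_normB _ _))// lerD.
rewrite (le_trans (le_normr_Rintegral _ _))//.
  exact: (bounded_integrable P_fin mB bB).
have iA : P.-integrable setT (EFin \o (fun w => e / 2 + 2 * \1_A w)).
  apply: (bounded_integrable P_fin (K := e / 2 + 2)).
    by apply: measurable_funD => //; apply: measurable_funM.
  move=> w; rewrite ger0_norm ?addr_ge0 ?(ltW e4) ?mulr_ge0//.
  by rewrite lerD2l ler_piMr// indicE; case: (_ \in _).
apply: (@le_trans _ _ (\int[P]_w (e / 2 + 2 * \1_A w))).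
  apply: le_Rintegral => //.
    apply: (bounded_integrable P_fin (K := 2)).
      exact: measurableT_comp.
    by move=> w; rewrite normr_id.
  move=> w _; rewrite indicE; have [wA|wA] := boolP (w \in A).
    by rewrite mulr1 (le_trans (bB w))// lerDr ltW.
  rewrite mulr0 addr0 (le_trans (fL _ _))// distrC leNgt.
  by apply: contra wA => h; rewrite inE.
rewrite RintegralD//; last 2 first.
- by apply: (bounded_integrable P_fin (K := `|e / 2|)).
- apply: (bounded_integrable P_fin (K := 2)); first exact: measurable_funM.
  by move=> w; rewrite normrM ger0_norm// ler_piMr// indicE; case: (_ \in _); rewrite ?normr1 ?normr0.
rewrite Rintegral_cst// (congr1 fine (probability_setT P)) mulr1 RintegralZl//; last first.
  by apply: (bounded_integrable P_fin (K := 1)) => // w; rewrite indicE; case: (_ \in _); rewrite ?normr1 ?normr0.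
rewrite /Rintegral integral_indic//= setIT.
by move: PA; lra.
Unshelve. all: by end_near. Qed.

Lemma has_charfun_lim (Zn : nat -> Omega -> R) Z (an : nat -> R) a :
  (forall n, measurable_fun setT (Zn n)) -> measurable_fun setT Z ->
  (forall e, 0 < e -> P [set w | e < `|Zn n w - Z w|] @[n --> \oo] --> 0%E) ->
  (forall n, has_charfun (Zn n) (an n)) -> an n @[n --> \oo] --> a ->
  has_charfun Z a.
Proof.
move=> mZn mZ ZnZ Zna ana; split.
  have h := cvg_in_prob_integral (@cos_max R) lipschitz_cos
    (@measurable_cos_comp _ Omega) mZn mZ ZnZ.
  rewrite -(cvg_lim _ ana)//; apply/esym/cvg_lim => //.
  by move: h; under eq_fun do rewrite (Zna _).1.
have h := cvg_in_prob_integral (@sin_max R) lipschitz_sin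
  (@measurable_sin_comp _ Omega) mZn mZ ZnZ.
by rewrite -(cvg_lim _ h)//; under eq_fun do rewrite (Zna _).2; exact: lim_cst.
Qed.

End characteristic_functions.

Section tail_bound.
Context {dO : measure_display} {Omega : measurableType dO} {R : realType}.
Variable P : probability Omega R.

Definition tail_cst (al : R) : R := ((1 - cos 1) * (1 - 2^-1 `^ al))^-1.

Let half_powR_lt1 (al : R) : 0 < al -> (2^-1 : R) `^ al < 1.
Proof.
move=> al0; rewrite -[ltRHS](@powRr0 R 2^-1).
rewrite /powR ifF; last by apply/negbTE; rewrite invr_eq0 pnatr_eq0.
rewrite ifF; last by apply/negbTE; rewrite invr_eq0 pnatr_eq0.
by rewrite ltr_expR ltr_nM2r// ln_lt0// invr_gt0 ltr0n invf_lt1 ?ltr1n.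
Qed.

Let cos1_lt1 : cos 1 < 1 :> R.
Proof.
have pi1 : 1 <= pi :> R by rewrite (le_trans _ (pi_ge2 R))// ler1n.
by rewrite -[ltRHS]cos0 ltr_cos ?in_itv/= ?lexx ?pi_ge0 ?ler01 ?pi1.
Qed.

Lemma tail_cst_gt0 al : 0 < al -> 0 < tail_cst al.
Proof.
by move=> al0; rewrite invr_gt0 mulr_gt0 ?subr_gt0 ?half_powR_lt1 ?cos1_lt1.
Qed.

Let dyadic (x : R) N : 1 < x -> x <= 2 ^+ N ->
  exists2 k, (k < N)%N & 1 <= 2^-1 ^+ k * x <= 2.
Proof.
elim: N x => [|N IH] x x1; first by rewrite expr0 leNgt x1.
rewrite exprS => xN; have [x2|x2] := leP x 2.
  by exists 0%N => //; rewrite expr0 mul1r x2 (ltW x1).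
have [||k kN h] := IH (2^-1 * x); [lra|lra|].
by exists k.+1 => //; rewrite exprSr -mulrA.
Qed.

Let cos_le_cos1 (x : R) : 1 <= x <= 2 -> cos x <= cos 1.
Proof.
have pi1 : 1 <= pi :> R by rewrite (le_trans _ (pi_ge2 R))// ler1n.
move=> /andP[x1 x2]; rewrite leNgt ltr_cos ?in_itv/= -?leNgt ?ler01 ?pi1//.
by rewrite (le_trans _ x1)// (le_trans x2 (pi_ge2 R)).
Qed.

(** If [e < |Z|], one of the dyadic frequencies [2^-k / e] brings [|Z|] into the
    interval [1, 2], where [1 - cos] is at least [1 - cos 1]. Summing the expected
    values of [1 - cos] over these frequencies bounds the tail. *)
Lemma tail_bound (al c e : R) (Z : Omega -> R) : 0 < al -> 0 <= c -> 0 < e ->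
  measurable_fun setT Z ->
  (forall t, 0 < t -> \int[P]_w cos (t * Z w) = expR (- (t `^ al * c))) ->
  (P [set w | (e < `|Z w|)%R] <= (tail_cst al * (e^-1 `^ al * c))%:E)%E.
Proof.
move=> al0 c0 e0 mZ hZ.
have P_fin : (P setT < +oo)%E by rewrite probability_setT ltry.
pose r : R := 2^-1 `^ al.
have r1 : r < 1 by exact: half_powR_lt1.
pose t k : R := 2^-1 ^+ k / e.
have t0 k : 0 < t k by rewrite divr_gt0// exprn_gt0// invr_gt0.
have tal k : t k `^ al = r ^+ k * e^-1 `^ al.
  rewrite powRM ?exprn_ge0 ?invr_ge0 ?(ltW e0)//; congr (_ * _).
  elim: k => [|k IH]; first by rewrite !expr0 powR1.
  by rewrite !exprS powRM ?exprn_ge0 ?invr_ge0// IH.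
pose S N w : R := \sum_(k < N) (1 - cos (t k * Z w)).
have mS N : measurable_fun setT (S N).
  apply: measurable_sum => k; apply: measurable_funB => //.
  by apply: measurable_cos_comp; exact: measurable_funM.
have iC k : P.-integrable setT (EFin \o (fun w => 1 - cos (t k * Z w))).
  apply: (bounded_integrable P_fin (K := 2)).
    by apply: measurable_funB => //; apply: measurable_cos_comp; exact: measurable_funM.
  by move=> w; rewrite (le_trans (ler_normB _ _))// normr1 lerD// cos_max.
have ES N : \int[P]_w S N w <= e^-1 `^ al * c / (1 - r).
  apply: (@le_trans _ _ (\sum_(k < N) r ^+ k * (e^-1 `^ al * c))).
    rewrite /S; elim: (N) => [|n IH].
      by under eq_Rintegral do rewrite big_ord0; rewrite big_ord0 Rintegral_cst// mul0r.
    under eq_Rintegral do rewrite big_ord_recr/=.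
    rewrite big_ord_recr/= RintegralD//; last first.
      apply: (bounded_integrable P_fin (K := n%:R * 2)); first exact: (mS n).
      move=> w; rewrite (le_trans (ler_norm_sum _ _ _))//.
      rewrite (le_trans (ler_sum _ (G := fun=> 2) _))//; last first.
        by rewrite sumr_const card_ord mulr_natl.
      by move=> k _; rewrite (le_trans (ler_normB _ _))// normr1 lerD// cos_max.
    rewrite lerD// RintegralB//; last 2 first.
    - by apply: (bounded_integrable P_fin (K := 1)) => // w; rewrite normr1.
    - by apply: integrable_cos; exact: measurable_funM.
    rewrite Rintegral_cst// (congr1 fine (probability_setT P)) mulr1 hZ// tal.
    by rewrite lerBlDr -lerBlDl mulrA expR_ge1Dx.
  rewrite -mulr_suml mulrC ler_wpM2l ?mulr_ge0 ?powR_ge0//.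
  rewrite -[leRHS]mul1r ler_pdivlMr ?subr_gt0//.
  have -> : (\sum_(k < N) r ^+ k) * (1 - r) = 1 - r ^+ N.
    elim: (N) => [|n IH]; first by rewrite big_ord0 mul0r expr0 subrr.
    by rewrite big_ord_recr/= mulrDl IH exprS; ring.
  by rewrite gerBl exprn_ge0// powR_ge0.
pose A N := [set w | e < `|Z w| /\ `|Z w| <= 2 ^+ N * e].
have mA N : measurable (A N).
  rewrite (_ : A N = (fun w => `|Z w|) @^-1` `]e, (2 ^+ N * e)]%classic).
    by rewrite -[X in measurable X]setTI; apply: measurableT_comp.
  by apply/seteqP; split => w /=; rewrite in_itv/= => /andP.
have PA N : (P (A N) <= (tail_cst al * (e^-1 `^ al * c))%:E)%E.
  rewrite -[leLHS]fineK ?fin_num_measure// lee_fin.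
  rewrite (_ : fine _ = \int[P]_w \1_(A N) w); last first.
    by rewrite /Rintegral integral_indic//= setIT.
  have i1 : P.-integrable setT (EFin \o (\1_(A N) : Omega -> R)).
    by apply: (bounded_integrable P_fin (K := 1)) => // w; rewrite indicE; case: (_ \in _); rewrite ?normr1 ?normr0.
  apply: (@le_trans _ _ ((1 - cos 1)^-1 * \int[P]_w S N w)).
    rewrite -RintegralZl//; last first.
      apply: (bounded_integrable P_fin (K := N%:R * 2)); first exact: (mS N).
      move=> w; rewrite (le_trans (ler_norm_sum _ _ _))//.
      rewrite (le_trans (ler_sum _ (G := fun=> 2) _))//; last first.
        by rewrite sumr_const card_ord mulr_natl.
      by move=> k _; rewrite (le_trans (ler_normB _ _))// normr1 lerD// cos_max.
    have S0 w : 0 <= S N w.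
      by apply: sumr_ge0 => k _; rewrite subr_ge0 cos_le1.
    have k0 : 0 < 1 - cos 1 :> R by rewrite subr_gt0 cos1_lt1.
    apply: le_Rintegral => //.
      apply: (bounded_integrable P_fin (K := (1 - cos 1)^-1 * (N%:R * 2))).
        exact: measurable_funM.
      move=> w; rewrite normrM ger0_norm ?invr_ge0 ?(ltW k0)// ler_wpM2l ?invr_ge0 ?(ltW k0)//.
      rewrite (le_trans (ler_norm_sum _ _ _))//.
      rewrite (le_trans (ler_sum _ (G := fun=> 2) _))//; last first.
        by rewrite sumr_const card_ord mulr_natl.
      by move=> k _; rewrite (le_trans (ler_normB _ _))// normr1 lerD// cos_max.
    move=> w _; rewrite indicE; have [wA|_] := boolP (w \in A N); last first.
      by rewrite mulr_ge0 ?invr_ge0 ?(ltW k0).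
    rewrite ler_pdivlMl// mulr1.
    move: wA; rewrite inE => -[Ze ZN].
    have [||k kN hk] := @dyadic (`|Z w| / e) N.
    - by rewrite ltr_pdivlMr// mul1r.
    - by rewrite ler_pdivrMr.
    rewrite /S (bigD1 (Ordinal kN))//= -[leLHS]addr0 lerD//.
      rewrite lerD2l lerN2 -cos_norm; apply: cos_le_cos1.
      by rewrite normrM gtr0_norm// /t mulrAC -mulrA.
    by apply: sumr_ge0 => j _; rewrite subr_ge0 cos_le1.
  rewrite /tail_cst invfM -mulrA ler_wpM2l ?invr_ge0 ?subr_ge0 ?(ltW cos1_lt1)//.
  by rewrite mulrC; exact: ES.
have -> : [set w | (e < `|Z w|)%R] = \bigcup_N A N.
  apply/seteqP; split => [w /= Ze|w [N _ []]//].
  exists (Num.truncn (`|Z w| / e)).+1 => //; split => //.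
  rewrite -ler_pdivrMr//; apply/ltW/(lt_le_trans (truncnS_gt _)).
  by rewrite -natrX ler_nat ltnW// ltn_expl.
have ndA : {homo A : n m / (n <= m)%N >-> (n <= m)%O}.
  move=> n m nm; apply/subsetPset => w [h1 h2]; split=> //.
  by rewrite (le_trans h2)// ler_pM2r// ler_eXn2l// ltr1n.
have h := @nondecreasing_cvg_mu _ _ _ P A mA (bigcup_measurable (fun k _ => mA k)) ndA.
rewrite -(cvg_lim _ h)//; apply: lime_le; first exact: cvgP h.
exact: nearW.
Qed.

End tail_bound.

(** * Joint characteristic functions of the random measure *)

Lemma sum_enum_val (T : finType) (V : nmodType) (F : T -> V) :
  \sum_(k < #|T|) F (enum_val k) = \sum_t F t.
Proof. by rewrite [RHS](reindex _ (onW_bij _ (@enum_val_bij T))). Qed.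

Section random_measure_theory.
Context {dO : measure_display} {Omega : measurableType dO} {R : realType}.
Variable P : probability Omega R.
Context {d m : nat}.
Variables (alpha : R) (alpha0 : 0 < alpha).
Variable M : set 'cV[R]_d -> {RV P >-> 'cV[R]_m}.
Hypothesis hM : sas_random_measure alpha M.
Local Notation leb := (lebesgue_cV d).

Lemma random_measure0 : {ae P, forall w, M set0 w = 0}.
Proof.
have f0 : finite_borel (\bigcup_(j in [set: nat]) (fun=> set0 : set 'cV[R]_d) j).
  by rewrite bigcup0//; split => //; rewrite measure0.
have := fun t0 => rm_sigma_additive hM (A := fun=> set0) (fun=> measurable0) t0 f0.
have t0 : trivIset [set: nat] (fun=> set0 : set 'cV[R]_d).
  by move=> i j _ _ [x []].
move=> /(_ t0).
apply: filterS => w /= h.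
have : (fun=> M set0 w) x @[x --> \oo] --> (0 : 'cV[R]_m).
  by apply: cvg_series_cvg_0; apply: cvgP h.
move=> h0; have h1 : (fun=> M set0 w) x @[x --> \oo] --> M set0 w by exact: cvg_cst.
by rewrite -(cvg_lim (@norm_hausdorff _ _) h0) (cvg_lim (@norm_hausdorff _ _) h1).
Qed.

Lemma random_measure_fin_add (I : finType) (B : I -> set 'cV[R]_d) (A : set 'cV[R]_d) :
  (forall i, measurable (B i)) -> trivIset setT B -> finite_borel A ->
  A = \bigcup_i B i -> {ae P, forall w, M A w = \sum_i M (B i) w}.
Proof.
move=> mB tB fA AE.
pose F (n : nat) : set 'cV[R]_d :=
  if insub n is Some k then B (enum_val (k : 'I_#|I|)) else set0.
have mF n : measurable (F n) by rewrite /F; case: insub.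
have tF : trivIset setT F.
  move=> i j _ _ [x []]; rewrite /F; case: insubP => // a _ <- xa; case: insubP => // b _ <- xb.
  by congr nat_of_ord; apply: enum_val_inj; apply: tB => //; exists x.
have UF : \bigcup_n F n = A.
  rewrite AE; apply/seteqP; split => x [n _].
    by rewrite /F; case: insubP => // a _ _ xa; exists (enum_val a).
  move=> xn; exists (enum_rank n) => //; rewrite /F; case: insubP => [a _ ea|].
    by rewrite (_ : a = enum_rank n) ?enum_rankK//; exact/val_inj.
  by rewrite ltn_ord.
have fF : finite_borel (\bigcup_j F j) by rewrite UF.
have := rm_sigma_additive hM mF tF fF; rewrite UF.
apply: filterS2 random_measure0 => w M0 h.
rewrite -(cvg_lim (@norm_hausdorff _ _) h).
apply: cvg_lim; first exact: norm_hausdorff.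
apply: cvg_near_cst.
exists #|I| => // n /= In.
rewrite /series/= (@big_cat_nat _ _ _ #|I|)//= [X in _ + X]big_nat_cond [X in _ + X]big1 ?addr0.
  rewrite big_mkord [RHS](reindex _ (onW_bij _ (@enum_val_bij I))); apply: eq_bigr => k _.
  by congr (M _ w); rewrite /F valK.
move=> i /andP[/andP[Ii _] _]; rewrite (_ : F i = set0) //.
by rewrite /F insubN// -leqNgt.
Qed.

Section atoms.
Context {I : finType} (A : I -> set 'cV[R]_d).
Hypothesis fA : forall i, finite_borel (A i).

(** The cells of the Venn diagram of the sets [A i] that lie in some [A i]. *)
Definition atom (s : {set I}) : set 'cV[R]_d :=
  [set u | s != finset.set0 /\ forall i, (i \in s) = (u \in A i)].

Lemma measurable_atom s : measurable (atom s).
Proof.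
have [s0|s0] := boolP (s != finset.set0); last first.
  rewrite (_ : atom s = set0)//; apply/seteqP; split => // u [].
  by rewrite (negbTE s0).
rewrite (_ : atom s = \bigcap_(i in [set: I]) (if i \in s then A i else ~` A i)).
  apply: fin_bigcap_measurable => // i _; have [mAi _] := fA i.
  by case: ifP => // _; exact: measurableC.
apply/seteqP; split => u.
  move=> [_ us] i _; rewrite us; case: ifPn; first by rewrite inE.
  by move=> /negP h Aiu; apply: h; rewrite inE.
move=> us; split=> // i; have := us i Logic.I; case: ifPn => _ h; apply/esym.
  exact: mem_set.
exact: memNset.
Qed.

Lemma atom_sub (s : {set I}) i : i \in s -> atom s `<=` A i.
Proof. by move=> si u [_ us]; apply/set_mem; rewrite -us. Qed.

Lemma finite_borel_atom (s : {set I}) : finite_borel (atom s).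
Proof.
split; first exact: measurable_atom.
have [->|/set0Pn[i si]] := eqVneq s finset.set0.
  rewrite (_ : atom _ = set0) ?measure0//; apply/seteqP; split => // u [].
  by rewrite eqxx.
have [mAi Aioo] := fA i.
apply: le_lt_trans Aioo; apply: le_measure; rewrite ?inE//; first exact: measurable_atom.
exact: atom_sub.
Qed.

Lemma trivIset_atom : trivIset setT atom.
Proof.
move=> s t _ _ [u [[_ us] [_ ut]]]; apply/finset.setP => i.
by rewrite us ut.
Qed.

Lemma atom_cover i : A i = \bigcup_(s : {set I}) (if i \in s then atom s else set0).
Proof.
apply/seteqP; split => [u Aiu|u [s _]]; last first.
  by case: ifPn => // si; exact: atom_sub.
pose s := finset (fun j => u \in A j).
have si : i \in s by rewrite finset.inE inE.
exists s => //; rewrite si; split; first by apply/set0Pn; exists i.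
by move=> j; rewrite finset.inE.
Qed.

Lemma random_measure_atoms : {ae P, forall w, forall i,
  M (A i) w = \sum_(s : {set I} | i \in s) M (atom s) w}.
Proof.
apply: filter_forall => i.
have mB (s : {set I}) : measurable (if i \in s then atom s else set0).
  by case: ifP => // _; exact: measurable_atom.
have tB : trivIset setT (fun s : {set I} => if i \in s then atom s else set0).
  move=> s t _ _ [u []]; case: ifP => // _ us; case: ifP => // _ ut.
  by apply: trivIset_atom => //; exists u.
have := random_measure_fin_add mB tB (fA i) (atom_cover i).
apply: filterS2 random_measure0 => w M0 ->.
rewrite [RHS]big_mkcond/=; apply: eq_bigr => s _.
by case: ifP.
Qed.

Variable theta : I -> 'cV[R]_m.

Let g (s : {set I}) := enorm (\sum_(i in s) theta i) `^ alpha.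

Lemma integral_family_atoms :
  (\int[leb]_u (enorm (\sum_i \1_(A i) u *: theta i) `^ alpha)%:E =
   (\sum_s fine (leb (atom s)) * enorm (\sum_(i in s) theta i) `^ alpha)%:E)%E.
Proof.
transitivity (\int[leb]_u (\sum_s (g s)%:E * (\1_(atom s) u)%:E))%E.
  apply: eq_integral => u _.
  pose su := finset (fun i => u \in A i).
  have -> : \sum_i \1_(A i) u *: theta i = \sum_(i in su) theta i.
    rewrite [RHS]big_mkcond/=; apply: eq_bigr => i _.
    by rewrite indicE finset.inE; case: (u \in A i); rewrite ?scale1r ?scale0r.
  rewrite [RHS](bigD1 su)//= [X in (_ + X)%E]big1 ?adde0 => [|s ssu]; last first.
    rewrite ?indicE memNset ?mule0// => -[_ us]; move/eqP: ssu; apply.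
    by apply/finset.setP => i; rewrite us finset.inE.
  have [su0|su0] := eqVneq su finset.set0.
    by rewrite /g su0 finset.big_set0 enorm0 powR0 ?gt_eqF// mul0e.
  by rewrite ?indicE mem_set ?mule1//; split=> // i; rewrite finset.inE.
rewrite ge0_integral_sum//; last 2 first.
- move=> s; apply: measurable_funeM; apply/measurable_EFinP.
  by apply: measurable_indic; exact: measurable_atom.
- by move=> s u _; rewrite -EFinM lee_fin mulr_ge0// powR_ge0.
rewrite -sumEFin; apply: eq_bigr => s _.
rewrite ge0_integralZl//; last 2 first.
- by apply/measurable_EFinP/measurable_indic; exact: measurable_atom.
- by rewrite lee_fin powR_ge0.
rewrite integral_indic//; last exact: measurable_atom.
rewrite setIT EFinM fineK 1?muleC// ge0_fin_numE//.
by have [] := finite_borel_atom s.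
Qed.

Lemma measurable_random_measure (B : set 'cV[R]_d) : measurable_fun setT (M B).
Proof. exact: measurable_funPT. Qed.

Lemma measurable_dot_comp (v : 'cV[R]_m) (f : Omega -> 'cV[R]_m) :
  measurable_fun setT f -> measurable_fun setT (fun w => dot v (f w)).
Proof. by move=> mf; apply: measurableT_comp => //; exact: measurable_dot. Qed.

(** The joint characteristic function of the values of [M] on sets that need not
    be disjoint, by additivity over the atoms. *)
Lemma charfun_family :
  has_charfun P (fun w => \sum_i dot (theta i) (M (A i) w))
    (expR (- fine (\int[leb]_u (enorm (\sum_i \1_(A i) u *: theta i) `^ alpha)%:E)%E)).
Proof.
rewrite integral_family_atoms/=.
pose N := #|{set I}|.
pose B (k : 'I_N) := atom (enum_val k).
pose th (k : 'I_N) := \sum_(i in enum_val k) theta i.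
have tB : trivIset setT B.
  move=> j k _ _ Bjk; apply: enum_val_inj; exact: (trivIset_atom _ _ Bjk).
have := rm_charfun hM th (fun k => finite_borel_atom (enum_val k)) tB.
move/charfunP.
have -> : \sum_(k < N) fine (leb (B k)) * enorm (th k) `^ alpha =
    \sum_(s : {set I}) fine (leb (atom s)) * enorm (\sum_(i in s) theta i) `^ alpha.
  exact: (sum_enum_val (fun s => fine (leb (atom s)) * enorm (\sum_(i in s) theta i) `^ alpha)).
apply: has_charfun_ae.
- by apply: measurable_sum => k; apply: measurable_dot_comp; exact: measurable_random_measure.
- by apply: measurable_sum => k; apply: measurable_dot_comp; exact: measurable_random_measure.
apply: filterS random_measure_atoms => w Mw.
have -> : \sum_(k < N) dot (th k) (M (B k) w) =
    \sum_(s : {set I}) dot (\sum_(i in s) theta i) (M (atom s) w).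
  by rewrite -[RHS]sum_enum_val.
transitivity (\sum_(s : {set I}) \sum_(i in s) dot (theta i) (M (atom s) w)).
  by apply: eq_bigr => s _; rewrite dot_suml.
rewrite (exchange_big_dep predT)//=; apply: eq_bigr => i _.
by rewrite Mw dot_sumr.
Qed.

End atoms.

Section simple_families.
Context {J : finType} (S : J -> @simple_integrand R d m) (theta : J -> 'cV[R]_m).

Definition combined_simple (u : 'cV[R]_d) : 'cV[R]_m :=
  \sum_j (simple_fun (S j) u)^T *m theta j.

Let I : finType := {j : J & 'I_(simple_size (S j))}.
Let A (p : I) : set 'cV[R]_d := simple_set (tagged p).
Let th (p : I) : 'cV[R]_m := (simple_coef (tagged p))^T *m theta (tag p).

Let combinedE u : \sum_p \1_(A p) u *: th p = combined_simple u.
Proof.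
rewrite /combined_simple.
under [RHS]eq_bigr do rewrite /simple_fun raddf_sum/= mulmx_suml.
rewrite (sig_big_dep xpredT (fun _ => xpredT) (fun (j : J) (l : 'I_(simple_size (S j))) =>
  (\1_(simple_set l) u *: simple_coef l)^T *m theta j))/=.
by apply: eq_bigr => p _; rewrite /th linearZ/= scalemxAl.
Qed.

Lemma charfun_simple :
  has_charfun P (fun w => \sum_j dot (theta j) (simple_integral M (S j) w))
    (expR (- fine (\int[leb]_u (enorm (combined_simple u) `^ alpha)%:E)%E)).
Proof.
have fA p : finite_borel (A p) by exact: simple_finite.
have := charfun_family fA th.
under eq_integral do rewrite combinedE.
rewrite (_ : (fun w => _) = (fun w => \sum_j dot (theta j) (simple_integral M (S j) w)))//.
apply/funext => w; rewrite /simple_integral.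
under [RHS]eq_bigr do rewrite dot_sumr.
rewrite (sig_big_dep xpredT (fun _ => xpredT) (fun (j : J) (l : 'I_(simple_size (S j))) =>
  dot (theta j) (simple_coef l *m M (simple_set l) w)))/=.
by apply: eq_bigr => p _; rewrite /th dot_mulmx.
Qed.

End simple_families.

End random_measure_theory.

(** * Approximation by simple functions *)

Section simple_approximation.
Context {R : realType}.

(** The position of [x] relative to the grid of step [2^-n], up to [4^n] steps. *)
Definition grid_code (n : nat) (x : R) : bool * {ffun 'I_(4 ^ n) -> bool} :=
  (x < 0, [ffun k : 'I_(4 ^ n) => k.+1%:R <= `|x| * 2 ^+ n]).

Definition grid_value (n : nat) (c : bool * {ffun 'I_(4 ^ n) -> bool}) : R :=
  (-1) ^+ c.1 * ((\sum_k (c.2 k : nat))%:R / 2 ^+ n).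

Definition grid_round n x := grid_value (grid_code n x).

Let count_code n x :
  (\sum_k ((grid_code n x).2 k : nat) = minn (4 ^ n) (Num.truncn (`|x| * 2 ^+ n)))%N.
Proof.
set t := Num.truncn _; rewrite /=.
transitivity (\sum_(k < 4 ^ n) ((k < t)%N : nat))%N.
  apply: eq_bigr => k _; rewrite ffunE; congr nat_of_bool.
  by rewrite truncn_ge_nat// mulr_ge0// exprn_ge0.
elim: (4 ^ n)%N => [|N IH]; first by rewrite big_ord0 min0n.
by rewrite big_ord_recr/= IH; case: ltnP; lia.
Qed.

Let x2n_ge0 n (x : R) : 0 <= `|x| * 2 ^+ n.
Proof. by rewrite mulr_ge0// exprn_ge0. Qed.

Let sgE (x : R) : x = (-1) ^+ (x < 0)%R * `|x|.
Proof.
have [x0|x0] := ltP x 0 => /=; first by rewrite ltr0_norm// expr1 mulN1r opprK.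
by rewrite ger0_norm// expr0 mul1r.
Qed.

Lemma norm_grid_round n x : `|grid_round n x| <= `|x|.
Proof.
rewrite /grid_round /grid_value normrM normrX normrN1 expr1n mul1r count_code.
rewrite ger0_norm ?divr_ge0 ?exprn_ge0// ler_pdivrMr ?exprn_gt0//.
apply: (@le_trans _ _ (Num.truncn (`|x| * 2 ^+ n))%:R); first by rewrite ler_nat geq_minr.
by rewrite truncn_le.
Qed.

Lemma cvg_grid_round x : grid_round n x @[n --> \oo] --> x.
Proof.
apply/cvgrPdist_le => e e0; near=> n.
have n0 : (0 : R) < 2 ^+ n by rewrite exprn_gt0.
have xn : `|x| <= 2 ^+ n.
  apply: (@le_trans _ _ n%:R); first by near: n; exact: nbhs_infty_ger.
  by rewrite -natrX ler_nat ltnW// ltn_expl.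
rewrite /grid_round /grid_value count_code {1}(sgE x) -mulrBr normrM normrX normrN1 expr1n mul1r.
have -> : minn (4 ^ n) (Num.truncn (`|x| * 2 ^+ n)) = Num.truncn (`|x| * 2 ^+ n).
  apply/minn_idPr; rewrite -(ler_nat R) (@le_trans _ _ (`|x| * 2 ^+ n)) ?truncn_le//.
  by rewrite natrX (_ : 4%:R = 2 * 2 :> R) ?exprMn ?ler_wpM2r ?exprn_ge0// -natrM.
set t := Num.truncn _.
have /andP[t1 t2] : t%:R <= `|x| * 2 ^+ n < t.+1%:R := truncn_itv (x2n_ge0 n x).
have -> : `|x| - t%:R / 2 ^+ n = (`|x| * 2 ^+ n - t%:R) / 2 ^+ n.
  by field; rewrite gt_eqF.
rewrite ger0_norm ?divr_ge0 ?subr_ge0 ?(ltW n0)// ler_pdivrMr//.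
apply: (@le_trans _ _ 1); first by rewrite lerBlDl natr1 ltW.
rewrite -ler_pdivrMl// mulr1; apply: (@le_trans _ _ n%:R).
  by near: n; exact: nbhs_infty_ger.
by rewrite -natrX ler_nat ltnW// ltn_expl.
Unshelve. all: by end_near. Qed.

Lemma measurable_grid_code n (c : bool * {ffun 'I_(4 ^ n) -> bool}) :
  measurable [set x | grid_code n x = c].
Proof.
rewrite (_ : mkset _ = [set x | (x < 0) = c.1] `&`
    \bigcap_(k in [set: 'I_(4 ^ n)]) [set x : R | (k.+1%:R <= `|x| * 2 ^+ n) = c.2 k]).
  apply: measurableI.
    rewrite (_ : mkset _ = (fun x : R => x < 0) @^-1` [set c.1]); last by [].
    rewrite -[X in measurable X]setTI; apply: measurable_fun_ltr => //.
  apply: fin_bigcap_measurable => // k _.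
  rewrite (_ : mkset _ = (fun x : R => k.+1%:R <= `|x| * 2 ^+ n) @^-1` [set c.2 k]); last by [].
  rewrite -[X in measurable X]setTI; apply: measurable_fun_ler => //.
  by apply: measurable_funM.
apply/seteqP; split => x /=.
  by move=> <-; split=> // k _; rewrite ffunE.
move=> [x0 h]; case: c x0 h => b f /= x0 h; rewrite /grid_code x0; congr pair.
by apply/ffunP => k; rewrite ffunE; exact: h.
Qed.

Context {d m : nat}.

Let cube (n : nat) : set 'cV[R]_d := [set v | forall i, `|v i 0| <= n%:R].

Let finite_cube n : finite_borel (cube n).
Proof.
split; last exact: lebesgue_cV_cube.
have -> : cube n = [set v | forall i, `[- n%:R, n%:R]%classic (v i 0)].
  by apply/seteqP; split => v /= h i; have := h i; rewrite /= in_itv/= ler_norml.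
by apply: (measurable_box (B := fun=> `[- n%:R, n%:R]%classic)).
Qed.

Variable Q : 'cV[R]_d -> 'M[R]_m.
Hypothesis mQ : measurable_fun setT Q.

Section level.
Variable n : nat.

Let T : finType := {ffun 'I_m * 'I_m -> bool * {ffun 'I_(4 ^ n) -> bool}}.
Let code (u : 'cV[R]_d) : T := [ffun p => grid_code n (Q u p.1 p.2)].
Let A (k : 'I_#|T|) : set 'cV[R]_d := cube n `&` [set u | code u = enum_val k].

Let fA k : finite_borel (A k).
Proof.
have [mc coo] := finite_cube n.
have mA : measurable (A k).
  apply: measurableI => //.
  rewrite (_ : mkset _ = \bigcap_(p in [set: 'I_m * 'I_m])
     (fun u => Q u p.1 p.2) @^-1` [set x | grid_code n x = (enum_val k : T) p]).
    apply: fin_bigcap_measurable => // -[i j] _; rewrite -[X in measurable X]setTI.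
    apply: (measurableT_comp (measurable_fun_coord i j) mQ) => //.
    exact: measurable_grid_code.
  apply/seteqP; split => u /=; first by move=> <- p _ /=; rewrite ffunE.
  by move=> h; apply/ffunP => p; rewrite ffunE; exact: h.
split => //; apply: le_lt_trans coo; apply: le_measure; rewrite ?inE//.
by apply: subIset; left.
Qed.

Let tA : trivIset setT A.
Proof. by move=> j k _ _ [u [[_ /= uj] [_ /= uk]]]; apply: enum_val_inj; rewrite -uj. Qed.

Definition grid_simple : @simple_integrand R d m :=
  @Build_simple_integrand R d m #|T|
    (fun k => \matrix_(i, j) grid_value ((enum_val k : T) (i, j))) A fA tA.

Lemma grid_simpleE u i j :
  simple_fun grid_simple u i j = (u \in cube n)%:R * grid_round n (Q u i j).
Proof.
rewrite /simple_fun /= summxE (bigD1 (enum_rank (code u)))//= big1 ?addr0 => [|k kn].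
  rewrite !mxE indicE enum_rankK ffunE; congr (_%:R * _); congr nat_of_bool.
  have [uc|uc] := boolP (u \in cube n); last first.
    by apply: memNset => -[cu _]; move/negP: uc; apply; exact: mem_set.
  by apply: mem_set; split => /=; [exact: set_mem|rewrite enum_rankK].
rewrite !mxE indicE memNset ?mul0r// => -[_ /= uk]; move/eqP: kn; apply.
by rewrite uk enum_valK.
Qed.

End level.

Lemma grid_simple_le n u i j : `|simple_fun (grid_simple n) u i j| <= `|Q u i j|.
Proof.
rewrite grid_simpleE normrM; case: (_ \in _); rewrite ?normr1 ?normr0 ?mul1r ?mul0r//.
exact: norm_grid_round.
Qed.

Lemma cvg_grid_simple u i j :
  simple_fun (grid_simple n) u i j @[n --> \oo] --> Q u i j.
Proof.
have un : \forall n \near \oo, u \in cube n.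
  near=> n; apply: mem_set => k.
  apply: (@le_trans _ _ (norm1 u)); first exact: entry_le_norm1.
  by near: n; exact: nbhs_infty_ger.
apply: (@cvg_trans _ (grid_round n (Q u i j) @[n --> \oo])); last exact: cvg_grid_round.
apply: near_eq_cvg; by near=> n; rewrite grid_simpleE (near un n)// mul1r.
Unshelve. all: by end_near. Qed.

End simple_approximation.

(** * Convergence in probability *)

Lemma cvg_ereal0 {R : realType} (T : Type) (F : set_system T) {FF : Filter F} (f : T -> \bar R) :
  (forall n, 0 <= f n)%E -> (forall e : R, 0 < e -> \forall n \near F, (f n <= e%:E)%E) ->
  f n @[n --> F] --> 0%E.
Proof.
move=> f0 fe; apply/fine_cvgP; split.
  have := fe 1 ltr01; apply: filterS => n fn.
  by rewrite ge0_fin_numE// (le_lt_trans fn)// ltry.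
apply/cvgr0Pnorm_le => e e0; have := fe e e0; apply: filterS => n fn /=.
rewrite ger0_norm ?fine_ge0// -lee_fin fineK// ge0_fin_numE//.
by rewrite (le_lt_trans fn)// ltry.
Qed.

Section convergence_in_probability.
Context {dO : measure_display} {Omega : measurableType dO} {R : realType}.
Variable P : probability Omega R.
Context {m : nat}.
Implicit Types V W : Omega -> 'cV[R]_m.

Lemma measurable_fun_mxB d' (T : measurableType d') p q (f g : T -> 'M[R]_(p, q)) :
  measurable_fun setT f -> measurable_fun setT g ->
  measurable_fun setT (fun t => f t - g t).
Proof.
move=> mf mg; apply: measurable_fun_mxP => i j; under eq_fun do rewrite !mxE.
apply: measurable_funB; [exact: (measurableT_comp (measurable_fun_coord i j) mf)|
  exact: (measurableT_comp (measurable_fun_coord i j) mg)].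
Qed.

Lemma measurable_gt (f : Omega -> R) (e : R) : measurable_fun setT f ->
  measurable [set w | e < f w].
Proof.
move=> mf; rewrite (_ : mkset _ = f @^-1` `]e, +oo[%classic); last first.
  by apply/seteqP; split => w /=; rewrite in_itv/= andbT.
by rewrite -[X in measurable X]setTI; exact: mf.
Qed.

Lemma measurable_enorm_gt V (e : R) : measurable_fun setT V ->
  measurable [set w | e < enorm (V w)].
Proof.
move=> mV; apply: measurable_gt; apply: measurableT_comp => //.
exact: measurable_enorm.
Qed.

Lemma prob_enormD (e1 e2 : R) V W : measurable_fun setT V -> measurable_fun setT W ->
  (P [set w | e1 + e2 < enorm (V w + W w)]%R <=
   P [set w | e1 < enorm (V w)]%R + P [set w | e2 < enorm (W w)]%R)%E.
Proof.
move=> mV mW; apply: (@le_trans _ _ (P ([set w | e1 < enorm (V w)]%R `|` [set w | e2 < enorm (W w)]%R))).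
  apply: le_measure; rewrite ?inE.
  - by apply: measurable_enorm_gt; exact: measurable_fun_mxD.
  - by apply: measurableU; exact: measurable_enorm_gt.
  move=> w /= h; have [h1|h1] := ltP e1 (enorm (V w)); [by left|right].
  rewrite ltNge; apply/negP => h2; move: h; rewrite ltNge => /negP; apply.
  by rewrite (le_trans (enormD _ _))// lerD.
by apply: measureU2; exact: measurable_enorm_gt.
Qed.

(** A sequence that is Cauchy in probability converges in probability: along a
    subsequence the increments exceed [2^-j] with probability at most [2^-j], so
    off the unions of the later exceptional sets the subsequence converges, at a
    geometric rate. *)
Lemma cauchy_in_probability (Y : nat -> Omega -> 'cV[R]_m) :
  (forall n, measurable_fun setT (Y n)) ->
  (forall e : R, 0 < e -> exists N, forall n k, (N <= n)%N -> (N <= k)%N ->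
     (P [set w | e < enorm (Y n w - Y k w)]%R <= e%:E)%E) ->
  exists2 Z : Omega -> 'cV[R]_m, measurable_fun setT Z &
    cvg_in_probability P \oo Y Z.
Proof.
move=> mY cY.
pose r j : R := 2^-1 ^+ j.
have r0 j : 0 < r j by rewrite exprn_gt0// invr_gt0.
have /choice[N0 hN0] j := cY _ (r0 j).
pose N j := (\sum_(l < j.+1) N0 l)%N.
have NN j k : (j <= k)%N -> (N0 j <= N k)%N.
  move=> jk; have jk' : (j < k.+1)%N by rewrite ltnS.
  by rewrite /N (bigD1 (Ordinal jk'))//= leq_addr.
pose A j := [set w | r j < enorm (Y (N j.+1) w - Y (N j) w)].
have mA j : measurable (A j) by apply: measurable_enorm_gt; exact: measurable_fun_mxB.
have PA j : (P (A j) <= (r j)%:E)%E by apply: hN0; exact: NN.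
pose B j := \bigcup_l A (j + l)%N.
have mB j : measurable (B j) by apply: bigcup_measurable.
have PB j : (P (B j) <= (2 * r j)%:E)%E.
  apply: le_trans (measure_sigma_subadditive _ _ (mB j) (fun _ h => h)) _.
    by move=> l; exact: mA.
  apply: lime_le; first exact: is_cvg_nneseries.
  apply: nearW => n; apply: (@le_trans _ _ (\sum_(0 <= l < n) (r (j + l)%N)%:E)%E).
    by apply: lee_sum => l _; exact: PA.
  rewrite sumEFin lee_fin.
  have -> : \sum_(0 <= l < n) r (j + l)%N = 2 * r j * (1 - r n).
    elim: n => [|n IH]; first by rewrite big_geq// /r expr0 subrr mulr0.
    by rewrite big_nat_recr//= IH /r exprD exprS; field.
  by rewrite ler_piMr ?mulr_ge0 ?(ltW (r0 _))// gerBl ltW.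
have step j k w i : ~ B j w -> (j <= k)%N ->
    `|Y (N k) w i 0 - Y (N j) w i 0| <= 2 * r j - 2 * r k.
  move=> Bw jk; rewrite -(subnKC jk); elim: (k - j)%N => [|l IH].
    by rewrite addn0 !subrr normr0.
  have : `|Y (N (j + l).+1) w i 0 - Y (N (j + l)%N) w i 0| <= r (j + l)%N.
    apply: (@le_trans _ _ (enorm (Y (N (j + l).+1) w - Y (N (j + l)%N) w))).
      by apply: le_trans (entry_le_enorm _ i); rewrite !mxE.
    by rewrite leNgt; apply/negP => h; apply: Bw; exists l.
  rewrite addnS => h.
  have -> : Y (N (j + l).+1) w i 0 - Y (N j) w i 0 =
    (Y (N (j + l).+1) w i 0 - Y (N (j + l)%N) w i 0) +
    (Y (N (j + l)%N) w i 0 - Y (N j) w i 0) by ring.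
  rewrite (le_trans (ler_normD _ _))// (le_trans (lerD h IH))//.
  rewrite (_ : r (j + l).+1 = r (j + l)%N / 2); last by rewrite /r exprS mulrC.
  by rewrite le_eqVlt; apply/orP; left; apply/eqP; field.
pose C := \bigcup_j ~` B j.
have mC : measurable C by apply: bigcup_measurable => j _; exact: measurableC.
pose z i k w : R := \1_C w * Y (N k) w i 0.
have mz i k : measurable_fun setT (z i k).
  apply: measurable_funM; first exact: measurable_indic.
  exact: (measurableT_comp (measurable_fun_coord i 0) (mY _)).
have rcvg : r n @[n --> \oo] --> (0 : R) by apply: cvg_expr; rewrite ger0_norm; lra.
have cz i w : cvgn (z i ^~ w).
  have [Cw|Cw] := pselect (C w); last first.
    rewrite (_ : z i ^~ w = cst 0); first exact: is_cvg_cst.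
    by apply/funext => k; rewrite /z indicE memNset// mul0r.
  have zE k : z i k w = Y (N k) w i 0 by rewrite /z indicE mem_set// mul1r.
  have [j _ Bj] := Cw.
  have Bk k : (j <= k)%N -> ~ B k w.
    move=> jk [l _ Al]; apply: Bj; exists (k - j + l)%N => //.
    by rewrite addnA subnKC.
  pose b k := Y (N (k + j)%N) w i 0 + 2 * r (k + j)%N.
  have cb : cvgn b.
    apply: nonincreasing_is_cvgn.
      apply/nonincreasing_seqP => k; rewrite /b addSn.
      have := step (k + j)%N (k + j).+1 w i (Bk _ (leq_addl _ _)) (leqnSn _).
      by rewrite ler_norml => /andP[_ h]; lra.
    exists (Y (N j) w i 0 - 2 * r j) => _ [k _ <-]; rewrite /b.
    have := step j (k + j)%N w i Bj (leq_addl _ _).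
    have := r0 (k + j)%N.
    by rewrite ler_norml => ? /andP[? ?]; lra.
  have rj : r (k + j)%N @[k --> \oo] --> (0 : R) by rewrite (cvg_shiftn j r).
  have zb : z i (k + j)%N w @[k --> \oo] --> limn b - 2 * 0.
    have -> : (fun k => z i (k + j)%N w) = (fun k => b k - 2 * r (k + j)%N).
      by apply/funext => k; rewrite zE /b addrK.
    by apply: cvgB => //; apply: cvgMr.
  by apply/cvg_ex; exists (limn b - 2 * 0); rewrite -(cvg_shiftn j).
pose Z w : 'cV[R]_m := \col_i limn (z i ^~ w).
have mZ : measurable_fun setT Z.
  apply: measurable_fun_mxP => i k; under eq_fun do rewrite mxE.
  by apply: (measurable_fun_cvg (mz i)) => w _; exact: cz.
exists Z => //.
have YZ j w : ~ B j w -> enorm (Y (N j) w - Z w) <= m%:R * (2 * r j).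
  move=> Bw; apply: (le_trans (enorm_le_norm1 _)); rewrite norm1_cV.
  rewrite -[X in X%:R](card_ord m) mulr_natl -sumr_const; apply: ler_sum => i _.
  rewrite !mxE distrC.
  have h : `|z i n w - Y (N j) w i 0| @[n --> \oo] --> `|limn (z i ^~ w) - Y (N j) w i 0|.
    by apply: cvg_norm; apply: cvgB; [exact: cz|exact: cvg_cst].
  rewrite -(cvg_lim _ h)//; apply: limr_le; first exact: cvgP h.
  exists j => // k /= jk.
  rewrite /z indicE mem_set ?mul1r; last by exists j.
  by apply: le_trans (step j k w i Bw jk) _; rewrite gerBl mulr_ge0// ltW.
move=> e e0; apply: cvg_ereal0 => [n|e' e'0]; first exact: measure_ge0.
have [j hj1 hj2] : exists2 j, r j + m%:R * (2 * r j) <= e & r j + 2 * r j <= e'.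
  have : (1 + 2 * m%:R) * r n @[n --> \oo] --> ((1 + 2 * m%:R) * 0 : R).
    by apply: cvgMr.
  rewrite mulr0 => /cvgr0Pnorm_le/(_ _ e0) h1.
  have : 3 * r n @[n --> \oo] --> (3 * 0 : R) by apply: cvgMr.
  rewrite mulr0 => /cvgr0Pnorm_le/(_ _ e'0) h2.
  have [j [h3 h4]] := filter_ex (filterI h1 h2).
  exists j.
    by apply: le_trans h3; rewrite ger0_norm ?mulr_ge0 ?addr_ge0 ?(ltW (r0 j))//; lra.
  by apply: le_trans h4; rewrite ger0_norm ?mulr_ge0 ?(ltW (r0 j))//; lra.
exists (N j) => // n /= jn.
apply: (@le_trans _ _ (P [set w | r j + m%:R * (2 * r j) <
    enorm ((Y n w - Y (N j) w) + (Y (N j) w - Z w))]%R)).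
  apply: le_measure; rewrite ?inE.
  - by apply: measurable_enorm_gt; exact: measurable_fun_mxB.
  - by apply: measurable_enorm_gt; apply: measurable_fun_mxD; exact: measurable_fun_mxB.
  by move=> w /=; rewrite addrA subrK; exact: le_lt_trans.
apply: (le_trans (prob_enormD _ _ _ _)); [exact: measurable_fun_mxB..|].
apply: (@le_trans _ _ ((r j)%:E + (2 * r j)%:E)%E); last by rewrite -EFinD lee_fin.
apply: leeD.
  by apply: hN0; [apply: leq_trans jn; exact: NN|exact: NN].
apply: le_trans (PB j); apply: le_measure; rewrite ?inE//.
  by apply: measurable_enorm_gt; exact: measurable_fun_mxB.
move=> w /= h; apply: contrapT => Bw; have := YZ j w Bw.
by rewrite leNgt h.
Unshelve. all: by end_near. Qed.

End convergence_in_probability.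

(** * Tails of stochastic integrals *)

Section powers.
Context {R : realType}.

Lemma cvg_powR (x_ : nat -> R) (x al : R) : 0 < al -> (forall n, 0 <= x_ n) ->
  x_ n @[n --> \oo] --> x -> x_ n `^ al @[n --> \oo] --> x `^ al.
Proof.
move=> al0 x_0 xx.
have : 0 <= x.
  by rewrite -(cvg_lim _ xx)//; apply: limr_ge; [exact: cvgP xx|exact: nearW].
rewrite le_eqVlt => /predU1P[x0|x0].
  rewrite -x0 powR0 ?gt_eqF//; apply/cvgrPdist_le => e e0.
  have e1 : 0 < e `^ al^-1 by rewrite powR_gt0.
  move/cvgrPdist_le: xx => /(_ _ e1); apply: filterS => n.
  rewrite -x0 !sub0r !normrN !ger0_norm ?powR_ge0// => h.
  rewrite -[leRHS](_ : (e `^ al^-1) `^ al = e); last first.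
    by rewrite -powRrM mulVf ?gt_eqF// powRr1// ltW.
  by apply: ge0_ler_powR; rewrite ?nnegrE ?powR_ge0 ?(ltW al0).
have c : {for x, continuous (fun y : R => y `^ al)}.
  apply: differentiable_continuous; apply/derivable1_diffP.
  by have [] := is_derive1_powR al x0.
exact: (continuous_cvg _ c xx).
Qed.

Lemma powR_sum_le (J : finType) (al : R) (x : J -> R) : 0 < al ->
  (forall j, 0 <= x j) ->
  (\sum_j x j) `^ al <= #|J|%:R `^ al * \sum_j x j `^ al.
Proof.
move=> al0 x0; set s := \sum_j x j `^ al.
have s0 : 0 <= s by apply: sumr_ge0 => j _; exact: powR_ge0.
have xs j : x j <= s `^ al^-1.
  rewrite -[leLHS](_ : (x j `^ al) `^ al^-1 = x j); last first.
    by rewrite -powRrM mulfV ?gt_eqF// powRr1.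
  apply: ge0_ler_powR; rewrite ?nnegrE ?invr_ge0 ?powR_ge0 ?(ltW al0)//.
  by rewrite /s (bigD1 j)//= lerDl sumr_ge0// => k _; exact: powR_ge0.
apply: (@le_trans _ _ ((#|J|%:R * s `^ al^-1) `^ al)).
  apply: ge0_ler_powR; rewrite ?nnegrE ?(ltW al0) ?mulr_ge0 ?powR_ge0 ?sumr_ge0//.
  by rewrite mulr_natl -sumr_const; apply: ler_sum => j _.
by rewrite powRM ?powR_ge0// -powRrM mulVf ?gt_eqF// powRr1.
Qed.

End powers.

Section stochastic_integrals.
Context {dO : measure_display} {Omega : measurableType dO} {R : realType}.
Variable P : probability Omega R.
Context {d m : nat}.
Variables (alpha : R) (alpha0 : 0 < alpha).
Variable M : set 'cV[R]_d -> {RV P >-> 'cV[R]_m}.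
Hypothesis hM : sas_random_measure alpha M.
Local Notation leb := (lebesgue_cV d).

Lemma union_bound (I : finType) (A : I -> set Omega) (B : set Omega) :
  measurable B -> (forall i, measurable (A i)) ->
  (forall w, B w -> exists i, A i w) -> (P B <= \sum_i P (A i))%E.
Proof.
move=> mB mA BA.
pose C (s : seq I) := [set w | exists2 i, i \in s & A i w].
have CS i s : C (i :: s) = A i `|` C s.
  apply/seteqP; split => w /=.
    by move=> [j]; rewrite inE => /predU1P[->|js Aj]; [left|right; exists j].
  move=> [Ai|[j js Aj]]; first by exists i => //; rewrite mem_head.
  by exists j => //; rewrite inE js orbT.
have hC s : measurable (C s) /\ (P (C s) <= \sum_(i <- s) P (A i))%E.
  elim: s => [|i s [mC PC]].
    by rewrite big_nil (_ : C [::] = set0) ?measure0//; apply/seteqP; split => // w [].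
  rewrite CS big_cons; split; first exact: measurableU.
  by apply: (le_trans (measureU2 _ _ _)) => //; exact: leeD2l.
have [mC PC] := hC (index_enum I).
apply: le_trans PC; apply: le_measure; rewrite ?inE//.
by move=> w /BA[i Aw]; exists i => //; exact: mem_index_enum.
Qed.

Definition vector_tail_cst (e : R) : R :=
  m%:R * (tail_cst alpha * (e / m.+1%:R)^-1 `^ alpha).

Lemma vector_tail_cst_ge0 e : 0 <= vector_tail_cst e.
Proof. by rewrite mulr_ge0// mulr_ge0 ?powR_ge0// ltW// tail_cst_gt0. Qed.

Lemma measurable_norm1_powR (G : 'cV[R]_d -> 'M[R]_m) : measurable_fun setT G ->
  measurable_fun setT (fun u => (norm1 (G u) `^ alpha)%:E).
Proof.
move=> mG; apply/measurable_EFinP; apply: (measurableT_comp (measurable_powR alpha)).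
by apply: measurableT_comp => //; exact: measurable_norm1.
Qed.

Lemma measurable_opnorm_powR (G : 'cV[R]_d -> 'M[R]_m) : measurable_fun setT G ->
  measurable_fun setT (fun u => (opnorm (G u) `^ alpha)%:E).
Proof.
move=> mG; apply/measurable_EFinP; apply: (measurableT_comp (measurable_powR alpha)).
by apply: measurableT_comp => //; exact: measurable_opnorm.
Qed.

Lemma measurable_fun_mulmxtr (G : 'cV[R]_d -> 'M[R]_m) (theta : 'cV[R]_m) :
  measurable_fun setT G -> measurable_fun setT (fun u => (G u)^T *m theta).
Proof.
move=> mG; apply: measurable_fun_mxP => i j.
under eq_fun do rewrite mxE.
apply: measurable_sum => k; apply: measurable_funM => //.
under eq_fun do rewrite mxE.
exact: (measurableT_comp (measurable_fun_coord k i) mG).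
Qed.

Lemma measurable_enorm_powR (g : 'cV[R]_d -> 'cV[R]_m) : measurable_fun setT g ->
  measurable_fun setT (fun u => (enorm (g u) `^ alpha)%:E).
Proof.
move=> mG; apply/measurable_EFinP; apply: (measurableT_comp (measurable_powR alpha)).
by apply: measurableT_comp => //; exact: measurable_enorm.
Qed.

(** The scalar tail bound is applied to each coordinate and summed. *)
Lemma vector_tail (G : 'cV[R]_d -> 'M[R]_m) (V : Omega -> 'cV[R]_m) (e : R) :
  measurable_fun setT G -> measurable_fun setT V -> 0 < e ->
  (\int[leb]_u (norm1 (G u) `^ alpha)%:E < +oo)%E ->
  (forall theta, has_charfun P (fun w => dot theta (V w))
    (expR (- fine (\int[leb]_u (enorm ((G u)^T *m theta) `^ alpha)%:E)%E))) ->
  (P [set w | e < enorm (V w)]%R <=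
   (vector_tail_cst e)%:E * \int[leb]_u (norm1 (G u) `^ alpha)%:E)%E.
Proof.
move=> mG mV e0 Goo hV.
set I1 := (\int[leb]_u (norm1 (G u) `^ alpha)%:E)%E.
pose e' := e / m.+1%:R.
have e'0 : 0 < e' by rewrite divr_gt0.
have mVi i : measurable_fun setT (fun w => V w i 0).
  exact: (measurableT_comp (measurable_fun_coord i 0) mV).
pose A i := [set w | e' < `|V w i 0|].
have mA i : measurable (A i).
  by apply: (measurable_gt (f := fun w => `|V w i 0|)); exact: measurableT_comp.
have I10 : (0 <= I1)%E by apply: integral_ge0 => u _; rewrite lee_fin powR_ge0.
apply: (@le_trans _ _ (\sum_i P (A i))%E).
  apply: union_bound => //; first exact: measurable_enorm_gt.
  move=> w /= Vw; apply: contrapT => h; move: Vw; rewrite ltNge => /negP; apply.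
  have Vi i : `|V w i 0| <= e'.
    by rewrite leNgt; apply/negP => Vi; apply: h; exists i.
  rewrite (le_trans (enorm_le_norm1 _))// norm1_cV.
  apply: (@le_trans _ _ (\sum_(i < m) e')); first exact: ler_sum.
  rewrite sumr_const card_ord -mulr_natl /e' mulrCA ger_pMr//.
  by rewrite ler_pdivrMr// mul1r ler_nat.
pose c i := fine (\int[leb]_u (enorm ((G u)^T *m delta_mx i 0) `^ alpha)%:E)%E.
have ci i : (\int[leb]_u (enorm ((G u)^T *m delta_mx i 0) `^ alpha)%:E <= I1)%E.
  apply: ge0_le_integral => //.
  - by move=> u _; rewrite lee_fin powR_ge0.
  - by apply: measurable_enorm_powR; exact: measurable_fun_mulmxtr.
  - exact: measurable_norm1_powR.
  move=> u _; rewrite lee_fin; apply: ge0_ler_powR; rewrite ?nnegrE ?(ltW alpha0)//.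
  - exact: enorm_ge0.
  - exact: norm1_ge0.
  by rewrite (le_trans (enorm_mulmx _ _))// enorm_delta mulr1 norm1_tr.
have cfin i : (\int[leb]_u (enorm ((G u)^T *m delta_mx i 0) `^ alpha)%:E)%E \is a fin_num.
  rewrite ge0_fin_numE; last by apply: integral_ge0 => u _; rewrite lee_fin powR_ge0.
  exact: le_lt_trans (ci i) Goo.
have PA i : (P (A i) <= (tail_cst alpha * e'^-1 `^ alpha)%:E * I1)%E.
  apply: (@le_trans _ _ (tail_cst alpha * (e'^-1 `^ alpha * c i))%:E).
    apply: tail_bound => //.
      by apply: fine_ge0; apply: integral_ge0 => u _; rewrite lee_fin powR_ge0.
    move=> t t0; have [+ _] := hV (t *: delta_mx i 0).
    under eq_Rintegral do rewrite dotZl dot_delta.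
    move=> ->; congr (expR (- _)).
    under eq_integral do rewrite -scalemxAr enormZ powRM ?enorm_ge0// EFinM.
    rewrite ge0_integralZl//; last 2 first.
    - by apply: measurable_enorm_powR; exact: measurable_fun_mulmxtr.
    - by move=> u _; rewrite lee_fin powR_ge0.
    by rewrite fineM// gtr0_norm.
  rewrite mulrA EFinM lee_wpmul2l ?lee_fin ?mulr_ge0 ?powR_ge0 ?(ltW (tail_cst_gt0 alpha0))//.
  by rewrite fineK.
apply: (le_trans (lee_sum _ (fun i _ => PA i))).
have I1fin : I1 \is a fin_num by rewrite ge0_fin_numE.
rewrite -(fineK I1fin) -EFinM sumEFin lee_fin sumr_const card_ord.
by rewrite /vector_tail_cst -/e' -[leLHS]mulr_natl !mulrA.
Qed.

Lemma measurable_simple_fun (S : @simple_integrand R d m) : measurable_fun setT (simple_fun S).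
Proof.
apply: measurable_fun_mxP => i j.
rewrite (_ : (fun _ => _) =
    fun u => \sum_k \1_(@simple_set _ _ _ S k) u * @simple_coef _ _ _ S k i j); last first.
  by apply/funext => u; rewrite /simple_fun summxE; apply: eq_bigr => k _; rewrite mxE.
apply: measurable_sum => k; apply: measurable_funM => //; apply: measurable_indic.
by have [] := @simple_finite _ _ _ S k.
Qed.

Lemma measurable_simple_integral (S : @simple_integrand R d m) :
  measurable_fun setT (simple_integral M S).
Proof.
apply: measurable_fun_mxP => i j.
rewrite (_ : (fun _ => _) = fun w => \sum_k
    (@simple_coef _ _ _ S k *m M (@simple_set _ _ _ S k) w) i j); last first.
  by apply/funext => w; rewrite /simple_integral summxE.
apply: measurable_sum => k.
apply: (measurableT_comp (measurable_fun_coord i j)).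
apply: measurable_fun_mulmx; exact: measurable_funPT.
Qed.

Lemma opnormN p q (A : 'M[R]_(p, q)) : opnorm (- A) = opnorm A.
Proof.
rewrite /opnorm; congr sup; apply/seteqP; split => _ [v /= v1 <-]; exists v => //.
  by rewrite mulNmx enormN.
by rewrite mulNmx enormN.
Qed.

Definition simple_diff_cst : R := (m * m)%:R `^ alpha * 2 `^ alpha.

Lemma simple_diff_tail (S1 S2 : @simple_integrand R d m) (Q : 'cV[R]_d -> 'M[R]_m) (e : R) :
  measurable_fun setT Q -> 0 < e ->
  let a S := (\int[leb]_u (opnorm (Q u - simple_fun S u) `^ alpha)%:E)%E in
  (a S1 < +oo)%E -> (a S2 < +oo)%E ->
  (P [set w | e < enorm (simple_integral M S1 w - simple_integral M S2 w)]%R <=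
   (vector_tail_cst e * simple_diff_cst)%:E * (a S1 + a S2))%E.
Proof.
move=> mQ e0 a a1 a2.
have a12 : (a S1 + a S2 < +oo)%E.
  by move: (a S1) (a S2) a1 a2 => x y; exact: lte_add_pinfty.
pose G u := simple_fun S1 u - simple_fun S2 u.
have mG : measurable_fun setT G by apply: measurable_fun_mxB; exact: measurable_simple_fun.
have mQS S : measurable_fun setT (fun u => Q u - simple_fun S u).
  by apply: measurable_fun_mxB => //; exact: measurable_simple_fun.
have op0 (H : 'cV[R]_d -> 'M[R]_m) : (forall u, setT u -> (0 <= (opnorm (H u) `^ alpha)%:E)%E).
  by move=> u _; rewrite lee_fin powR_ge0.
have ub : (\int[leb]_u (norm1 (G u) `^ alpha)%:E <= simple_diff_cst%:E * (a S1 + a S2))%E.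
  apply: (@le_trans _ _ (\int[leb]_u (simple_diff_cst%:E *
     ((opnorm (Q u - simple_fun S1 u) `^ alpha)%:E + (opnorm (Q u - simple_fun S2 u) `^ alpha)%:E)))%E).
    apply: ge0_le_integral => //.
    - by move=> u _; rewrite lee_fin powR_ge0.
    - exact: measurable_norm1_powR.
    - apply: measurable_funeM; apply: emeasurable_funD;
      exact: (measurable_opnorm_powR (mQS _)).
    move=> u _; rewrite -EFinD -EFinM lee_fin /simple_diff_cst -mulrA.
    apply: (@le_trans _ _ (((m * m)%:R * (opnorm (Q u - simple_fun S1 u) +
        opnorm (Q u - simple_fun S2 u))) `^ alpha)).
      apply: ge0_ler_powR; rewrite ?nnegrE ?(ltW alpha0) ?norm1_ge0//.
        by rewrite mulr_ge0// addr_ge0 ?opnorm_ge0.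
      rewrite (le_trans (norm1_le_opnorm _))// ler_wpM2l//.
      rewrite -[opnorm (_ - simple_fun S1 u)]opnormN /G.
      rewrite -[X in opnorm X](_ : - (Q u - simple_fun S1 u) + (Q u - simple_fun S2 u) = _).
        exact: opnormD.
      by rewrite opprB addrA subrK.
    rewrite powRM ?addr_ge0 ?opnorm_ge0//.
    by rewrite ler_wpM2l ?powR_ge0// powRD_le ?opnorm_ge0.
  rewrite ge0_integralZl//; last 3 first.
  - by apply: emeasurable_funD; exact: (measurable_opnorm_powR (mQS _)).
  - by move=> u _; rewrite -EFinD lee_fin addr_ge0 ?powR_ge0.
  - by rewrite lee_fin mulr_ge0 ?powR_ge0.
  rewrite ge0_integralD//; first exact: (op0 (fun u => Q u - simple_fun S1 u)).
  - exact: (measurable_opnorm_powR (mQS _)).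
  - exact: (op0 (fun u => Q u - simple_fun S2 u)).
  - exact: (measurable_opnorm_powR (mQS _)).
rewrite EFinM -muleA; apply: le_trans (lee_wpmul2l _ ub); last first.
  by rewrite lee_fin vector_tail_cst_ge0.
apply: (vector_tail mG _ e0).
- by apply: measurable_fun_mxB; exact: measurable_simple_integral.
- apply: (le_lt_trans ub); apply: lte_mul_pinfty; [|by []|exact: a12].
  by rewrite lee_fin mulr_ge0 ?powR_ge0.
move=> theta.
have := charfun_simple alpha0 hM (fun b : bool => if b then S1 else S2)
  (fun b : bool => if b then theta else - theta).
rewrite (_ : (fun w => _) = fun w => dot theta (simple_integral M S1 w - simple_integral M S2 w)).
  under eq_integral do rewrite /combined_simple big_bool/= mulmxN -mulmxBl -linearB/=.
  by [].
apply/funext => w; rewrite big_bool/= dotDr dotNr; congr (_ + _).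
by rewrite dotC dotNr dotC.
Qed.

Lemma approximates_grid_simple (Q : 'cV[R]_d -> 'M[R]_m) (mQ : measurable_fun setT Q) :
  is_integrand alpha Q -> approximates alpha (grid_simple mQ) Q.
Proof.
move=> [_ Qoo]; rewrite /approximates.
have mQS n : measurable_fun setT (fun u => Q u - simple_fun (grid_simple mQ n) u).
  by apply: measurable_fun_mxB => //; exact: measurable_simple_fun.
pose K : R := (2 * (m * m)%:R) `^ alpha.
have nQS n u : norm1 (Q u - simple_fun (grid_simple mQ n) u) <= 2 * norm1 (Q u).
  rewrite (le_trans (norm1D _ _))// norm1N mulr_natl mulr2n lerD2l.
  by apply: ler_sum => i _; apply: ler_sum => j _; exact: grid_simple_le.
rewrite -(@integral0 _ _ _ leb setT).
apply: (@dominated_cvg _ _ _ leb setT measurableT _ _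
  (fun u => K%:E * (opnorm (Q u) `^ alpha)%:E)%E) => //.
- by move=> n; exact: (measurable_opnorm_powR (mQS n)).
- move=> u _; apply: cvg_EFin; first exact: nearW.
  rewrite -[X in _ --> X](@powR0 R alpha) ?gt_eqF//.
  apply: cvg_powR => //; first by move=> n; exact: opnorm_ge0.
  have h : norm1 (Q u - simple_fun (grid_simple mQ n) u) @[n --> \oo] --> (0 : R).
    rewrite -[X in _ --> X](_ : \sum_(i < m) \sum_(j < m) `|Q u i j - Q u i j| = 0); last first.
      by rewrite big1// => i _; rewrite big1// => j _; rewrite subrr normr0.
    apply: cvg_sumr => i; apply: cvg_sumr => j; apply: cvg_norm.
    under eq_fun do rewrite !mxE.
    by apply: cvgB; [exact: cvg_cst|exact: cvg_grid_simple].
  apply: (squeeze_cvgr _ (cvg_cst (0 : R)) h).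
  by apply: nearW => n; rewrite opnorm_ge0 opnorm_le_norm1.
- apply: integrableZl => //; apply/integrableP; split; first exact: measurable_opnorm_powR.
  under eq_integral do rewrite gee0_abs ?lee_fin ?powR_ge0//.
  exact: Qoo.
- move=> n u _; rewrite gee0_abs; last by rewrite lee_fin powR_ge0.
  rewrite /K -EFinM lee_fin.
  rewrite -powRM ?mulr_ge0 ?opnorm_ge0//; apply: ge0_ler_powR; rewrite ?nnegrE ?(ltW alpha0)//.
  + exact: opnorm_ge0.
  + by rewrite !mulr_ge0 ?opnorm_ge0.
  rewrite (le_trans (opnorm_le_norm1 _))// (le_trans (nQS n u))// -mulrA ler_wpM2l//.
  exact: norm1_le_opnorm.
Qed.

End stochastic_integrals.

(** * Existence and joint laws of stochastic integrals *)

Lemma enorm_cvg {R : realType} (m : nat) (v : nat -> 'cV[R]_m) (w : 'cV[R]_m) :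
  (forall i k, v n i k @[n --> \oo] --> w i k) -> enorm (v n) @[n --> \oo] --> enorm w.
Proof.
move=> vw; have h : norm1 (v n - w) @[n --> \oo] --> (0 : R).
  rewrite -[X in _ --> X](_ : norm1 (w - w) = 0); last by apply/eqP; rewrite norm1_eq0 subrr.
  apply: cvg_sumr => i; apply: cvg_sumr => j; apply: cvg_norm.
  by under eq_fun do rewrite !mxE; rewrite !mxE; apply: cvgB => //; exact: cvg_cst.
apply/cvgrPdist_le => e e0; move/cvgr0Pnorm_le: h => /(_ _ e0); apply: filterS => n.
rewrite ger0_norm ?norm1_ge0// => vwe.
have tri (a b : 'cV[R]_m) : enorm a - enorm b <= norm1 (a - b).
  rewrite lerBlDr (le_trans _ (lerD (enorm_le_norm1 _) (lexx _)))//.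
  by rewrite -{1}(subrK b a) enormD.
rewrite ler_norml; apply/andP; split; last first.
  by rewrite (le_trans (tri _ _))// -norm1N opprB.
by rewrite lerNl opprB (le_trans (tri _ _)).
Qed.

Section integral_existence.
Context {dO : measure_display} {Omega : measurableType dO} {R : realType}.
Variable P : probability Omega R.
Context {d m : nat}.
Variables (alpha : R) (alpha0 : 0 < alpha).
Variable M : set 'cV[R]_d -> {RV P >-> 'cV[R]_m}.
Hypothesis hM : sas_random_measure alpha M.
Local Notation leb := (lebesgue_cV d).

(** The difference of two simple functions is compared with [Q] from both sides, and its
    integral is small in probability by the tail bound. *)
Lemma approximates_close (S1 S2 : nat -> @simple_integrand R d m)
    (Q : 'cV[R]_d -> 'M[R]_m) (e e' : R) :
  measurable_fun setT Q -> approximates alpha S1 Q -> approximates alpha S2 Q ->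
  0 < e -> 0 < e' -> exists N, forall n k, (N <= n)%N -> (N <= k)%N ->
   (P [set w | e < enorm (simple_integral M (S1 n) w - simple_integral M (S2 k) w)]%R
     <= e'%:E)%E.
Proof.
move=> mQ aS1 aS2 e0 e'0.
pose K := @vector_tail_cst R m alpha e * @simple_diff_cst R m alpha.
have K0 : 0 <= K by rewrite mulr_ge0 ?vector_tail_cst_ge0// mulr_ge0 ?powR_ge0.
have eK : 0 < e' / (2 * (K + 1)) by rewrite divr_gt0// mulr_gt0// ltr_wpDl.
have small (S : nat -> @simple_integrand R d m) : approximates alpha S Q ->
    \forall n \near \oo,
      (\int[leb]_u (opnorm (Q u - simple_fun (S n) u) `^ alpha)%:E <= (e' / (2 * (K + 1)))%:E)%E.
  move=> /fine_cvgP[fS /cvgr0Pnorm_le/(_ _ eK) aS].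
  near=> n.
  have fn : (\int[leb]_u (opnorm (Q u - simple_fun (S n) u) `^ alpha)%:E)%E \is a fin_num.
    by near: n.
  rewrite -(fineK fn) lee_fin.
  apply: (@le_trans _ _ `|fine (\int[leb]_u (opnorm (Q u - simple_fun (S n) u) `^ alpha)%:E)|).
    exact: ler_norm.
  by near: n.
have [N _ hN] := filterI (small S1 aS1) (small S2 aS2).
exists N => n k Nn Nk.
have [+ _] := hN n Nn; have [_] := hN k Nk.
move=> /= a2 a1.
have oo1 := le_lt_trans a1 (ltry _).
have oo2 := le_lt_trans a2 (ltry _).
apply: (le_trans (simple_diff_tail alpha0 hM mQ e0 oo1 oo2)).
apply: (@le_trans _ _ (K%:E * ((e' / (2 * (K + 1)))%:E + (e' / (2 * (K + 1)))%:E))%E).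
  apply: lee_wpmul2l; first by rewrite lee_fin.
  by apply: leeD; [exact: a1|exact: a2].
rewrite -EFinD -EFinM lee_fin.
rewrite (_ : K * _ = e' * (K / (K + 1))); last by field; apply/lt0r_neq0; lra.
by rewrite ler_piMr ?(ltW e'0)// ler_pdivrMr ?ltr_wpDl// mul1r lerDl.
Unshelve. all: by end_near. Qed.

(** The simple integrals of grid approximations are Cauchy in probability, and the comparison of two
approximating sequences makes the limit independent of the choice. *)
Lemma stochastic_integral_exists (Q : 'cV[R]_d -> 'M[R]_m) : is_integrand alpha Q ->
  exists X : {RV P >-> 'cV[R]_m}, stochastic_integral alpha M Q X.
Proof.
move=> iQ; have [mQ _] := iQ.
have aS0 := approximates_grid_simple alpha0 mQ iQ.
have [||Z mZ cZ] := @cauchy_in_probability _ _ _ P m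
  (fun n => simple_integral M (grid_simple mQ n)).
- by move=> n; exact: measurable_simple_integral.
- by move=> e e0; exact: (approximates_close mQ aS0 aS0 e0 e0).
pose X : {RV P >-> 'cV[R]_m} := HB.pack Z (isMeasurableFun.Build _ _ _ _ Z mZ).
exists X; split => //; first by exists (grid_simple mQ).
move=> S aS e e0; apply: cvg_ereal0 => [n|e' e'0]; first exact: measure_ge0.
have e2 : 0 < e / 2 by rewrite divr_gt0.
have e'2 : 0 < e' / 2 by rewrite divr_gt0.
have [N hN] := approximates_close mQ aS aS0 e2 e'2.
have /fine_cvgP[fP /cvgr0Pnorm_le/(_ _ e'2) hP] := cZ _ e2.
near \oo => k.
have Nk : (N <= k)%N by near: k; exact: nbhs_infty_ge.
have Pk : (P [set w | e / 2 < enorm (simple_integral M (grid_simple mQ k) w - Z w)]%R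
    <= (e' / 2)%:E)%E.
  rewrite -[leLHS]fineK ?fin_num_measure//; last first.
    apply: measurable_enorm_gt; apply: measurable_fun_mxB => //.
    exact: measurable_simple_integral.
  rewrite lee_fin; apply: le_trans (ler_norm _) _.
  by near: k.
exists N => // n /= Nn.
have mI T := @measurable_simple_integral _ _ _ P d m M T.
apply: (@le_trans _ _ (P [set w | e / 2 + e / 2 <
   enorm ((simple_integral M (S n) w - simple_integral M (grid_simple mQ k) w) +
    (simple_integral M (grid_simple mQ k) w - Z w))]%R)).
  apply: le_measure; rewrite ?inE.
  - by apply: measurable_enorm_gt; exact: measurable_fun_mxB.
  - by apply: measurable_enorm_gt; apply: measurable_fun_mxD; exact: measurable_fun_mxB.
  by move=> w /=; rewrite addrA subrK -splitr.
have m1 : measurable_fun setT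
    (fun w => simple_integral M (S n) w - simple_integral M (grid_simple mQ k) w).
  exact: measurable_fun_mxB.
have m2 : measurable_fun setT (fun w => simple_integral M (grid_simple mQ k) w - Z w).
  exact: measurable_fun_mxB.
apply: (le_trans (prob_enormD P (e / 2) (e / 2) m1 m2)).
by rewrite [e' in leRHS]splitr EFinD; apply: leeD => //; exact: hN.
Unshelve. all: by end_near. Qed.

Section joint_law.
Context {J : finType} (Q : J -> 'cV[R]_d -> 'M[R]_m) (X : J -> {RV P >-> 'cV[R]_m}).
Hypothesis QX : forall j, stochastic_integral alpha M (Q j) (X j).
Variable theta : J -> 'cV[R]_m.

Let mQ j : measurable_fun setT (Q j). Proof. by have [[]] := QX j. Qed.

Let S n j := grid_simple (mQ j) n.

Let Zn n w := \sum_j dot (theta j) (simple_integral M (S n j) w).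
Let Z w := \sum_j dot (theta j) (X j w).

Let mX j : measurable_fun setT (X j). Proof. exact: measurable_funPT. Qed.

Let mI j n : measurable_fun setT (simple_integral M (S n j)).
Proof. exact: measurable_simple_integral. Qed.

Let cvg_Zn (e : R) : 0 < e -> P [set w | e < `|Zn n w - Z w|] @[n --> \oo] --> 0%E.
Proof.
move=> e0.
have mZn n : measurable_fun setT (fun w => Zn n w - Z w).
  by apply: measurable_funB; apply: measurable_sum => j; exact: measurable_dot_comp.
pose b j := e / ((#|J|.+1)%:R * (enorm (theta j) + 1)).
have b0 j : 0 < b j.
  by rewrite divr_gt0// mulr_gt0// ltr_wpDl// enorm_ge0.
have ub n : (P [set w | e < `|Zn n w - Z w|]%R <=
    \sum_j P [set w | b j < enorm (simple_integral M (S n j) w - X j w)]%R)%E.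
  apply: union_bound.
  - by apply: (measurable_gt (f := fun w => `|Zn n w - Z w|)); exact: measurableT_comp.
  - by move=> j; apply: measurable_enorm_gt; exact: measurable_fun_mxB.
  move=> w /= ew; apply: contrapT => h; move: ew; rewrite ltNge => /negP; apply.
  have hj j : enorm (simple_integral M (S n j) w - X j w) <= b j.
    by rewrite leNgt; apply/negP => hj; apply: h; exists j.
  rewrite /Zn /Z -sumrB (le_trans (ler_norm_sum _ _ _))//.
  apply: (@le_trans _ _ (\sum_(j : J) e / #|J|.+1%:R)); last first.
    rewrite sumr_const -[leLHS]mulr_natl mulrCA ger_pMr// ler_pdivrMr// mul1r ler_nat.
    exact: leqnSn.
  apply: ler_sum => j _; rewrite -dotNr -dotDr.
  have cs (u v : 'cV[R]_m) : `|dot u v| <= enorm u * enorm v.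
    rewrite ler_norml cauchy_schwarz andbT lerNl -dotNr -(enormN v).
    exact: cauchy_schwarz.
  apply: (le_trans (cs _ _)).
  have t1 : 0 < enorm (theta j) + 1 by rewrite ltr_wpDl// enorm_ge0.
  apply: (@le_trans _ _ ((enorm (theta j) + 1) * b j)).
    by apply: ler_pM => //; rewrite ?enorm_ge0// lerDl.
  by rewrite /b invfM mulrCA [X in e * X <= _]mulrCA mulfV ?gt_eqF// mulr1.
apply: (@squeeze_cvge _ _ _ _ (cst 0%E) _
  (fun n => \sum_j P [set w | b j < enorm (simple_integral M (S n j) w - X j w)]%R)%E).
- by apply: nearW => n /=; rewrite measure_ge0 ub.
- exact: cvg_cst.
rewrite -[X in _ --> X](_ : \sum_(j : J) 0%E = 0%E); last by rewrite big1.
apply: cvg_nnesum => j _; first by apply: nearW => n; exact: measure_ge0.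
have [iQ _ cX] := QX j.
exact: (cX _ (approximates_grid_simple alpha0 (mQ j) iQ) (b j) (b0 j)).
Qed.

Let D (u : 'cV[R]_d) : R := #|J|%:R `^ alpha *
  \sum_j ((m * m)%:R * enorm (theta j)) `^ alpha * opnorm (Q j u) `^ alpha.

Let iD : leb.-integrable setT (EFin \o D).
Proof.
have -> : EFin \o D = (fun u => (#|J|%:R `^ alpha)%:E *
    \sum_j ((((m * m)%:R * enorm (theta j)) `^ alpha)%:E * (opnorm (Q j u) `^ alpha)%:E))%E.
  apply/funext => u; rewrite /D /= EFinM -sumEFin; congr (_ * _)%E.
apply: integrableZl => //; apply: integrable_sum => //= j _.
apply: integrableZl => //; apply/integrableP; split; first exact: measurable_opnorm_powR.
under eq_integral do rewrite gee0_abs ?lee_fin ?powR_ge0//.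
by have [[]] := QX j.
Qed.

Let D_ge u (T : J -> 'M[R]_m) : (forall j i k, `|T j i k| <= `|Q j u i k|) ->
  enorm (\sum_j (T j)^T *m theta j) `^ alpha <= D u.
Proof.
move=> TQ; rewrite /D.
apply: (@le_trans _ _ ((\sum_j (m * m)%:R * enorm (theta j) * opnorm (Q j u)) `^ alpha)).
  apply: ge0_ler_powR; rewrite ?nnegrE ?(ltW alpha0) ?enorm_ge0//.
    by apply: sumr_ge0 => j _; rewrite !mulr_ge0 ?enorm_ge0 ?opnorm_ge0.
  rewrite (le_trans (enorm_sum _ _))//; apply: ler_sum => j _.
  rewrite (le_trans (enorm_mulmx _ _))// norm1_tr mulrAC ler_wpM2r ?enorm_ge0//.
  apply: le_trans (norm1_le_opnorm _).
  by apply: ler_sum => i _; apply: ler_sum => k _; exact: TQ.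
rewrite (le_trans (powR_sum_le _ _))//.
  by move=> j; rewrite !mulr_ge0 ?enorm_ge0 ?opnorm_ge0.
rewrite ler_wpM2l ?powR_ge0//; apply: ler_sum => j _.
by rewrite powRM ?mulr_ge0 ?enorm_ge0 ?opnorm_ge0.
Qed.

Let mcomb (T : J -> 'cV[R]_d -> 'M[R]_m) : (forall j, measurable_fun setT (T j)) ->
  measurable_fun setT (fun u => \sum_j (T j u)^T *m theta j).
Proof.
move=> mT; elim: (index_enum J) => [|j s IH].
  by under eq_fun do rewrite big_nil; exact: measurable_cst.
under eq_fun do rewrite big_cons; apply: measurable_fun_mxD => //.
exact: measurable_fun_mulmxtr.
Qed.

Lemma integral_combined_fin :
  (\int[leb]_u (enorm (\sum_j (Q j u)^T *m theta j) `^ alpha)%:E < +oo)%E.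
Proof.
have /integrableP[mD Doo] := iD.
apply: le_lt_trans Doo; apply: ge0_le_integral => //.
- by move=> u _; rewrite lee_fin powR_ge0.
- by apply: measurable_enorm_powR; exact: mcomb.
- exact: measurableT_comp.
move=> u _; apply: (@le_trans _ _ (D u)%:E); last by rewrite lee_fin ler_norm.
by rewrite lee_fin D_ge.
Qed.

(** For simple functions this is the formula for families of sets; both sides pass to the limit, the
exponent by dominated convergence along grid approximations bounded by the integrands. *)
Lemma charfun_integrals : has_charfun P (fun w => \sum_j dot (theta j) (X j w))
  (expR (- fine (\int[leb]_u (enorm (\sum_j (Q j u)^T *m theta j) `^ alpha)%:E)%E)).
Proof.
apply: (@has_charfun_lim _ _ _ P Zn Z (fun n =>
  expR (- fine (\int[leb]_u (enorm (combined_simple (S n) theta u) `^ alpha)%:E)%E))).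
- by move=> n; apply: measurable_sum => j; exact: measurable_dot_comp.
- by apply: measurable_sum => j; exact: measurable_dot_comp.
- by move=> e; exact: cvg_Zn.
- by move=> n; exact: charfun_simple.
apply: (continuous_cvg _ (@continuous_expR R _)); apply: cvgN.
have cint : (\int[leb]_u (enorm (combined_simple (S n) theta u) `^ alpha)%:E)%E @[n --> \oo] -->
    (\int[leb]_u (enorm (\sum_j (Q j u)^T *m theta j) `^ alpha)%:E)%E.
  apply: (@dominated_cvg _ _ _ leb setT measurableT _ _ (EFin \o D)) => //.
  - move=> n; apply: measurable_enorm_powR; apply: mcomb => j.
    exact: measurable_simple_fun.
  - move=> u _; apply: cvg_EFin; first exact: nearW.
    apply: cvg_powR => //; first by move=> n; exact: enorm_ge0.
    apply: enorm_cvg => i k; rewrite ord1.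
    under eq_fun do rewrite /combined_simple summxE.
    rewrite summxE; apply: cvg_sumr => j.
    under eq_fun do rewrite mxE.
    rewrite mxE; apply: cvg_sumr => l; apply: cvgMl.
    under eq_fun do rewrite mxE.
    by rewrite mxE; exact: cvg_grid_simple.
  - move=> n u _; rewrite gee0_abs; last by rewrite lee_fin powR_ge0.
    rewrite lee_fin; apply: D_ge => j i k; exact: grid_simple_le.
have fin_lim : (\int[leb]_u (enorm (\sum_j (Q j u)^T *m theta j) `^ alpha)%:E)%E \is a fin_num.
  rewrite ge0_fin_numE; first exact: integral_combined_fin.
  by apply: integral_ge0 => u _; rewrite lee_fin powR_ge0.
by apply: fine_cvg; rewrite fineK.
Qed.

End joint_law.

End integral_existence.

(** * Laws determined by characteristic functions *)

Section laws.
Context {R : realType} {m k : nat}.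

Let pushforward_bounded d (T : measurableType d) (P : probability T R)
    (U : T -> 'M[R]_(m, k)) (mU : measurable_fun setT U) (f : 'M[R]_(m, k) -> R) :
  measurable_fun setT f -> (forall v, `|f v| <= 1) ->
  \int[measure_function_pushforward__canonical__measure_function_Measure P mU]_v f v =
  \int[P]_w f (U w).
Proof.
move=> mf f1; rewrite /Rintegral integral_pushforward//; first exact/measurable_EFinP.
have Pfin : (P setT < +oo)%E by rewrite probability_setT ltry.
rewrite preimage_setT; apply: (bounded_integrable Pfin (K := 1)) => //.
exact: measurableT_comp mf mU.
Qed.

(** Pushing both laws forward to the space of matrices reduces this to the uniqueness of Fourier
transforms of finite measures. *)
Lemma eq_law_fourier d1 d2 (T1 : measurableType d1) (T2 : measurableType d2)
    (P1 : probability T1 R) (P2 : probability T2 R)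
    (U : T1 -> 'M[R]_(m, k)) (V : T2 -> 'M[R]_(m, k)) :
  measurable_fun setT U -> measurable_fun setT V ->
  (forall A, \int[P1]_w cos (mxdot A (U w)) = \int[P2]_w cos (mxdot A (V w))) ->
  (forall A, \int[P1]_w sin (mxdot A (U w)) = \int[P2]_w sin (mxdot A (V w))) ->
  forall B, measurable B -> P1 [set w | B (U w)] = P2 [set w | B (V w)].
Proof.
move=> mU mV hcos hsin B mB.
pose mu := measure_function_pushforward__canonical__measure_function_Measure P1 mU.
pose nu := measure_function_pushforward__canonical__measure_function_Measure P2 mV.
have mc A : measurable_fun setT (fun v : 'M[R]_(m, k) => cos (mxdot A v)).
  by apply: measurable_cos_comp; exact: measurable_mxdot.
have ms A : measurable_fun setT (fun v : 'M[R]_(m, k) => sin (mxdot A v)).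
  by apply: measurable_sin_comp; exact: measurable_mxdot.
have : mu B = nu B.
  apply: eq_measure_fourier => //.
  - by rewrite /mu /= /pushforward preimage_setT probability_setT ltry.
  - by rewrite /nu /= /pushforward preimage_setT probability_setT ltry.
  - move=> A; rewrite !pushforward_bounded//; move=> v; exact: cos_max.
  - move=> A; rewrite !pushforward_bounded//; move=> v; exact: sin_max.
by [].
Qed.

End laws.

(** * The Gaussian characteristic function *)

Section density.
Context d (T : measurableType d) {R : realType}.
Variables (mu nu : {measure set T -> \bar R}) (p : T -> R).
Hypothesis mp : measurable_fun setT p.
Hypothesis p0 : forall x, 0 <= p x.
Hypothesis nuE : forall A, measurable A -> nu A = (\int[mu]_(x in A) (p x)%:E)%E.
Local Open Scope ereal_scope.
Import HBNNSimple.

Let integral_density_nnsfun (f : {nnsfun T >-> R}) :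
  \int[nu]_x (f x)%:E = \int[mu]_x ((f x)%:E * (p x)%:E).
Proof.
under [LHS]eq_integral do rewrite fimfunE -fsumEFin//.
rewrite [LHS]ge0_integral_fsum//; last 2 first.
  - by move=> r; exact/measurable_EFinP/measurableT_comp.
  - by move=> r x _; rewrite EFinM nnfun_muleindic_ge0.
under [RHS]eq_integral.
  move=> x _; rewrite fimfunE -fsumEFin// muleC ge0_mule_fsumr; last first.
    by move=> r; rewrite EFinM nnfun_muleindic_ge0.
  over.
rewrite [RHS]ge0_integral_fsum//; last 2 first.
  - move=> r; apply: emeasurable_funM; first exact/measurable_EFinP.
    exact/measurable_EFinP/measurableT_comp.
  - move=> r x _; apply: mule_ge0; first by rewrite lee_fin.
    by rewrite EFinM nnfun_muleindic_ge0.
apply: eq_fsbigr => r; rewrite inE => -[x _ fxr].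
have r0 : (0 <= r)%R by rewrite -fxr.
have mf : measurable (f @^-1` [set r]) by exact: measurable_sfunP.
under eq_integral do rewrite EFinM.
rewrite ge0_integralZl//; last exact/measurable_EFinP/measurable_indic.
rewrite integral_indic// setIT nuE// -ge0_integralZl//; last 2 first.
- exact/measurable_EFinP/measurable_funTS.
- by move=> y _; rewrite lee_fin.
rewrite integral_mkcond; apply: eq_integral => y _.
rewrite patchE indicE; case: ifPn => _; last by rewrite mulr0 mule0.
by rewrite mulr1 muleC.
Qed.

Lemma ge0_integral_density (f : T -> \bar R) : measurable_fun setT f ->
  (forall x, 0 <= f x) -> \int[nu]_x f x = \int[mu]_x (f x * (p x)%:E).
Proof.
move=> mf f0; pose g := nnsfun_approx measurableT mf.
have fg x : (g n x)%:E @[n --> \oo] --> f x by apply: cvg_nnsfun_approx.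
have cn := @cvg_monotone_convergence _ _ _ nu setT measurableT (fun n x => (g n x)%:E).
have cm := @cvg_monotone_convergence _ _ _ mu setT measurableT (fun n x => (g n x)%:E * (p x)%:E).
have hn : \int[nu]_x (g n x)%:E @[n --> \oo] --> \int[nu]_x limn (fun n => (g n x)%:E).
  apply: cn => //.
  - by move=> n; exact/measurable_EFinP.
  - by move=> n x _; rewrite lee_fin.
  - by move=> x _ a b ab; rewrite lee_fin; exact/lefP/nd_nnsfun_approx.
have hm : \int[mu]_x ((g n x)%:E * (p x)%:E) @[n --> \oo] -->
    \int[mu]_x limn (fun n => (g n x)%:E * (p x)%:E).
  apply: cm => //.
  - by move=> n; apply: emeasurable_funM; exact/measurable_EFinP.
  - by move=> n x _; rewrite mule_ge0// lee_fin.
  - move=> x _ a b ab; apply: lee_wpmul2r; rewrite lee_fin//.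
    exact/lefP/nd_nnsfun_approx.
have -> : \int[nu]_x f x = \int[nu]_x limn (fun n => (g n x)%:E).
  by apply: eq_integral => x _; apply/esym/cvg_lim => //; exact: fg.
have -> : \int[mu]_x (f x * (p x)%:E) = \int[mu]_x limn (fun n => (g n x)%:E * (p x)%:E).
  apply: eq_integral => x _; apply/esym/cvg_lim => //; apply: cvgeZr => //.
rewrite -(cvg_lim _ hn)// -(cvg_lim _ hm)//.
by under eq_fun do rewrite integral_density_nnsfun.
Qed.

End density.

Section gaussian.
Context {R : realType}.
Notation mu := (@lebesgue_measure R).
Implicit Types (s t c x : R).

Definition bell s x : R := expR (- (x ^+ 2 / (2 * s ^+ 2))).

Lemma ge0_integral_scale (K : R) (f : R -> R) : 0 <= K -> measurable_fun setT f ->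
  (forall x, 0 <= f x) ->
  (\int[mu]_x (K * f x)%:E = K%:E * \int[mu]_x (f x)%:E)%E.
Proof.
move=> K0 mf f0; rewrite -ge0_integralZl//.
- exact/measurable_EFinP.
- by move=> x _; rewrite lee_fin.
Qed.

Lemma normal_pdf_bell s x : s != 0 -> normal_pdf 0 s x = normal_peak s * bell s x.
Proof.
move=> s0; rewrite normal_pdfE// /normal_fun /bell subr0.
by congr (_ * expR _); rewrite mulNr mulr_natl.
Qed.

Lemma bell_ge0 s x : 0 <= bell s x. Proof. exact: expR_ge0. Qed.

#[local] Hint Resolve bell_ge0 : core.

Lemma measurable_bell s : s != 0 -> measurable_fun setT (bell s).
Proof.
move=> s0; have -> : bell s = (fun x => (normal_peak s)^-1 * normal_pdf 0 s x).
  apply/funext => x; rewrite normal_pdf_bell// mulKf// gt_eqF//; exact: normal_peak_gt0.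
by apply: measurable_funM => //; exact: measurable_normal_pdf.
Qed.

Lemma integrable_bell s K b : 0 < s ->
  mu.-integrable setT (EFin \o (fun x => K * bell s (x + b))).
Proof.
move=> s0; have sn0 : s != 0 by rewrite gt_eqF.
have mq : measurable_fun setT (fun x : R => bell s (x + b)).
  by apply: (measurableT_comp (measurable_bell sn0)); exact: measurable_funD.
apply/integrableP; split.
  by apply/measurable_EFinP; exact: measurable_funM.
rewrite (eq_integral (fun x : measurableTypeR R => (`|K| * bell s (1 * x + b))%:E)); last first.
  by move=> x _; rewrite mul1r /= normrM [`|bell _ _|]ger0_norm.
rewrite ge0_integral_scale//; last by under eq_fun do rewrite mul1r.
have := @ge0_integral_affine R 1 b (fun x => (bell s x)%:E) (oner_neq0 R).
rewrite normr1 mul1e => ->; last 2 first.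
- by apply/measurable_EFinP; exact: measurable_bell.
- by move=> x; rewrite lee_fin.
apply: lte_mul_pinfty => //.
have p0 := normal_peak_gt0 sn0.
rewrite (eq_integral (fun x : measurableTypeR R => ((normal_peak s)^-1 * normal_pdf 0 s x)%:E)); last first.
  by move=> x _; rewrite normal_pdf_bell// mulKf// gt_eqF.
rewrite ge0_integral_scale ?invr_ge0 ?(ltW p0)//; last 2 first.
- exact: measurable_normal_pdf.
- by move=> x; exact: normal_pdf_ge0.
by rewrite integral_normal_pdf mule1 ltry.
Qed.

Lemma normM_bell_le s x : 0 < s -> `|x| * bell s x <= 2 * s * bell (2 * s) x.
Proof.
move=> s0; set y := `|x| / s.
have y0 : 0 <= y by rewrite divr_ge0// ltW.
have xE : `|x| = y * s by rewrite divfK// gt_eqF.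
have -> : bell s x = expR (- (3 / 8 * y ^+ 2)) * bell (2 * s) x.
  rewrite /bell -expRD; congr expR; rewrite -(real_normK (num_real x)) xE; field.
  by rewrite gt_eqF.
rewrite mulrA ler_wpM2r// xE expRN ler_pdivrMr ?expR_gt0//.
have h : y <= 2 * expR (3 / 8 * y ^+ 2).
  by have := expR_ge1Dx (3 / 8 * y ^+ 2); nra.
by rewrite [leRHS]mulrAC ler_wpM2r// ltW.
Qed.

Lemma bell_shift_le s h x : 0 < s -> `|h| < s -> bell (2 * s) (x + h) <= expR 1 * bell (4 * s) x.
Proof.
move=> s0 hs; rewrite /bell -expRD ler_expR.
have sn0 : s != 0 by rewrite gt_eqF.
have -> : x = x / s * s by rewrite divfK.
have -> : h = h / s * s by rewrite divfK.
have : `|h / s| <= 1 by rewrite normf_div [`|s|]gtr0_norm// ler_pdivrMr// mul1r ltW.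
move: (x / s) (h / s) => y k k1.
have -> : (y * s + k * s) ^+ 2 / (2 * (2 * s) ^+ 2) = (y + k) ^+ 2 / 8 by field.
have -> : (y * s) ^+ 2 / (2 * (4 * s) ^+ 2) = y ^+ 2 / 32 by field.
have k2 : k ^+ 2 <= 1 by rewrite -(real_normK (num_real k)) exprn_ile1.
have := sqr_ge0 (3 * y + 4 * k); nra.
Qed.

(** Differentiation under the integral sign, with a wide bell as dominating function. *)
Lemma is_derive_bell_integral (f df : R -> R -> R) s K : 0 < s -> 0 <= K ->
  (forall t, measurable_fun setT (f t)) ->
  (forall t x, `|t| < s -> `|f t x| <= K * bell (4 * s) x) ->
  (forall t x, `|t| < s -> is_derive t (1 : R) (f ^~ x) (df t x)) ->
  (forall t x, `|t| < s -> `|df t x| <= K * bell (4 * s) x) ->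
  is_derive (0 : R) (1 : R) (fun t => \int[mu]_x f t x) (\int[mu]_x df 0 x).
Proof.
move=> s0 K0 mf fK fd dfK.
have sI t : `](- s), s[%classic t -> `|t| < s.
  by rewrite /= in_itv/= => /andP[*]; rewrite ltr_norml; apply/andP.
have I0 : `](- s), s[%classic (0 : R) by rewrite /= in_itv/= oppr_lt0 s0.
have s40 : 0 < 4 * s by rewrite mulr_gt0.
have intG : mu.-integrable setT (EFin \o (fun x => K * bell (4 * s) x)).
  have := integrable_bell K 0 s40; apply: eq_integrable => // x _.
  by rewrite /= addr0.
have intf t : `](- s), s[%classic t -> mu.-integrable setT (EFin \o f t).
  move=> /sI ts; apply: le_integrable intG => //.
    by have /measurable_EFinP := mf t.
  by move=> x _; rewrite lee_fin [leRHS]ger0_norm ?mulr_ge0//; exact: fK.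
have derf t x : `](- s), s[%classic t -> setT x -> derivable (f ^~ x) t 1.
  by move=> /sI ts _; have [] := fd _ x ts.
have d1 t x : `|t| < s -> partial1of2 f t x = df t x.
  by move=> ts; rewrite partial1of2E; have [_] := fd _ x ts.
have G0 x : 0 <= K * bell (4 * s) x by rewrite mulr_ge0.
have Gub t x : `](- s), s[%classic t -> setT x -> `|partial1of2 f t x| <= K * bell (4 * s) x.
  by move=> /sI ts _; rewrite d1//; exact: dfK.
apply: DeriveDef; first exact: (derivable_under_integral measurableT I0 intf derf G0 intG Gub).
rewrite -derive1E (differentiation_under_integral measurableT I0 intf derf G0 intG Gub).
by apply: eq_Rintegral => x _; rewrite d1// normr0.
Qed.

Lemma is_derive_translate (f : R -> R) a b : is_derive (0 : R) (1 : R) (fun h => f (a + h)) b ->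
  is_derive a (1 : R) f b.
Proof.
move=> df.
have d2 : is_derive a (1 : R) (fun t => t - a) 1.
  by apply: is_derive_eq; rewrite oppr0 addr0.
have df' : is_derive (a - a) (1 : R) (fun h => f (a + h)) b by rewrite subrr.
have := @is_derive1_comp R (fun h => f (a + h)) (fun t => t - a) a _ _ df' d2.
by rewrite mulr1 /comp; under eq_fun do rewrite addrC subrK.
Qed.

Lemma Rintegral_shift (f : R -> R) h : measurable_fun setT f ->
  \int[mu]_x f (x + h) = \int[mu]_x f x.
Proof.
move=> mf; rewrite /Rintegral integralE [in RHS]integralE.
have aff (g : R -> \bar R) : measurable_fun setT g -> (forall x, 0 <= g x)%E ->
    (\int[mu]_x g (x + h)%R = \int[mu]_x g x)%E.
  move=> mg g0; rewrite -(@ge0_integral_affine R 1 h g (oner_neq0 R) mg g0).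
  by rewrite normr1 mul1e; under [in RHS]eq_integral do rewrite mul1r.
have mf' : measurable_fun setT (EFin \o f) by exact/measurable_EFinP.
congr (fine (_ - _)).
- have m1 := measurable_funepos mf'.
  have p0 x : (0 <= (EFin \o f)^\+ x)%E by exact: funepos_ge0.
  apply: etrans (aff _ m1 p0); apply: eq_integral => x _. by rewrite !funeposE.
- have m1 := measurable_funeneg mf'.
  have p0 x : (0 <= (EFin \o f)^\- x)%E by exact: funeneg_ge0.
  by apply: etrans (aff _ m1 p0); apply: eq_integral => x _; rewrite !funenegE.
Qed.

Lemma bell_le s x : 0 < s -> bell s x <= bell (2 * s) x.
Proof.
move=> s0; rewrite ler_expR lerN2 ler_wpM2l ?sqr_ge0// lef_pV2 ?posrE ?mulr_gt0 ?exprn_gt0// ?mulr_gt0//.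
have := sqr_ge0 s; lra.
Qed.

Lemma bell_le4 s x : 0 < s -> bell (2 * s) x <= bell (4 * s) x.
Proof.
move=> s0; have := @bell_le (2 * s) x; rewrite mulrA -natrM; apply.
by rewrite mulr_gt0.
Qed.

Lemma cos_bell_le s t c x : `|cos (t * x + c) * bell s x| <= bell s x.
Proof. by rewrite normrM [`|bell _ _|]ger0_norm// ler_piMl// cos_max. Qed.

Lemma sin_bell_le s t c x : 0 < s -> `|- (x * sin (t * x + c)) * bell s x| <= 2 * s * bell (2 * s) x.
Proof.
move=> s0; rewrite normrM normrN normrM [`|bell _ _|]ger0_norm//.
apply: le_trans (normM_bell_le x s0); rewrite ler_wpM2r// ler_piMr// sin_max//.
Qed.

Lemma is_derive_cosM x c t :
  is_derive t (1 : R) (fun t => cos (t * x + c)) (- (x * sin (t * x + c))).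
Proof.
have d1 : is_derive t (1 : R) (fun t : R => t * x + c) x.
  by apply: is_derive_eq; rewrite scaler0 add0r addr0 /GRing.scale/= mulr1.
have := @is_derive1_comp R (@cos R) (fun t => t * x + c) t _ _ (is_derive_cos _) d1.
by move=> h; apply: (is_derive_eq' h); rewrite mulNr mulrC.
Qed.

Lemma is_derive_addl (x h : R) : is_derive h (1 : R) (fun h => x + h) 1.
Proof.
have dx : is_derive h (1 : R) (fun=> x : R) 0 by exact: is_derive_cst.
have di : is_derive h (1 : R) (fun h : R => h) 1 by exact: is_derive_id.
by apply: (is_derive_eq' (is_deriveD dx di)); rewrite add0r.
Qed.

Lemma is_derive_sqrM (k x h : R) :
  is_derive h (1 : R) (fun h => k * (x + h) ^+ 2) (2 * k * (x + h)).
Proof.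
have da := is_derive_addl x h.
have dk : is_derive h (1 : R) (fun=> k : R) 0 by exact: is_derive_cst.
have := is_deriveM dk (is_deriveM da da).
move=> d; apply: (is_derive_eq' d).
by rewrite /GRing.scale/=; ring.
Qed.

Lemma is_derive_bell s h x : s != 0 ->
  is_derive h (1 : R) (fun h => bell s (x + h)) (- ((x + h) / s ^+ 2) * bell s (x + h)).
Proof.
move=> s0.
have d1 : is_derive h (1 : R) (fun h : R => - ((x + h) ^+ 2 / (2 * s ^+ 2))) (- ((x + h) / s ^+ 2)).
  have := is_derive_sqrM (- (2 * s ^+ 2)^-1) x h.
  under eq_fun do rewrite mulNr mulrC.
  by move=> d; apply: (is_derive_eq' d); field.
have := @is_derive1_comp R (@expR R) _ h _ _ (is_derive_expR _) d1.
by move=> h'; apply: (is_derive_eq' h'); rewrite mulrC.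
Qed.

Lemma measurable_affine t c : measurable_fun setT (fun x : R => t * x + c).
Proof.
have h : measurable_fun setT (fun x : R => t * (x + 0) + c).
  by apply: measurable_funD => //; apply: measurable_funM => //; exact: measurable_funD.
by under eq_fun do rewrite -[x in t * x]addr0.
Qed.

Lemma measurable_cos_affine t c : measurable_fun setT (fun x : R => cos (t * x + c)).
Proof. by apply: measurable_cos_comp; exact: measurable_affine. Qed.

Lemma measurable_sin_affine t c : measurable_fun setT (fun x : R => sin (t * x + c)).
Proof. by apply: measurable_sin_comp; exact: measurable_affine. Qed.

Lemma measurable_cos_bell s t c : s != 0 ->
  measurable_fun setT (fun x : R => cos (t * x + c) * bell s x).
Proof.
move=> s0; apply: measurable_funM; last exact: measurable_bell.
exact: measurable_cos_affine.
Qed.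

Lemma measurable_sin_bell s t c : s != 0 ->
  measurable_fun setT (fun x : R => - (x * sin (t * x + c)) * bell s x).
Proof.
move=> s0; apply: measurable_funM; last exact: measurable_bell.
have h := measurable_funM (@measurable_id _ _ [set: R]) (measurable_sin_affine t c).
have h2 := measurableT_comp (@oppr_measurable R setT) h.
exact: h2.
Qed.

(** Integration by parts on the whole line, obtained by differentiating the integral of a translate,
which is constant. *)
Lemma sin_bell_by_parts s t c : 0 < s ->
  \int[mu]_x (- (x * sin (t * x + c)) * bell s x) =
  - (s ^+ 2 * t) * \int[mu]_x (cos (t * x + c) * bell s x).
Proof.
move=> s0; have sn0 : s != 0 by rewrite gt_eqF.
pose g x := sin (t * x + c) * bell s x.
have mg : measurable_fun setT g.
  rewrite /g; apply: measurable_funM; last exact: measurable_bell.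
  exact: measurable_sin_affine.
pose df (h x : R) := (t * cos (t * (x + h) + c) -
  ((x + h) / s ^+ 2) * sin (t * (x + h) + c)) * bell s (x + h).
pose K := expR 1 * (1 + `|t| + 2 / s).
have dg : is_derive (0 : R) (1 : R) (fun h => \int[mu]_x g (x + h)) (\int[mu]_x df 0 x).
  have s1 : 1 <= 1 + `|t| + 2 / s.
    by rewrite -addrA lerDl addr_ge0// divr_ge0// ltW.
  apply: (@is_derive_bell_integral (fun h x => g (x + h)) df s K) => //.
  - by rewrite mulr_ge0 ?expR_ge0// (le_trans ler01).
  - by move=> h; apply: (measurableT_comp mg); exact: measurable_funD.
  - move=> h x hs; rewrite /g normrM [`|bell _ _|]ger0_norm//.
    apply: (@le_trans _ _ (1 * bell (2 * s) (x + h))).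
      by apply: ler_pM => //; [exact: sin_max|exact: bell_le].
    rewrite mul1r; apply: le_trans (bell_shift_le x s0 hs) _.
    by rewrite ler_wpM2r// ler_peMr// expR_ge0.
  - move=> h x _; rewrite /g.
    have d1 : is_derive h (1 : R) (fun h : R => t * (x + h) + c) t.
      have dt : is_derive h (1 : R) (fun=> t : R) 0 by exact: is_derive_cst.
      have dc : is_derive h (1 : R) (fun=> c : R) 0 by exact: is_derive_cst.
      have da := is_derive_addl x h.
      have d := is_deriveD (is_deriveM dt da) dc.
      by apply: (is_derive_eq' d); rewrite /GRing.scale/=; ring.
    have d2 := @is_derive1_comp R (@sin R) (fun h => t * (x + h) + c) h _ _ (is_derive_sin _) d1.
    have := is_deriveM d2 (is_derive_bell h x sn0).
    move=> h'; apply: (is_derive_eq' h').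
    by rewrite /df /GRing.scale/=; ring.
  - move=> h x hs; rewrite /df normrM [`|bell _ _|]ger0_norm//.
    have b1 := bell_shift_le x s0 hs.
    have b2 := normM_bell_le (x + h) s0.
    have b3 := bell_le (x + h) s0.
    have b4 : `|t * cos (t * (x + h) + c) - ((x + h) / s ^+ 2) * sin (t * (x + h) + c)|
        <= `|t| + `|x + h| / s ^+ 2.
      apply: le_trans (ler_normB _ _) _; apply: lerD.
        by rewrite normrM ler_piMr// cos_max.
      rewrite normrM normf_div [`|s ^+ 2|]ger0_norm ?sqr_ge0// ler_piMr ?sin_max//.
      by rewrite divr_ge0// sqr_ge0.
    apply: le_trans (ler_wpM2r (bell_ge0 _ _) b4) _.
    apply: (@le_trans _ _ ((`|t| + 2 / s) * bell (2 * s) (x + h))).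
      rewrite mulrDl [leRHS]mulrDl lerD ?ler_wpM2l//.
      rewrite mulrAC ler_pdivrMr ?exprn_gt0//; apply: le_trans b2 _.
      by rewrite [leRHS](_ : _ = 2 * s * bell (2 * s) (x + h))//; field.
    apply: (@le_trans _ _ ((1 + `|t| + 2 / s) * bell (2 * s) (x + h))).
      by rewrite ler_wpM2r// -addrA lerDr.
    rewrite /K mulrAC [leRHS]mulrC ler_wpM2l//.
    exact: le_trans ler01 s1.
have gE : (fun h => \int[mu]_x g (x + h)) = cst (\int[mu]_x g x).
  by apply/funext => h; rewrite Rintegral_shift.
rewrite gE in dg.
have : \int[mu]_x df 0 x = 0.
  have [_ <-] := dg; exact: derive_cst.
have i1 : mu.-integrable setT (EFin \o (fun x => t * (cos (t * x + c) * bell s x))).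
  apply: (le_integrable measurableT _ _ (integrable_bell `|t| 0 s0)).
    have h := measurable_funM (@measurable_cst _ _ _ _ [set: R] t) (measurable_cos_bell t c sn0).
    by move/measurable_EFinP : h.
  by move=> x _; rewrite lee_fin addr0 !normrM normr_id ler_wpM2l// ler_piMl// cos_max.
have i2 : mu.-integrable setT (EFin \o (fun x => (s ^+ 2)^-1 * (- (x * sin (t * x + c)) * bell s x))).
  have s20 : 0 < 2 * s by rewrite mulr_gt0.
  apply: (le_integrable measurableT _ _ (integrable_bell ((s ^+ 2)^-1 * (2 * s)) 0 s20)).
    have h := measurable_funM (@measurable_cst _ _ _ _ [set: R] ((s ^+ 2)^-1)) (measurable_sin_bell t c sn0).
    by move/measurable_EFinP : h.
  move=> x _; rewrite lee_fin addr0 [leRHS]ger0_norm; last first.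
    by rewrite mulr_ge0// mulr_ge0 ?invr_ge0 ?sqr_ge0 ?mulr_ge0// ltW.
  rewrite normrM [`|(s ^+ 2)^-1|]ger0_norm ?invr_ge0 ?sqr_ge0// -mulrA.
  by rewrite ler_wpM2l ?invr_ge0 ?sqr_ge0//; exact: sin_bell_le.
have -> : \int[mu]_x df 0 x = \int[mu]_x (t * (cos (t * x + c) * bell s x) +
    (s ^+ 2)^-1 * (- (x * sin (t * x + c)) * bell s x)).
  apply: eq_Rintegral => x _; rewrite /df !addr0.
  by rewrite mulrBl mulrA mulNr mulrN; congr (_ - _); ring.
rewrite RintegralD//.
have sn2 : s ^+ 2 != 0 by rewrite expf_neq0.
have ii2 : mu.-integrable setT (EFin \o (fun x => - (x * sin (t * x + c)) * bell s x)).
  have := @integrableZl _ _ _ mu setT measurableT (s ^+ 2) _ i2.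
  apply: eq_integrable => // x _.
  by rewrite /= -EFinM mulVKf.
have ii1 : mu.-integrable setT (EFin \o (fun x => cos (t * x + c) * bell s x)).
  apply: (le_integrable measurableT _ _ (integrable_bell 1 0 s0)).
    by have /measurable_EFinP := measurable_cos_bell t c sn0.
  by move=> x _; rewrite lee_fin addr0 mul1r !normrM ler_piMl// cos_max.
rewrite !RintegralZl// => /eqP; rewrite addrC addr_eq0 => /eqP h.
by rewrite mulNr -mulrA -mulrN -h mulVKf.
Qed.

(** As a function of [t] the integral satisfies [C' = - s ^ 2 t C]. *)
Lemma cos_bell_integral s t c : 0 < s ->
  \int[mu]_x (cos (t * x + c) * bell s x) =
  expR (- (t ^+ 2 * s ^+ 2 / 2)) * cos c * \int[mu]_x bell s x.
Proof.
move=> s0; have sn0 : s != 0 by rewrite gt_eqF.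
pose C t := \int[mu]_x (cos (t * x + c) * bell s x).
have dC a : is_derive a (1 : R) C (- (s ^+ 2 * a) * C a).
  apply: is_derive_translate; rewrite -sin_bell_by_parts//.
  have -> : \int[mu]_x (- (x * sin (a * x + c)) * bell s x) =
      \int[mu]_x (- (x * sin ((a + 0) * x + c)) * bell s x).
    by rewrite addr0.
  pose df (h x : R) := - (x * sin ((a + h) * x + c)) * bell s x.
  apply: (@is_derive_bell_integral (fun h x => cos ((a + h) * x + c) * bell s x) df s (1 + 2 * s)) => //.
  - by rewrite addr_ge0// mulr_ge0// ltW.
  - move=> h; apply: measurable_funM; last exact: measurable_bell.
    exact: measurable_cos_affine.
  - move=> h x _; apply: le_trans (cos_bell_le _ _ _ _) _.
    apply: le_trans (bell_le x s0) _; apply: le_trans (bell_le4 x s0) _.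
    by rewrite ler_peMl// lerDl mulr_ge0// ltW.
  - move=> h x _.
    have d0 := is_derive_addl a h.
    have := @is_derive1_comp R (fun b => cos (b * x + c)) (fun h => a + h) h _ _
      (is_derive_cosM x c (a + h)) d0.
    rewrite mulr1 => d1.
    have d2 : is_derive h (1 : R) (fun=> bell s x : R) 0 by exact: is_derive_cst.
    apply: (is_derive_eq' (is_deriveM d1 d2)).
    by rewrite scaler0 add0r /df /GRing.scale/= mulrC.
  - move=> h x _; apply: le_trans (sin_bell_le _ _ _ s0) _.
    apply: ler_pM; rewrite ?mulr_ge0 ?(ltW s0)//; first by rewrite lerDr.
    exact: bell_le4.
have d2 a : is_derive a (1 : R) (fun a : R => expR (a ^+ 2 * s ^+ 2 / 2)) (a * s ^+ 2 * expR (a ^+ 2 * s ^+ 2 / 2)).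
  have d1 : is_derive a (1 : R) (fun a : R => a ^+ 2 * s ^+ 2 / 2) (a * s ^+ 2).
    have := is_derive_sqrM (s ^+ 2 / 2) 0 a.
    under eq_fun do rewrite add0r mulrC mulrA.
    by move=> d; apply: (is_derive_eq' d); field.
  have := @is_derive1_comp R (@expR R) _ a _ _ (is_derive_expR _) d1.
  by move=> h'; apply: (is_derive_eq' h'); rewrite mulrC.
have d3 a : is_derive a (1 : R) (fun a => C a * expR (a ^+ 2 * s ^+ 2 / 2)) 0.
  apply: (is_derive_eq' (is_deriveM (dC a) (d2 a))).
  by rewrite /GRing.scale/=; ring.
have CE : C t * expR (t ^+ 2 * s ^+ 2 / 2) = C 0.
  have := is_derive_0_is_cst t 0 d3.
  by rewrite /= expr0n /= !mul0r expR0 mulr1.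
transitivity (expR (- (t ^+ 2 * s ^+ 2 / 2)) * C 0).
  by rewrite -[in RHS]CE mulrCA -expRD addrC subrr expR0 mulr1.
rewrite -[RHS]mulrA; congr (_ * _); rewrite /C -RintegralZl//.
  by apply: eq_Rintegral => x _; rewrite mul0r add0r.
have := integrable_bell 1 0 s0; apply: eq_integrable => // x _.
by rewrite /= addr0 mul1r.
Qed.

Lemma bell_mass s : 0 < s -> normal_peak s * \int[mu]_x bell s x = 1.
Proof.
move=> s0; have sn0 : s != 0 by rewrite gt_eqF.
have iq : mu.-integrable setT (EFin \o bell s).
  have := integrable_bell 1 0 s0; apply: eq_integrable => // x _.
  by rewrite /= addr0 mul1r.
rewrite -RintegralZl//; transitivity (fine (\int[mu]_x (normal_pdf 0 s x)%:E)).
  by congr fine; apply: eq_integral => x _; rewrite normal_pdf_bell.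
by rewrite integral_normal_pdf.
Qed.

(** The bounded function is shifted by a constant so that the density formula for nonnegative
integrands applies. *)
Lemma normal_prob_cos s t c : 0 < s ->
  (\int[normal_prob 0 s]_x (1 + cos (t * x + c))%:E)%E =
  (1 + expR (- (t ^+ 2 * s ^+ 2 / 2)) * cos c)%:E.
Proof.
move=> s0; have sn0 : s != 0 by rewrite gt_eqF.
have mc : measurable_fun setT (fun x : R => 1 + cos (t * x + c)).
  by apply: measurable_funD => //; exact: measurable_cos_affine.
have c1 x : 0 <= 1 + cos (t * x + c) by rewrite -lerBlDl sub0r cos_geN1.
have iq : mu.-integrable setT (EFin \o bell s).
  have := integrable_bell 1 0 s0; apply: eq_integrable => // x _.
  by rewrite /= addr0 mul1r.
have ic : mu.-integrable setT (EFin \o (fun x => cos (t * x + c) * bell s x)).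
  apply: (le_integrable measurableT _ _ iq).
    by have /measurable_EFinP := measurable_cos_bell t c sn0.
  by move=> x _; rewrite lee_fin normrM ler_piMl// cos_max.
have iS : mu.-integrable setT (EFin \o (fun x => bell s x + cos (t * x + c) * bell s x)).
  by have := integrableD measurableT iq ic; apply: eq_integrable.
have dens := @ge0_integral_density _ _ R mu (normal_prob 0 s) (normal_pdf 0 s)
  (measurable_normal_pdf 0 s) (normal_pdf_ge0 0 s) (fun A mA => erefl)
  (fun x => (1 + cos (t * x + c))%:E).
rewrite dens; last 2 first.
- by have /measurable_EFinP := mc.
- by move=> x; rewrite lee_fin.
rewrite (eq_integral (fun x : measurableTypeR R =>
    (normal_peak s * (bell s x + cos (t * x + c) * bell s x))%:E)); last first.
  by move=> x _; rewrite -EFinM normal_pdf_bell//; congr EFin; ring.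
have fin : (\int[mu]_x (normal_peak s * (bell s x + cos (t * x + c) * bell s x))%:E)%E \is a fin_num.
  apply: integrable_fin_num => //.
  by have := @integrableZl _ _ _ mu setT measurableT (normal_peak s) _ iS; apply: eq_integrable.
rewrite -(fineK fin) -[fine _]/(\int[mu]_x (normal_peak s * (bell s x + cos (t * x + c) * bell s x))).
congr EFin; rewrite RintegralZl// RintegralD// cos_bell_integral// mulrDr.
by rewrite bell_mass// mulrCA bell_mass// mulr1.
Qed.

Lemma normal_prob_charfun s t : 0 < s ->
  \int[normal_prob 0 s]_x cos (t * x) = expR (- (t ^+ 2 * s ^+ 2 / 2)) /\
  \int[normal_prob 0 s]_x sin (t * x) = 0.
Proof.
move=> s0.
have key c : \int[normal_prob 0 s]_x cos (t * x + c) =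
    expR (- (t ^+ 2 * s ^+ 2 / 2)) * cos c.
  have Pfin : (normal_prob 0 s [set: R] < +oo)%E by rewrite probability_setT ltry.
  have i1 : (normal_prob 0 s).-integrable setT (EFin \o (fun x : R => cos (t * x + c))).
    apply: (bounded_integrable Pfin (K := 1)); first exact: measurable_cos_affine.
    by move=> x; exact: cos_max.
  have i0 : (normal_prob 0 s).-integrable setT (EFin \o (fun=> 1 : R)).
    by apply: (bounded_integrable Pfin (K := 1)) => // x; rewrite normr1.
  have := congr1 fine (normal_prob_cos t c s0).
  rewrite -[fine _]/(\int[normal_prob 0 s]_x (1 + cos (t * x + c))) /=.
  rewrite RintegralD// Rintegral_cst// mul1r.
  by rewrite -[X in fine X]/(normal_prob 0 s [set: R]) probability_setT /= => /addrI.
split.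
  have := key 0; rewrite cos0 mulr1 => <-.
  apply: eq_Rintegral => x _; rewrite addr0; exact: erefl.
have h := key (- (pi / 2)); rewrite cosN cos_pihalf mulr0 in h.
rewrite -[RHS]h.
apply: eq_Rintegral => x _; apply/esym; exact: cosBpihalf.
Qed.

End gaussian.

Section gaussian_law.
Context {dO : measure_display} {Omega : measurableType dO} {R : realType}.
Variable P : probability Omega R.

Let scal (x : R) : 'M[R]_(1, 1) := x%:M.

Let measurable_scal : measurable_fun setT scal.
Proof.
apply: measurable_fun_mxP => i j; rewrite !ord1.
have -> : (fun x => scal x 0 0) = id by apply/funext => x; rewrite /scal mxE mulr1n.
exact: measurable_id.
Qed.

Let mxdot_scal A x : mxdot A (scal x) = A 0 0 * x.
Proof. by rewrite mxdotE !big_ord1 mxE mulr1n. Qed.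

(** The real line is read as the space of 1 x 1 matrices. *)
Lemma normal_law_charfun (Z : Omega -> R) s : measurable_fun setT Z -> 0 < s ->
  (forall t, has_charfun P (fun w => t * Z w) (expR (- (t ^+ 2 * s ^+ 2 / 2)))) ->
  forall B : set R, measurable B -> P [set w | B (Z w)] = normal_prob 0 s B.
Proof.
move=> mZ s0 hZ B mB.
have mB' : measurable [set v : 'M[R]_(1, 1) | B (v 0 0)].
  by rewrite -[X in measurable X]setTI; exact: (measurable_fun_coord 0 0).
have := @eq_law_fourier R 1 1 _ _ Omega _ P (normal_prob 0 s) (scal \o Z) scal
  (measurableT_comp measurable_scal mZ) measurable_scal _ _ _ mB'.
have scalE x : (scal x) 0 0 = x by rewrite mxE mulr1n.
have -> : [set w | [set v : 'M[R]_(1, 1) | B (v 0 0)] ((scal \o Z) w)] = [set w | B (Z w)].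
  by apply/seteqP; split => w /=; rewrite scalE.
have -> : [set w | [set v : 'M[R]_(1, 1) | B (v 0 0)] (scal w)] = B.
  by apply/seteqP; split => w /=; rewrite scalE.
apply => A.
- have [hc _] := hZ (A 0 0); have [nc _] := normal_prob_charfun (A 0 0) s0.
  transitivity (\int[P]_w cos (A 0 0 * Z w)).
    by apply: eq_Rintegral => w _; rewrite -mxdot_scal.
  rewrite hc -[LHS]nc; apply: eq_Rintegral => x _; by rewrite mxdot_scal.
- have [_ hs] := hZ (A 0 0); have [_ ns] := normal_prob_charfun (A 0 0) s0.
  transitivity (\int[P]_w sin (A 0 0 * Z w)).
    by apply: eq_Rintegral => w _; rewrite -mxdot_scal.
  rewrite hs -[LHS]ns; apply: eq_Rintegral => x _; by rewrite mxdot_scal.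
Qed.

End gaussian_law.

(** * Radial integrals in polar coordinates *)

Lemma spectrum_lower_bound (R : realType) n (A : 'M[R]_n) : positive_spectrum A ->
  exists2 c : R, 0 < c & forall z, spectrum A z -> c < complex.Re z.
Proof.
move=> [_ h].
have [s sE] := closed_field_poly_normal (char_poly (map_mx (real_complex R) A)).
have sA z : spectrum A z -> z \in s.
  rewrite /spectrum /= eigenvalue_root_char sE rootZ; last first.
    by rewrite lead_coef_eq0 -size_poly_eq0 size_char_poly.
  by rewrite root_prod_XsubC.
have : exists2 c : R, 0 < c & forall z, z \in s -> 0 < complex.Re z -> c < complex.Re z.
  elim: s {sE sA} => [|z s [c c0 hc]]; first by exists 1.
  have [z0|z0] := ltP 0 (complex.Re z); last first.
    exists c => // w; rewrite inE => /orP[/eqP-> |]; last exact: hc.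
    by rewrite ltNge z0.
  exists (Num.min c (complex.Re z) / 2).
    by rewrite divr_gt0// lt_min c0.
  move=> w; rewrite inE => /orP[/eqP-> _|ws w0].
    apply: (@lt_le_trans _ _ (Num.min c (complex.Re z))); last by rewrite ge_min lexx orbT.
    by rewrite ltr_pdivrMr// ltr_pMr ?lt_min ?c0// ltr1n.
  apply: (@le_lt_trans _ _ c); last exact: hc.
  apply: (@le_trans _ _ (Num.min c (complex.Re z))); last by rewrite ge_min lexx.
  by rewrite ler_pdivrMr// ler_pMr ?lt_min ?c0// ler1n.
by move=> [c c0 hc]; exists c => // z sz; apply: hc; [exact: sA|exact: h].
Qed.

Lemma dyadic_scale (R : realType) (B t : R) : 2 <= B -> 0 < t <= B ->
  exists k, 2^-1 <= t * 2 ^+ k <= B.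
Proof.
move=> B2 /andP[t0 tB].
have [n hn] : exists n, 2^-1 <= t * 2 ^+ n.
  exists (Num.bound (1 / t)).
  have : (Num.bound (1 / t))%:R <= 2 ^+ (Num.bound (1 / t)) :> R.
    by rewrite -natrX ler_nat ltnW// ltn_expl.
  move=> h; have h1 := lt_le_trans (archi_boundP (divr_ge0 ler01 (ltW t0))) h.
  rewrite ltr_pdivrMr// mulrC in h1; apply: le_trans (ltW h1).
  by rewrite invf_le1// ler1n.
have ex : exists n, 2^-1 <= t * 2 ^+ n by exists n.
exists (ex_minn ex); case: ex_minnP => -[|k] hk kmin; rewrite hk /=.
  by rewrite expr0 mulr1.
have : t * 2 ^+ k < 2^-1.
  by rewrite ltNge; apply/negP => /kmin; rewrite ltnn.
move=> h; apply: le_trans B2; rewrite exprS mulrCA -ler_pdivlMl//.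
by rewrite mulVf// (le_trans (ltW h))// invf_le1// ler1n.
Qed.

Lemma measurable_fun_punctured (R : realType) n (f : 'cV[R]_n -> R) :
  (forall x, x != 0 -> {for x, continuous f}) -> measurable_fun setT f.
Proof.
move=> cf; apply: (measurability _ (measurable_realfun.RGenOpens.measurableE R)).
move=> _ [_ [a [b ->]] <-]; rewrite setTI.
have m0 : measurable [set (0 : 'cV[R]_n)].
  rewrite (_ : [set 0] = \bigcap_(i in [set: 'I_n]) (fun v : 'cV[R]_n => v i 0) @^-1` [set 0]).
    apply: fin_bigcap_measurable => // i _; rewrite -[X in measurable X]setTI.
    by apply: measurable_fun_coord.
  apply/seteqP; split=> v /=; first by move=> -> i _ /=; rewrite mxE.
  by move=> h; apply/colP => i; rewrite mxE; exact: h.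
pose U := f @^-1` `]a, b[%classic.
have oU : open (U `\ 0).
  rewrite openE => x [/= Ux x0]; rewrite /interior.
  have xn0 : x != 0 by apply/eqP.
  apply: filterI.
    apply: (cf x xn0); apply: open_nbhs_nbhs; split => //; exact: interval_open.
  apply: open_nbhs_nbhs; split => //; apply: closed_openC.
  exact: (accessible_closed_set1 (hausdorff_accessible (@norm_hausdorff _ _))).
rewrite -/U (_ : U = (U `\ 0) `|` (U `&` [set 0])); last first.
  by rewrite setUC setUIDK.
apply: measurableU; first exact: sub_sigma_algebra.
have [U0|U0] := pselect (U 0).
  by rewrite (_ : U `&` _ = [set 0])//; apply/seteqP; split => x /= => [[]|->].
by rewrite (_ : U `&` _ = set0)//; apply/seteqP; split => // x /= [+ x0]; rewrite x0.
Qed.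

Lemma integral_geometric d (T : measurableType d) (R : realType)
    (mu : {measure set T -> \bar R}) (f : nat -> T -> \bar R) (I : \bar R) (r : R) :
  (forall n, measurable_fun setT (f n)) -> (forall n x, (0 <= f n x)%E) ->
  0 <= r < 1 -> (0 <= I < +oo)%E ->
  (forall n, \int[mu]_x f n x = (r ^+ n)%:E * I)%E ->
  (\int[mu]_x (\sum_(0 <= n <oo) f n x) < +oo)%E.
Proof.
move=> mf f0 /andP[r0 r1] /andP[I0 Ioo] hf.
rewrite integral_nneseries//.
have fin : I \is a fin_num by rewrite ge0_fin_numE.
have r1' : 0 < 1 - r by rewrite subr_gt0.
apply: (@le_lt_trans _ _ ((fine I / (1 - r))%:E)); last by rewrite ltry.
apply: lime_le.
  by apply: is_cvg_nneseries => n _ _; exact: integral_ge0.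
apply: nearW => n.
have -> : (\sum_(0 <= k < n) \int[mu]_x f k x = (fine I * \sum_(0 <= k < n) r ^+ k)%:E)%E.
  elim: n => [|n IH]; first by rewrite !big_geq// mulr0.
  by rewrite !big_nat_recr//= IH hf -{2}(fineK fin) -EFinM -EFinD mulrDr [r ^+ n * _]mulrC.
have hg : (1 - r) * \sum_(0 <= k < n) r ^+ k = 1 - r ^+ n.
  elim: n => [|n IH]; first by rewrite big_geq// mulr0 expr0 subrr.
  by rewrite big_nat_recr//= mulrDr IH exprS; ring.
rewrite lee_fin ler_wpM2l ?fine_ge0// -[leRHS]mul1r ler_pdivlMr// mulrC hg.
by rewrite gerBl exprn_ge0.
Qed.

Lemma powR_between (R : realType) (a b t p : R) : 0 < a -> a <= t <= b ->
  t `^ p <= a `^ p + b `^ p.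
Proof.
move=> a0 /andP[at0 tb]; have t0 : 0 < t by exact: lt_le_trans at0.
have b0 : 0 < b by exact: lt_le_trans tb.
have [p0|p0] := leP 0 p.
  apply: (@le_trans _ _ (b `^ p)); last by rewrite lerDr powR_ge0.
  by apply: ge0_ler_powR; rewrite ?nnegrE ?(ltW t0) ?(ltW b0).
apply: (@le_trans _ _ (a `^ p)); last by rewrite lerDl powR_ge0.
rewrite -[p]opprK powRN [leRHS]powRN lef_pV2 ?posrE ?powR_gt0//.
by rewrite ge0_ler_powR ?nnegrE ?(ltW a0) ?(ltW t0)// oppr_ge0 ltW.
Qed.

Lemma measurable_between d (T : measurableType d) (R : realType) (f : T -> R) a b :
  measurable_fun setT f -> measurable [set v | a <= f v <= b].
Proof.
move=> mf; rewrite (_ : [set v | a <= f v <= b] = setT `&` f @^-1` `[a, b]%classic).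
  by apply: mf => //; exact: measurable_itv.
by rewrite setTI; apply/seteqP; split => v /=; rewrite in_itv.
Qed.

Section radial.
Context {R : realType} {d : nat}.
Variables (E : 'M[R]_d) (tau : 'cV[R]_d -> R) (l : 'cV[R]_d -> 'cV[R]_d).
Hypothesis hE : positive_spectrum E.
Hypothesis hpolar : polar_coordinates E tau l.
Let q := \tr E.

Lemma radial_ge0 x : 0 <= tau x.
Proof.
have [->|x0] := eqVneq x 0; first by rewrite (polar_tau0 hpolar).
by rewrite ltW// (polar_gt0 hpolar).
Qed.

Lemma radial_neq0 x : 0 < tau x -> x != 0.
Proof. by apply: contraTneq => ->; rewrite (polar_tau0 hpolar) ltxx. Qed.

Lemma measurable_radial : measurable_fun setT tau.
Proof. by apply: measurable_fun_punctured => x; exact: (polar_cont_tau hpolar). Qed.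

Lemma radial_bounded K : exists2 r : R, 0 < r & forall x, tau x <= K -> enorm x <= r.
Proof.
have [r hr] := polar_infty hpolar K; exists (`|r| + 1).
  by rewrite ltr_wpDl.
move=> x; apply: contraTT; rewrite -!ltNge => h; apply: hr.
by apply: le_lt_trans h; rewrite (le_trans (ler_norm r))// lerDl.
Qed.

Lemma radial_away a : 0 < a -> exists2 e : R, 0 < e & forall x, a <= tau x -> e <= enorm x.
Proof.
move=> a0; have /cvgrPdist_lt/(_ a a0) := polar_zero hpolar.
move=> /nbhs_ballP[e /= e0 he]; exists e => // x; apply: contraTT; rewrite -!ltNge => xe.
have : ball (0 : 'cV[R]_d) e x.
  split => // i j; rewrite /ball/= mxE sub0r normrN ord1.
  by apply: le_lt_trans xe; exact: entry_le_enorm.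
by move=> /he /=; rewrite sub0r normrN ger0_norm// radial_ge0.
Qed.

(** The directions stay away from the origin, so a vector of large radial part and bounded norm
would be contracted too slowly by the inverse scaling. *)
Lemma radial_le_of_enorm r : exists2 K : R, 0 < K & forall x, enorm x <= r -> tau x <= K.
Proof.
have [c c0 hc] := spectrum_lower_bound hE.
have [C C0 hC] := mpow_growth_le1 hc.
have [e e0 he] := radial_away ltr01.
pose b := C * `|r| / e.
have b0 : 0 <= b by rewrite divr_ge0 ?mulr_ge0 ?(ltW C0) ?(ltW e0).
exists (1 + b `^ c^-1); first by rewrite ltr_pwDl// powR_ge0.
move=> x xr; have [t1|t1] := leP (tau x) 1.
  by apply: le_trans t1 _; rewrite lerDl powR_ge0.
have t0 : 0 < tau x by rewrite (lt_trans ltr01).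
have x0 := radial_neq0 t0.
have lE : l x = mpow (tau x)^-1 E *m x.
  by rewrite -[in LHS](mul1mx (l x)) -(mpowKV E t0) -mulmxA -(polar_dec hpolar x0).
have := he (l x); rewrite (polar_dir hpolar x0) lexx => /(_ isT) le.
have h1 : e <= C * (tau x)^-1 `^ c * `|r|.
  apply: le_trans le _; rewrite lE; apply: le_trans (enorm_mulmx _ _) _.
  apply: ler_pM; rewrite ?norm1_ge0 ?enorm_ge0//.
    by apply: hC; rewrite invr_gt0 t0 invf_le1// ltW.
  by apply: le_trans xr _; exact: ler_norm.
have h2 : tau x `^ c <= b.
  rewrite ler_pdivlMr//; have p0 : 0 < tau x `^ c by rewrite powR_gt0.
  have pV : (tau x)^-1 `^ c * tau x `^ c = 1.
    by rewrite -powRM ?invr_ge0 ?(ltW t0)// mulVf ?gt_eqF// powR1.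
  apply: (@le_trans _ _ (tau x `^ c * (C * (tau x)^-1 `^ c * `|r|))).
    by rewrite ler_wpM2l// ltW.
  have -> : tau x `^ c * (C * (tau x)^-1 `^ c * `|r|) =
      ((tau x)^-1 `^ c * tau x `^ c) * (C * `|r|) by ring.
  by rewrite pV mul1r.
have -> : tau x = (tau x `^ c) `^ c^-1 by rewrite -powRrM divff ?gt_eqF// powRr1// ltW.
apply: (@le_trans _ _ (b `^ c^-1)); last by rewrite lerDr.
by rewrite ge0_ler_powR ?nnegrE ?invr_ge0 ?powR_ge0// ltW.
Qed.

Lemma radial_sub K : exists2 K' : R, 2 <= K' &
  forall h y, tau h <= K -> tau y <= K -> tau (h - y) <= K'.
Proof.
have [r r0 hr] := radial_bounded K.
have [K' K0 hK'] := radial_le_of_enorm (r + r).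
exists (K' + 2); first by rewrite lerDr ltW.
move=> h y hh hy; apply: le_trans (_ : K' <= _); last by rewrite lerDl.
apply: hK'; apply: le_trans (enormD _ _) _; rewrite enormN.
by apply: lerD; exact: hr.
Qed.

Lemma ge0_integral_radial_scale (f : 'cV[R]_d -> \bar R) r : 0 < r ->
  measurable_fun setT f -> (forall z, (0 <= f z)%E) ->
  ((r `^ q)%:E * \int[lebesgue_cV d]_v f (mpow r E *m v) = \int[lebesgue_cV d]_v f v)%E.
Proof.
move=> r0 mf f0; have := ge0_integral_mulmx (mpow_unitmx E r) mf f0.
by rewrite det_mpow// ger0_norm ?powR_ge0.
Qed.

Lemma radial_shell_finite K : (lebesgue_cV d [set v | (tau v <= K)%R] < +oo)%E.
Proof.
have [r r0 hr] := radial_bounded K.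
apply: le_lt_trans (lebesgue_cV_cube d r); apply: le_measure.
- rewrite inE; have := measurable_between 0 K measurable_radial.
  by rewrite (_ : [set v | 0 <= tau v <= K] = [set v | tau v <= K])//; apply/seteqP; split => v /=; rewrite radial_ge0.
- rewrite inE; have mr : measurable [set x : R | `|x| <= r].
    rewrite (_ : [set x : R | `|x| <= r] = `[- r, r]%classic); first exact: measurable_itv.
    by apply/seteqP; split => x /=; rewrite in_itv/= ler_norml.
  exact: (measurable_box (B := fun=> [set x : R | `|x| <= r])).
- by move=> v /= /hr vr i; apply: le_trans vr; exact: entry_le_enorm.
Qed.

(** Scaling by [c ^ k] carries one shell onto the others, and the integrals over the images form a
geometric series of ratio [c `^ (p + q)]. *)
Lemma radial_power_integral c p B : 0 < c -> 2 <= B -> c `^ (p + q) < 1 ->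
  (\int[lebesgue_cV d]_(v in [set v | exists k, (2^-1 <= tau v / c ^+ k <= B)%R])
    (tau v `^ p)%:E < +oo)%E.
Proof.
move=> c0 B2 cpq; have B0 : 0 < B by apply: lt_le_trans B2.
pose S := [set v | 2^-1 <= tau v <= B].
have mS : measurable S by exact: measurable_between measurable_radial.
pose f v := tau v `^ p.
have mf : measurable_fun setT f.
  exact: (measurableT_comp (measurable_powR p) measurable_radial).
pose g v : \bar R := (f v * \1_S v)%:E.
have mg : measurable_fun setT g.
  by apply/measurable_EFinP; apply: measurable_funM => //; exact: measurable_indic.
have g0 v : (0 <= g v)%E by rewrite lee_fin mulr_ge0 ?powR_ge0.
pose I := (\int[lebesgue_cV d]_v g v)%E.
have I0 : (0 <= I)%E by apply: integral_ge0.
have Ioo : (I < +oo)%E.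
  pose M := 2^-1 `^ p + B `^ p.
  have M0 : 0 <= M by rewrite addr_ge0 ?powR_ge0.
  apply: (@le_lt_trans _ _ (\int[lebesgue_cV d]_v (M%:E * (\1_S v)%:E))%E).
    apply: ge0_le_integral => //.
    - apply: emeasurable_funM => //; apply/measurable_EFinP; exact: measurable_indic.
    - move=> v _; rewrite -EFinM lee_fin /f indicE.
      have [vS|vS] := boolP (v \in S); last by rewrite !mulr0.
      rewrite !mulr1; apply: powR_between; first by rewrite invr_gt0.
      by move: vS; rewrite inE.
  rewrite ge0_integralZl//; last exact/measurable_EFinP/measurable_indic.
  rewrite integral_indic// setIT; apply: lte_mul_pinfty => //.
  apply: le_lt_trans (radial_shell_finite B); apply: le_measure.
  - by rewrite inE.
  - rewrite inE; have := measurable_between 0 B measurable_radial.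
    by rewrite (_ : [set v | 0 <= tau v <= B] = [set v | tau v <= B])//; apply/seteqP; split => v /=; rewrite radial_ge0.
  - by move=> v /= /andP[].
pose gk k v : \bar R := (((c ^+ k) `^ p)%:E * g (mpow (c ^+ k)^-1 E *m v))%E.
have ck k : 0 < c ^+ k by rewrite exprn_gt0.
have mgk k : measurable_fun setT (gk k).
  apply: emeasurable_funM => //; apply: (measurableT_comp mg).
  by apply: measurable_fun_mulmx; exact: measurable_id.
have gk0 k v : (0 <= gk k v)%E by rewrite mule_ge0// lee_fin powR_ge0.
have intgk k : (\int[lebesgue_cV d]_v gk k v = ((c `^ (p + q)) ^+ k)%:E * I)%E.
  have -> : (\int[lebesgue_cV d]_v gk k v =
      ((c ^+ k) `^ p)%:E * \int[lebesgue_cV d]_v g (mpow (c ^+ k)^-1 E *m v))%E.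
    apply: ge0_integralZl => //; last by rewrite lee_fin powR_ge0.
    apply: (measurableT_comp mg); apply: measurable_fun_mulmx; exact: measurable_id.
  have ckV : 0 < (c ^+ k)^-1 by rewrite invr_gt0.
  rewrite /I -(ge0_integral_radial_scale ckV mg g0) !muleA -!EFinM.
  congr (_%:E * _)%E.
  have -> : (c `^ (p + q)) ^+ k = (c ^+ k) `^ (p + q).
    by rewrite -!powR_mulrn ?powR_ge0 ?(ltW c0)// -!powRrM mulrC.
  rewrite powRD; last by rewrite (gt_eqF (ck k)) implybT.
  rewrite -mulrA -powRM ?invr_ge0 ?(ltW (ck k))// divff ?gt_eqF// powR1 mulr1.
  by [].
have := @integral_geometric _ _ R (lebesgue_cV d) gk I (c `^ (p + q)) mgk gk0 _ _ intgk.
rewrite powR_ge0 cpq I0 Ioo => /(_ isT isT); apply: le_lt_trans.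
have mU : measurable [set v | exists k, 2^-1 <= tau v / c ^+ k <= B].
  rewrite (_ : [set v | exists k, 2^-1 <= tau v / c ^+ k <= B] =
    \bigcup_k [set v | (2^-1 <= tau v / c ^+ k <= B)%R]).
    apply: bigcupT_measurable => k; apply: measurable_between.
    by apply: measurable_funM => //; exact: measurable_radial.
  by apply/seteqP; split => v /= [k]; [exists k|move=> _; exists k].
rewrite [leLHS]integral_mkcond.
apply: ge0_le_integral => //.
- by move=> v _; rewrite patchE; case: ifP => // _; rewrite lee_fin powR_ge0.
- have mfU : measurable_fun [set v | exists k, 2^-1 <= tau v / c ^+ k <= B] (EFin \o f).
    by apply: measurable_funTS; have /measurable_EFinP := mf.
  by move: mfU => /(measurable_restrictT _ mU).
- by apply: ge0_emeasurable_sum.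
- move=> v _; rewrite patchE; case: ifPn => [|_]; last exact: nneseries_ge0.
  rewrite inE => -[k /= hk].
  apply: (@le_trans _ _ (\sum_(0 <= i < k.+1) gk i v)%E); last first.
    by apply: nneseries_lim_ge.
  rewrite big_nat_recr//=; apply: (@le_trans _ _ (gk k v)); last first.
    by rewrite leeDr// sume_ge0.
  rewrite /gk /g /f (polar_homo hpolar) ?invr_gt0// -EFinM lee_fin indicE.
  have -> : (mpow (c ^+ k)^-1 E *m v) \in S.
    by rewrite inE /S /= (polar_homo hpolar) ?invr_gt0// mulrC.
  rewrite mulr1 -powRM ?mulr_ge0 ?invr_ge0 ?radial_ge0 ?(ltW (ck k))//.
  by rewrite mulrA divff ?mul1r// gt_eqF.
Qed.

End radial.

(** * The moving-average kernel *)

Lemma near_sub (R : realType) n (x : 'cV[R]_n) (S : set 'cV[R]_n) :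
  (\forall z \near (0 : 'cV[R]_n), S z) -> \forall y \near x, S (y - x).
Proof.
case/nbhs_ballP => e /= e0 hb; apply/nbhs_ballP; exists e => // y xy /=.
apply: hb; case: xy => _ xy; split => // i j; have := xy i j.
by rewrite /ball/= !mxE sub0r normrN distrC.
Qed.

Section kernel.
Context {R : realType} {d m : nat}.
Hypothesis d0 : (0 < d)%N.
Variables (alpha : R) (E : 'M[R]_d) (D : 'M[R]_m).
Variables (tau : 'cV[R]_d -> R) (l : 'cV[R]_d -> 'cV[R]_d).
Variables (phi : 'cV[R]_d -> R) (beta H : R).
Hypotheses (alpha0 : 0 < alpha) (hE : positive_spectrum E) (hD : positive_spectrum D).
Hypothesis hpolar : polar_coordinates E tau l.
Hypotheses (hbeta : 0 < beta) (hhomo : homogeneous E phi).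
Hypothesis hadm : admissible tau beta phi.
Hypotheses (hH : is_max_Re D H) (hHbeta : H < beta).
Let q := \tr E.
Let A := D - (q / alpha)%:M.
Let Q := moving_average_kernel alpha E D phi.
Let tau_ge0 := radial_ge0 hpolar.
Let mtau := measurable_radial hpolar.

Let phi_gt0 x : x != 0 -> 0 < phi x.
Proof. by case: hadm => _ h _; exact: h. Qed.

(** Admissibility is a local Hoelder condition with respect to [tau], and [tau] is continuous
at 0. *)
Lemma continuous_admissible x : x != 0 -> {for x, continuous phi}.
Proof.
move=> x0; have ex : 0 < enorm x.
  have t0 := polar_gt0 hpolar x0.
  by have [e e0 he] := radial_away hpolar t0; apply: lt_le_trans (he _ (lexx _)).
have [_ _ /(_ (enorm x / 2) (enorm x * 2))] := hadm.
case; [by rewrite divr_gt0|lra|] => C C0 hC.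
suff : phi y @[y --> x] --> phi x by [].
apply/(@cvgrPdist_lt _ _ _ _ (nbhs_filter x) phi (phi x)) => e e0.
pose b := (e / (2 * C)) `^ beta^-1.
have b0 : 0 < b by rewrite powR_gt0// divr_gt0// mulr_gt0.
have : \forall z \near (0 : 'cV[R]_d), tau z < Num.min 1 b.
  have /cvgrPdist_lt/(_ (Num.min 1 b)) := polar_zero hpolar.
  rewrite lt_min ltr01 b0 => /(_ isT); apply: filterS => z.
  by rewrite sub0r normrN ger0_norm.
move=> /(near_sub x); apply: filterS => t /=.
rewrite lt_min; set z := t - x => /andP[z1 zb].
have -> : t = z + x by rewrite subrK.
rewrite distrC; apply: le_lt_trans (hC z x _ (ltW z1)) _.
  by apply/andP; split; lra.
have : tau z `^ beta <= e / (2 * C).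
  have -> : e / (2 * C) = b `^ beta.
    by rewrite -powRrM mulVf ?gt_eqF// powRr1// divr_ge0 ?(ltW e0)// mulr_ge0 ?(ltW C0).
  by apply: ge0_ler_powR; rewrite ?nnegrE ?tau_ge0 ?(ltW zb) ?(ltW hbeta) ?(ltW b0).
rewrite ler_pdivlMr ?mulr_gt0// => h.
by have : 0 <= tau z `^ beta := powR_ge0 _ _; nra.
Qed.

Let bounded_directions (g : 'cV[R]_d -> R) :
  (forall x, x != 0 -> {for x, continuous g}) ->
  exists2 M : R, 0 < M & forall u, tau u = 1 -> `|g u| <= M.
Proof.
move=> cg.
have cw : {within [set x | tau x = 1], continuous g}.
  apply: continuous_in_subspaceT => x; rewrite inE /= => x1; apply: cg.
  by apply: (radial_neq0 hpolar); rewrite x1.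
have /pinfty_ex_gt0[M M0 hM] := compact_bounded (continuous_compact cw (polar_compact hpolar)).
by exists M => // u u1; apply: (hM (g u)); exists u.
Qed.

(** Both functions are of degree one for the scaling, so that it suffices to compare them on the
compact set of directions. *)
Lemma admissible_radial : exists c1 c2 : R, [/\ 0 < c1, 0 < c2 &
  forall x, x != 0 -> c1 * tau x <= phi x <= c2 * tau x].
Proof.
have [M M0 hM] := bounded_directions continuous_admissible.
have cV x : x != 0 -> {for x, continuous (fun x => (phi x)^-1)}.
  move=> x0; suff : (phi y)^-1 @[y --> x] --> (phi x)^-1 by [].
  have pn : phi x != 0 by rewrite gt_eqF// phi_gt0.
  exact: (cvgV pn (continuous_admissible x0)).
have [N N0 hN] := bounded_directions cV.
exists N^-1, M; split => //; first by rewrite invr_gt0.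
move=> x x0; have t0 := polar_gt0 hpolar x0.
have l1 := polar_dir hpolar x0.
have l0 : l x != 0 by apply: (radial_neq0 hpolar); rewrite l1.
have -> : phi x = tau x * phi (l x).
  by rewrite [in LHS](polar_dec hpolar x0) hhomo.
rewrite ![_ * tau x]mulrC !ler_pM2l//.
have p0 := phi_gt0 l0.
have := hM _ l1; rewrite gtr0_norm// => ->.
have := hN _ l1; rewrite gtr0_norm ?invr_gt0// => h.
by rewrite andbT -[phi _]invrK lef_pV2 ?posrE ?invr_gt0.
Qed.

Let mphi : measurable_fun setT phi.
Proof. by apply: measurable_fun_punctured; exact: continuous_admissible. Qed.

Let measurable_mpow_phi : measurable_fun setT (fun z => mpow (phi z) A).
Proof.
apply: measurable_fun_mxP => i j.
have -> : (fun z => mpow (phi z) A i j) = (fun s => mpow (expR s) A i j) \o (fun z => ln (phi z)).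
  by apply/funext => z; rewrite /= /mpow expRK.
apply: measurableT_comp.
  apply: continuous_measurable_fun => s.
  apply: (@continuous_comp _ _ _ expR (fun r => mpow r A i j)); first exact: continuous_expR.
  by apply: continuous_mpow_entry; exact: expR_gt0.
exact: (measurableT_comp (@measurable_ln R)).
Qed.

Let measurable_sub (x : 'cV[R]_d) : measurable_fun setT (fun y : 'cV[R]_d => x - y).
Proof. by apply: measurable_fun_mxB; [exact: measurable_cst|exact: measurable_id]. Qed.

Let measurable_opp : measurable_fun setT (fun y : 'cV[R]_d => - y).
Proof. by have := measurable_sub 0; under eq_fun do rewrite sub0r. Qed.

Lemma measurable_kernel x : measurable_fun setT (Q x).
Proof.
apply: measurable_fun_mxB.
  exact: (measurableT_comp measurable_mpow_phi (measurable_sub x)).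
exact: (measurableT_comp measurable_mpow_phi measurable_opp).
Qed.

Lemma norm1_mpow_shift r : 0 < r ->
  norm1 (mpow r A) `^ alpha = r `^ (- q) * norm1 (mpow r D) `^ alpha.
Proof.
move=> r0; have -> : A = D + (- (q / alpha))%:M by rewrite /A [(- _)%:M]raddfN.
rewrite mpow_shift// norm1Z ger0_norm ?powR_ge0// powRM ?powR_ge0 ?norm1_ge0//.
by rewrite -powRrM mulNr divfK// gt_eqF.
Qed.

Let mpow_growth c : H < c -> exists2 K : R, 0 < K &
  forall r, 1 <= r -> norm1 (mpow r D) <= K * r `^ c.
Proof. by move=> Hc; apply: mpow_growth_ge1 => z sz; apply: le_lt_trans Hc; exact: hH.2. Qed.

(** The exponent [p] exceeds [- q] because the spectrum of [D] lies in the right half plane, which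
makes the singularity at the origin integrable. *)
Let mpow_phi_le T : 0 < T -> exists p C : R, [/\ 0 < p + q, 0 < C &
  forall z, 0 < tau z <= T -> norm1 (mpow (phi z) A) `^ alpha <= C * tau z `^ p].
Proof.
move=> T0; have [lam lam0 hlam] := spectrum_lower_bound hD.
have [K1 K10 hK1] := mpow_growth_le1 hlam.
have [K2 K20 hK2] := mpow_growth hHbeta.
have [c1 [c2 [c10 c20 hc]]] := admissible_radial.
pose T' := c2 * T; have T'0 : 0 < T' by rewrite mulr_gt0.
pose K := K1 + K2 * T' `^ beta.
have K0 : 0 < K by rewrite ltr_pwDl// mulr_ge0 ?powR_ge0 ?(ltW K20).
pose p := lam * alpha - q.
exists p, (K `^ alpha * (c1 `^ p + c2 `^ p)); split.
- by rewrite /p subrK mulr_gt0.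
- by rewrite mulr_gt0 ?powR_gt0// addr_gt0 ?powR_gt0.
move=> z /andP[z0 zT]; have zn0 := radial_neq0 hpolar z0.
have t0 := phi_gt0 zn0; have /andP[h1 h2] := hc _ zn0.
have tT : phi z <= T' by apply: le_trans h2 _; rewrite ler_pM2l.
have tD : norm1 (mpow (phi z) D) <= K * phi z `^ lam.
  have [t1|t1] := leP (phi z) 1.
    apply: le_trans (hK1 _ _) _; first by rewrite t0.
    by rewrite ler_wpM2r ?powR_ge0// lerDl mulr_ge0 ?powR_ge0 ?(ltW K20).
  apply: le_trans (hK2 _ (ltW t1)) _.
  apply: (@le_trans _ _ (K2 * T' `^ beta)).
    rewrite ler_pM2l//; apply: ge0_ler_powR; rewrite ?nnegrE ?(ltW hbeta) ?(ltW t0) ?(ltW T'0)//.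
  apply: (@le_trans _ _ K); first by rewrite lerDr ltW.
  rewrite ler_peMr ?(ltW K0)//; apply: (@le_trans _ _ (1 `^ lam)); first by rewrite powR1.
  by apply: ge0_ler_powR; rewrite ?nnegrE ?ler01 ?(ltW lam0) ?(ltW t0) ?(ltW t1).
rewrite norm1_mpow_shift//.
apply: (@le_trans _ _ (phi z `^ (- q) * (K `^ alpha * phi z `^ (lam * alpha)))).
  rewrite ler_wpM2l ?powR_ge0// powRrM -powRM ?powR_ge0 ?(ltW K0)//.
  by apply: ge0_ler_powR; rewrite ?nnegrE ?norm1_ge0 ?mulr_ge0 ?powR_ge0 ?(ltW alpha0) ?(ltW K0).
have -> : phi z `^ (- q) * (K `^ alpha * phi z `^ (lam * alpha)) = K `^ alpha * phi z `^ p.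
  rewrite mulrCA -powRD 1?addrC//; by rewrite (gt_eqF t0) implybT.
rewrite -mulrA ler_pM2l ?powR_gt0//.
have zE : phi z = (phi z / tau z) * tau z by rewrite divfK// gt_eqF.
rewrite zE powRM ?divr_ge0 ?(ltW z0) ?(ltW t0)// ler_wpM2r ?powR_ge0//.
by apply: powR_between => //; rewrite ler_pdivlMr// ler_pdivrMr// h1.
Qed.

(** Away from the origin both arguments of the kernel are, after scaling, close to one
direction; admissibility and the Lipschitz bound for powers gain a factor [tau y `^ (- beta)]. *)
Lemma kernel_far : exists R0 C p : R, [/\ 1 <= R0, 0 < C, p + q < 0 &
  forall h y, tau h = 1 -> R0 < tau y -> norm1 (Q h y) `^ alpha <= C * tau y `^ p].
Proof.
pose c := (H + beta) / 2.
have [Hc cb] : H < c /\ c < beta by rewrite /c !(midf_lt hHbeta).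
have [K K0 hK] := mpow_growth Hc.
have [c1 [c2 [c10 c20 hc]]] := admissible_radial.
have [r r0 hr] := radial_bounded hpolar 1.
have [e e0 he] := radial_away hpolar ltr01.
have [_ _ /(_ e (r + e))] := hadm; case=> //; first by rewrite ltrDr.
move=> C C0 hC.
pose a := c1 / 2; pose b := c2 + a.
have a0 : 0 < a by rewrite divr_gt0.
have [L L0 hL] := mpow_lipschitz A b a0.
(* Beyond [R0] the admissibility bound [C * s `^ (- beta)] is at most [a], so that both values of
   [phi] stay in the interval [a, b]. *)
pose R0 := 1 + (C / a) `^ beta^-1.
have Ca : 0 < C / a by rewrite divr_gt0.
pose p := alpha * (c - beta) - q.
exists R0, ((K * (L * C)) `^ alpha), p; split.
- by rewrite lerDl powR_ge0.
- by rewrite powR_gt0// !mulr_gt0.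
- by rewrite /p subrK pmulr_rlt0// subr_lt0.
move=> h y h1 yR.
have y1 : 1 < tau y by apply: le_lt_trans yR; rewrite lerDl powR_ge0.
have s0 : 0 < tau y by rewrite (lt_trans ltr01).
set s := tau y in yR y1 s0 *.
have yn0 := radial_neq0 hpolar s0.
pose u := l y; have u1 : tau u = 1 := polar_dir hpolar yn0.
have yE : y = mpow s E *m u := polar_dec hpolar yn0.
pose x' := mpow s^-1 E *m h.
have x'E : tau x' = s^-1 by rewrite (polar_homo hpolar) ?invr_gt0// h1 mulr1.
have hE' : h = mpow s E *m x' by rewrite mulmxA mpowVK// mul1mx.
have un0 : - u != 0 by apply: (radial_neq0 hpolar); rewrite (polar_opp hpolar) u1.
have xun0 : x' - u != 0.
  rewrite subr_eq0; apply/eqP => /(congr1 tau); rewrite x'E u1 => /eqP.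
  by rewrite invr_eq1 => /eqP s1; move: y1; rewrite s1 ltxx.
have p1 : phi (h - y) = s * phi (x' - u) by rewrite hE' yE -mulmxBr hhomo.
have p2 : phi (- y) = s * phi (- u) by rewrite yE -mulmxN hhomo.
have sb0 : 0 < s `^ beta by rewrite powR_gt0.
have dif : `|phi (x' - u) - phi (- u)| <= C * s `^ (- beta).
  have := hC x' (- u); rewrite x'E enormN => /(_ _ _).
  have -> : s^-1 `^ beta = s `^ (- beta) by rewrite -powR_inv1 ?(ltW s0)// -powRrM mulN1r.
  apply; last by rewrite invf_le1// ltW.
  rewrite he ?u1//=; apply: (@le_trans _ _ r); last by rewrite lerDl ltW.
  by apply: hr; rewrite u1.
have sba : C * s `^ (- beta) <= a.
  rewrite powRN -ler_pdivlMr// ; last by rewrite invr_gt0.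
  rewrite invrK mulrC -ler_pdivrMr//.
  have -> : C / a = ((C / a) `^ beta^-1) `^ beta.
    by rewrite -powRrM mulVf ?gt_eqF// powRr1// ltW.
  apply: ge0_ler_powR; rewrite ?nnegrE ?powR_ge0 ?(ltW hbeta) ?(ltW s0)//.
  by apply: le_trans (ltW yR); rewrite lerDr.
have /andP[u1' u2'] := hc _ un0; rewrite (polar_opp hpolar) u1 !mulr1 in u1' u2'.
have in1 : a <= phi (- u) <= b.
  apply/andP; split; last by rewrite (le_trans u2')// lerDl ltW.
  by apply: le_trans u1'; rewrite /a; lra.
have in2 : a <= phi (x' - u) <= b.
  have := le_trans dif sba; rewrite ler_distl => /andP[i1 i2].
  apply/andP; split; last by apply: le_trans i2 _; rewrite lerD2r.
  apply: le_trans i1; rewrite lerBrDr; apply: le_trans u1'.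
  by rewrite /a; lra.
have f1 := phi_gt0 xun0; have f2 := phi_gt0 un0.
have QE : Q h y = mpow s A *m (mpow (phi (x' - u)) A - mpow (phi (- u)) A).
  by rewrite /Q /moving_average_kernel -/A p1 p2 !mpowM// -mulmxBr.
have n1 : norm1 (Q h y) `^ alpha <=
    norm1 (mpow s A) `^ alpha * (L * (C * s `^ (- beta))) `^ alpha.
  rewrite -powRM ?norm1_ge0 ?mulr_ge0 ?powR_ge0 ?(ltW L0) ?(ltW C0)//.
  apply: ge0_ler_powR; rewrite ?nnegrE ?norm1_ge0 ?mulr_ge0 ?norm1_ge0 ?powR_ge0 ?(ltW alpha0) ?(ltW L0) ?(ltW C0)//.
  rewrite QE; apply: le_trans (norm1M _ _) _; rewrite ler_wpM2l ?norm1_ge0//.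
  by apply: le_trans (hL _ _ in2 in1) _; rewrite ler_pM2l.
apply: le_trans n1 _; rewrite norm1_mpow_shift//.
have n2 : norm1 (mpow s D) `^ alpha <= (K * s `^ c) `^ alpha.
  by apply: ge0_ler_powR; rewrite ?nnegrE ?norm1_ge0 ?mulr_ge0 ?powR_ge0 ?(ltW alpha0) ?(ltW K0) ?hK ?(ltW y1).
apply: (@le_trans _ _ (s `^ (- q) * (K * s `^ c) `^ alpha * (L * (C * s `^ (- beta))) `^ alpha)).
  by rewrite ler_wpM2r ?powR_ge0// ler_wpM2l ?powR_ge0.
have sn0 : s != 0 by rewrite gt_eqF.
rewrite !powRM ?mulr_ge0 ?powR_ge0 ?(ltW K0) ?(ltW L0) ?(ltW C0)// -!powRrM.
have -> : s `^ p = s `^ (- q) * s `^ (c * alpha) * s `^ (- beta * alpha).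
  rewrite -!powRD ?sn0 ?implybT//; congr (_ `^ _); rewrite /p; ring.
rewrite le_eqVlt; apply/orP; left; apply/eqP; ring.
Qed.

Let half_powR_lt1 (al : R) : 0 < al -> (2^-1 : R) `^ al < 1.
Proof.
move=> al0; rewrite -[ltRHS](@powRr0 R 2^-1).
rewrite /powR ifF; last by apply/negbTE; rewrite invr_eq0 pnatr_eq0.
rewrite ifF; last by apply/negbTE; rewrite invr_eq0 pnatr_eq0.
by rewrite ltr_expR ltr_nM2r// ln_lt0// invr_gt0 ltr0n invf_lt1 ?ltr1n.
Qed.

(** A majorant of the kernel that is uniform over unit lags: in a bounded region the two terms are
estimated separately by translates of one integrable function [G], and outside it their difference
is estimated by [F]. *)
Let kernel_pieces : exists G F : 'cV[R]_d -> \bar R,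
  [/\ measurable_fun setT G, measurable_fun setT F,
      (forall y, 0 <= G y)%E /\ (forall y, 0 <= F y)%E,
      (\int[lebesgue_cV d]_y G y < +oo)%E /\ (\int[lebesgue_cV d]_y F y < +oo)%E &
      forall h y, tau h = 1 ->
        ((norm1 (Q h y) `^ alpha)%:E <= (2 `^ alpha)%:E * (G (y - h)%R + G y) + F y)%E].
Proof.
have [R0 [Cf [pf [R1 Cf0 pf0 far]]]] := kernel_far.
have [K K2 hK] := radial_sub hE hpolar R0.
have K0 : 0 < K by exact: lt_le_trans K2.
have [p [C [p0 C0 near]]] := mpow_phi_le K0.
pose S := [set z | tau z <= K].
have mS : measurable S.
  have := measurable_between 0 K mtau.
  by rewrite (_ : [set v | 0 <= tau v <= K] = S)//; apply/seteqP; split => v /=; rewrite tau_ge0.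
pose U (c B : R) := [set v | exists k, 2^-1 <= tau v / c ^+ k <= B].
have mU c B : measurable (U c B).
  rewrite (_ : U c B = \bigcup_k [set v | (2^-1 <= tau v / c ^+ k <= B)%R]).
    apply: bigcupT_measurable => k; apply: measurable_between.
    by apply: measurable_funM => //.
  by apply/seteqP; split => v /= [k]; [exists k|move=> _; exists k].
pose Uf := U 2 2; pose Un := U 2^-1 K.
pose g z := norm1 (mpow (phi (- z)) A) `^ alpha.
have mg : measurable_fun setT (EFin \o g).
  exact: (@measurable_norm1_powR R d m alpha _ (measurableT_comp measurable_mpow_phi measurable_opp)).
pose tp (r : R) (z : 'cV[R]_d) := tau z `^ r.
have mtp (r : R) : measurable_fun setT (EFin \o (tp r)).
  by apply/measurable_EFinP; exact: (measurableT_comp (measurable_powR r) mtau).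
pose G z : \bar R := ((EFin \o g) \_ S) z.
pose F z : \bar R := (Cf%:E * ((EFin \o (tp pf)) \_ Uf) z)%E.
have res_ge0 (f : 'cV[R]_d -> R) (V : set 'cV[R]_d) z : (forall z, 0 <= f z) ->
    (0 <= ((EFin \o f) \_ V) z)%E.
  by move=> f0; rewrite patchE; case: ifP => // _; rewrite lee_fin.
have G0 z : (0 <= G z)%E by apply: res_ge0 => y; exact: powR_ge0.
have F0 z : (0 <= F z)%E.
  by apply: mule_ge0; [rewrite lee_fin ltW|apply: res_ge0 => y; exact: powR_ge0].
have mres (f : 'cV[R]_d -> R) (V : set 'cV[R]_d) : measurable V ->
    measurable_fun setT (EFin \o f) -> measurable_fun setT ((EFin \o f) \_ V).
  move=> mV mf; have mfV : measurable_fun V (EFin \o f) by exact: measurable_funTS.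
  by move: mfV => /(measurable_restrictT _ mV).
have mG : measurable_fun setT G by exact: mres.
have mFf : measurable_fun setT ((EFin \o (tp pf)) \_ Uf).
  by apply: mres; [exact: mU|exact: mtp].
have mFn : measurable_fun setT ((EFin \o (tp p)) \_ Un).
  by apply: mres; [exact: mU|exact: mtp].
have mF : measurable_fun setT F.
  exact: (emeasurable_funM (@measurable_cst _ _ _ _ setT Cf%:E) mFf).
exists G, F; split => //; first split.
- have m0 : measurable [set (0 : 'cV[R]_d)].
    have <- : [set v | 0 <= tau v <= 0] = [set (0 : 'cV[R]_d)].
      apply/seteqP; split => v /=; last by move=> ->; rewrite (polar_tau0 hpolar) lexx.
      move=> /andP[_ v0]; apply/eqP/negPn/negP => /(polar_gt0 hpolar).
      by rewrite ltNge v0.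
    exact: measurable_between.
  pose J z : \bar R := (C%:E * ((EFin \o (tp p)) \_ Un) z
    + (g 0)%:E * (\1_[set (0 : 'cV[R]_d)] z)%:E)%E.
  have J1 : measurable_fun setT (fun z => C%:E * ((EFin \o (tp p)) \_ Un) z)%E.
    exact: (emeasurable_funM (@measurable_cst _ _ _ _ setT C%:E) mFn).
  have mI : measurable_fun setT (fun z : 'cV[R]_d => (\1_[set (0 : 'cV[R]_d)] z : R)%:E).
    by apply/measurable_EFinP; exact: measurable_indic.
  have J2 : measurable_fun setT (fun z => (g 0)%:E * (\1_[set (0 : 'cV[R]_d)] z)%:E)%E.
    exact: (emeasurable_funM (@measurable_cst _ _ _ _ setT (g 0)%:E) mI).
  have J10 z : (0 <= C%:E * ((EFin \o (tp p)) \_ Un) z)%E.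
    by apply: mule_ge0; [rewrite lee_fin ltW|apply: res_ge0 => y; exact: powR_ge0].
  have J20 z : (0 <= (g 0)%:E * (\1_[set (0 : 'cV[R]_d)] z)%:E)%E.
    by rewrite -EFinM lee_fin mulr_ge0 ?powR_ge0.
  apply: (@le_lt_trans _ _ (\int[lebesgue_cV d]_z J z)%E).
    apply: ge0_le_integral => //; first exact: emeasurable_funD.
    move=> z _; rewrite /G patchE; case: ifPn => [|_]; last by rewrite adde_ge0.
    rewrite inE /S /= => zK; have [->|z0] := eqVneq z 0.
      apply: (@le_trans _ _ ((g 0)%:E * (\1_[set (0 : 'cV[R]_d)] (0 : 'cV[R]_d))%:E)%E).
        by rewrite indicE mem_set// mule1.
      by rewrite leeDr.
    have t0 := polar_gt0 hpolar z0.
    apply: (@le_trans _ _ (C%:E * ((EFin \o (tp p)) \_ Un) z)%E); last by rewrite leeDl.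
    have [k hk] : exists k, 2^-1 <= tau z * 2 ^+ k <= K.
      by apply: dyadic_scale => //; rewrite t0.
    rewrite patchE mem_set; last by exists k; rewrite exprVn invrK.
    have := near (- z); rewrite (polar_opp hpolar) t0 => /(_ zK) h.
    by rewrite /= -EFinM lee_fin.
  rewrite ge0_integralD//; apply: lte_add_pinfty.
    rewrite (ge0_integralZl _ measurableT mFn); last 2 first.
    - by move=> z _; apply: res_ge0 => y; exact: powR_ge0.
    - by rewrite lee_fin ltW.
    rewrite -integral_mkcond; apply: lte_mul_pinfty; [by rewrite lee_fin ltW|by []|].
    apply: (radial_power_integral hpolar) => //.
    have : 2^-1 `^ (p + q) < 1 :> R by exact: half_powR_lt1.
    by [].
  rewrite (ge0_integralZl _ measurableT mI); last 2 first.
  - by move=> z _; rewrite lee_fin.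
  - by rewrite lee_fin powR_ge0.
  have -> : (\int[lebesgue_cV d]_x (\1_[set (0 : 'cV[R]_d)] x)%:E = 0)%E.
    rewrite integral_indic// setIT; exact: lebesgue_cV_point.
  by rewrite mule0 ltry.
- rewrite (ge0_integralZl _ measurableT mFf); last 2 first.
  + by move=> z _; apply: res_ge0 => y; exact: powR_ge0.
  + by rewrite lee_fin ltW.
  rewrite -integral_mkcond; apply: lte_mul_pinfty; [by rewrite lee_fin ltW|by []|].
  apply: (radial_power_integral hpolar) => //.
  have h : 2^-1 `^ (- (pf + q)) < 1 :> R by apply: half_powR_lt1; rewrite oppr_gt0.
  by move: h; rewrite -powR_inv1// -powRrM mulrNN mul1r.
move=> h y h1; have [yR|yR] := leP (tau y) R0.
  have yK : tau y <= K.
    have := hK y 0 yR; rewrite subr0 (polar_tau0 hpolar); apply.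
    exact: le_trans ler01 R1.
  have hyK : tau (y - h) <= K.
    by rewrite -(polar_opp hpolar) opprB; apply: hK; rewrite ?h1.
  apply: (@le_trans _ _ ((2 `^ alpha)%:E * (G (y - h)%R + G y))%E); last by rewrite leeDl.
  rewrite /G !patchE !mem_set//= -EFinD -EFinM lee_fin /g opprB.
  apply: le_trans (powRD_le _ _ _); rewrite ?norm1_ge0 ?(ltW alpha0)//.
  apply: ge0_ler_powR; rewrite ?nnegrE ?addr_ge0 ?norm1_ge0 ?(ltW alpha0)//.
  by apply: le_trans (norm1D _ _) _; rewrite norm1N.
apply: (@le_trans _ _ (F y)); last first.
  by rewrite leeDr// mule_ge0 ?adde_ge0// lee_fin powR_ge0.
have t0 : 0 < tau y by apply: lt_trans yR; apply: lt_le_trans R1.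
have [k /andP[k1 k2]] : exists k, 2^-1 <= (tau y)^-1 * 2 ^+ k <= (2 : R).
  apply: dyadic_scale => //; rewrite invr_gt0 t0 /= (@le_trans _ _ 1) ?ler1n//.
  by rewrite invf_le1// (le_trans R1)// ltW.
rewrite /F patchE mem_set; last first.
  exists k; have pk : 0 < tau y / 2 ^+ k by rewrite divr_gt0// exprn_gt0.
  have -> : tau y / 2 ^+ k = ((tau y)^-1 * 2 ^+ k)^-1 by rewrite invfM invrK.
  have pV : 0 < (tau y)^-1 * 2 ^+ k by rewrite mulr_gt0 ?invr_gt0// exprn_gt0.
  by rewrite lef_pV2 ?posrE// k2 /= -[leRHS]invrK lef_pV2 ?posrE// invr_gt0.
by rewrite -EFinM lee_fin; exact: far.
Qed.

Lemma kernel_integral_directions : exists2 B : R, 0 <= B & forall h, tau h = 1 ->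
  (\int[lebesgue_cV d]_y (norm1 (Q h y) `^ alpha)%:E <= B%:E)%E.
Proof.
have [G [F [mG mF [G0 F0] [Goo Foo] hGF]]] := kernel_pieces.
pose IG := (\int[lebesgue_cV d]_y G y)%E; pose IF := (\int[lebesgue_cV d]_y F y)%E.
have IG0 : (0 <= IG)%E by apply: integral_ge0.
have IF0 : (0 <= IF)%E by apply: integral_ge0.
pose B := ((2 `^ alpha)%:E * (IG + IG) + IF)%E.
have B0 : (0 <= B)%E.
  by apply: adde_ge0 => //; apply: mule_ge0 => //; exact: adde_ge0.
have Boo : (B < +oo)%E.
  apply: lte_add_pinfty => //; apply: lte_mul_pinfty => //.
  exact: lte_add_pinfty.
exists (fine B); first exact: fine_ge0.
move=> h h1; rewrite fineK ?ge0_fin_numE//.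
have mGh : measurable_fun setT (fun y : 'cV[R]_d => G (y - h)).
  apply: (measurableT_comp mG); apply: measurable_fun_mxB; [exact: measurable_id|exact: measurable_cst].
have mGG : measurable_fun setT (fun y : 'cV[R]_d => G (y - h)%R + G y)%E by exact: emeasurable_funD.
have GG0 y : (0 <= G (y - h)%R + G y)%E by rewrite adde_ge0.
have mGG2 : measurable_fun setT (fun y : 'cV[R]_d => (2 `^ alpha)%:E * (G (y - h)%R + G y))%E.
  exact: emeasurable_funM.
have GG20 y : (0 <= (2 `^ alpha)%:E * (G (y - h)%R + G y))%E.
  by rewrite mule_ge0// lee_fin powR_ge0.
apply: (@le_trans _ _ (\int[lebesgue_cV d]_y ((2 `^ alpha)%:E * (G (y - h)%R + G y) + F y))%E).
  apply: ge0_le_integral => //.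
  - by move=> y _; rewrite lee_fin powR_ge0.
  - by apply: measurable_norm1_powR; exact: measurable_kernel.
  - exact: emeasurable_funD.
  - by move=> y _; exact: hGF.
rewrite ge0_integralD// ge0_integralZl//.
rewrite ge0_integralD//.
by have -> : (\int[lebesgue_cV d]_y G (y - h)%R = IG)%E by exact: (ge0_integral_translate (- h) mG G0).
Qed.

(** The power of the determinant of [mpow r E] and the scalar part [r `^ (- q / alpha)] of the
matrix power compensate each other; this is where the exponent [D - q / alpha] comes from. *)
Lemma kernel_scale r t v : 0 < r -> v != 0 -> v != t ->
  Q (mpow r E *m t) (mpow r E *m v) = mpow r A *m Q t v.
Proof.
move=> r0 v0 vt; have vn : - v != 0 by rewrite oppr_eq0.
have tv : t - v != 0 by rewrite subr_eq0 eq_sym.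
rewrite /Q /moving_average_kernel -/A -mulmxBr -mulmxN !hhomo//.
by rewrite !mpowM ?phi_gt0// mulmxBr.
Qed.

Lemma kernel_shift t h u : Q (t + h) u - Q h u = Q t (u - h).
Proof.
rewrite /Q /moving_average_kernel -/A.
have -> : t - (u - h) = t + h - u by rewrite opprB addrA.
have -> : - (u - h) = h - u by rewrite opprB.
by rewrite opprB addrA subrK.
Qed.

Lemma kernel0 y : Q 0 y = 0.
Proof. by rewrite /Q /moving_average_kernel sub0r subrr. Qed.

(** The pointwise scaling identity fails only at the finitely many singularities of the kernels,
which form a null set, so it may be integrated. *)
Lemma integral_kernel_scale (J : finType) (t : J -> 'cV[R]_d) r (G : (J -> 'M[R]_m) -> \bar R) :
  0 < r -> (forall M, 0 <= G M)%E ->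
  measurable_fun setT (fun u => G (fun j => Q (mpow r E *m t j) u)) ->
  measurable_fun setT (fun v => G (fun j => mpow r A *m Q (t j) v)) ->
  (\int[lebesgue_cV d]_u G (fun j => Q (mpow r E *m t j) u) =
   (r `^ q)%:E * \int[lebesgue_cV d]_v G (fun j => mpow r A *m Q (t j) v))%E.
Proof.
move=> r0 G0 m1 m2.
rewrite -(ge0_integral_radial_scale E r0 m1 (fun=> G0 _)); congr (_ * _)%E.
have m1' : measurable_fun setT (fun v => G (fun j => Q (mpow r E *m t j) (mpow r E *m v))).
  apply: (measurableT_comp m1 (f := _)); apply: measurable_fun_mulmx; exact: measurable_id.
apply: ae_eq_integral; [exact: measurableT|exact: m1'|exact: m2|].
have ae1 (a : 'cV[R]_d) : {ae lebesgue_cV d, forall v, v != a}.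
  exists [set a]; split.
  - have := measurable_between 0 0 (measurableT_comp mtau (measurable_sub a)).
    rewrite (_ : [set v | _] = [set a])//; apply/seteqP; split => v /=.
      move=> /andP[_ v0]; apply/esym/eqP; rewrite -subr_eq0.
      by apply/negPn/negP => /(polar_gt0 hpolar); rewrite ltNge v0.
    by move=> ->; rewrite subrr (polar_tau0 hpolar) lexx.
  - exact: lebesgue_cV_point.
  - by move=> v /= /negP/negPn/eqP.
have : {ae lebesgue_cV d, forall v, forall j : option J, v != if j is Some k then t k else 0}.
  by apply: filter_forall => -[k|]; exact: ae1.
apply: filterS => v hv _; congr G; apply/funext => j.
by apply: kernel_scale => //; [exact: (hv None)|exact: (hv (Some j))].
Qed.

(** Writing the lag as [r^E h] with [tau h = 1] and scaling reduces the bound to the uniform one over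
the unit lags. *)
Lemma kernel_integral_le : exists2 B : R, 0 <= B & forall x, x != 0 ->
  (\int[lebesgue_cV d]_y (norm1 (Q x y) `^ alpha)%:E <=
   (norm1 (mpow (tau x) D) `^ alpha * B)%:E)%E.
Proof.
have [B B0 hB] := kernel_integral_directions; exists B => // x x0.
have t0 := polar_gt0 hpolar x0.
have m1 y : measurable_fun setT (fun u => (norm1 (Q y u) `^ alpha)%:E).
  by apply: measurable_norm1_powR; exact: measurable_kernel.
have m2 : measurable_fun setT (fun v => (norm1 (mpow (tau x) A *m Q (l x) v) `^ alpha)%:E).
  by apply: measurable_norm1_powR; apply: measurable_fun_mulmx; exact: measurable_kernel.
have := @integral_kernel_scale unit (fun=> l x) (tau x)
  (fun M => (norm1 (M tt) `^ alpha)%:E) t0 _ (m1 _) m2.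
rewrite -(polar_dec hpolar x0) => ->; last by move=> M; rewrite lee_fin powR_ge0.
apply: (@le_trans _ _ ((tau x `^ q)%:E * ((norm1 (mpow (tau x) A) `^ alpha)%:E *
    \int[lebesgue_cV d]_v (norm1 (Q (l x) v) `^ alpha)%:E))%E).
  apply: lee_wpmul2l; first by rewrite lee_fin powR_ge0.
  rewrite -(ge0_integralZl _ measurableT (m1 (l x))); last 2 first.
  - by move=> v _; rewrite lee_fin powR_ge0.
  - by rewrite lee_fin powR_ge0.
  apply: ge0_le_integral; [exact: measurableT| |exact: m2| |].
  - by move=> v _; rewrite lee_fin powR_ge0.
  - exact: (emeasurable_funM (@measurable_cst _ _ _ _ setT _) (m1 (l x))).
  - move=> v _; rewrite -EFinM lee_fin -powRM ?norm1_ge0//.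
    by apply: ge0_ler_powR; rewrite ?nnegrE ?mulr_ge0 ?norm1_ge0 ?(ltW alpha0) ?norm1M.
rewrite muleA -EFinM norm1_mpow_shift// mulrA -powRD; last by rewrite (gt_eqF t0) implybT.
rewrite subrr powRr0 mul1r EFinM; apply: lee_wpmul2l; first by rewrite lee_fin powR_ge0.
exact: hB (polar_dir hpolar x0).
Qed.

(** Letting [tau x] tend to 0 in the previous bound: the powers [mpow r D] decay like a positive
power of [r]. *)
Lemma kernel_integral_small e : 0 < e -> \forall x \near (0 : 'cV[R]_d),
  (\int[lebesgue_cV d]_y (norm1 (Q x y) `^ alpha)%:E <= e%:E)%E.
Proof.
move=> e0.
have [B B0 hB] := kernel_integral_le.
have [lam lam0 hlam] := spectrum_lower_bound hD.
have [K K0 hK] := mpow_growth_le1 hlam.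
pose C := K `^ alpha * B + 1.
have C0 : 0 < C by rewrite ltr_wpDl// mulr_ge0 ?powR_ge0.
pose p := lam * alpha; have p0 : 0 < p by rewrite mulr_gt0.
pose b := Num.min 1 ((e / C) `^ p^-1).
have b0 : 0 < b by rewrite lt_min ltr01 powR_gt0// divr_gt0.
have : \forall z \near (0 : 'cV[R]_d), tau z < b.
  have /cvgrPdist_lt/(_ b b0) := polar_zero hpolar.
  by apply: filterS => z; rewrite sub0r normrN ger0_norm.
apply: filterS => z; rewrite lt_min => /andP[z1 zb].
have [->|z0] := eqVneq z 0.
  rewrite integral0_eq ?lee_fin ?(ltW e0)// => y _.
  have n0 : norm1 (0 : 'M[R]_m) = 0 by apply/eqP; rewrite norm1_eq0.
  by rewrite kernel0 n0 powR0// gt_eqF.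
have t0 := polar_gt0 hpolar z0.
apply: le_trans (hB z z0) _; rewrite lee_fin.
apply: (@le_trans _ _ ((K * tau z `^ lam) `^ alpha * B)).
  rewrite ler_wpM2r//; apply: ge0_ler_powR; rewrite ?nnegrE ?norm1_ge0 ?mulr_ge0 ?powR_ge0 ?(ltW alpha0) ?(ltW K0)//.
  by apply: hK; rewrite t0 ltW.
rewrite powRM ?powR_ge0 ?(ltW K0)// -powRrM -/p mulrAC.
have h : tau z `^ p <= e / C.
  have -> : e / C = ((e / C) `^ p^-1) `^ p.
    by rewrite -powRrM mulVf ?gt_eqF// powRr1// ltW// divr_gt0.
  by apply: ge0_ler_powR; rewrite ?nnegrE ?powR_ge0 ?(ltW p0) ?(ltW t0) ?(ltW zb).
apply: (@le_trans _ _ (C * (e / C))); last by rewrite mulrC divfK// gt_eqF.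
apply: ler_pM; rewrite ?mulr_ge0 ?powR_ge0//.
by rewrite /C lerDl.
Qed.

Lemma kernel_is_integrand x : is_integrand alpha (Q x).
Proof.
split; first exact: measurable_kernel.
have [B B0 hB] := kernel_integral_le.
have [->|x0] := eqVneq x 0.
  rewrite integral0_eq ?ltry// => y _.
  have n0 : norm1 (0 : 'M[R]_m) = 0 by apply/eqP; rewrite norm1_eq0.
  have : opnorm (Q 0 y) = 0.
    by apply/le_anti; rewrite opnorm_ge0 andbT kernel0 (le_trans (opnorm_le_norm1 _))// n0.
  by move=> ->; rewrite powR0// gt_eqF.
apply: (@le_lt_trans _ _ (\int[lebesgue_cV d]_y (norm1 (Q x y) `^ alpha)%:E)%E); last first.
  by apply: le_lt_trans (hB x x0) _; rewrite ltry.
apply: ge0_le_integral; [exact: measurableT| | | |].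
- by move=> y _; rewrite lee_fin powR_ge0.
- by apply: measurable_opnorm_powR; exact: measurable_kernel.
- by apply: measurable_norm1_powR; exact: measurable_kernel.
- move=> y _; rewrite lee_fin; apply: ge0_ler_powR; rewrite ?nnegrE ?norm1_ge0 ?opnorm_ge0 ?(ltW alpha0)//.
  exact: opnorm_le_norm1.
Qed.

End kernel.

(** * Laws of the field *)

Section product_law.
Context {dO : measure_display} {Omega : measurableType dO} {R : realType}.
Variable P : probability Omega R.

Let Pfin : (P setT < +oo)%E.
Proof. by rewrite probability_setT ltry. Qed.

Let PPfin : ((P \x P)%E [set: Omega * Omega] < +oo)%E.
Proof. by rewrite probability_setT ltry. Qed.

Lemma integral_product_bounded (f g : Omega -> R) :
  measurable_fun setT f -> measurable_fun setT g ->
  (forall w, `|f w| <= 1) -> (forall w, `|g w| <= 1) ->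
  \int[(P \x P)%E]_w (f w.1 * g w.2) = (\int[P]_w f w) * (\int[P]_w g w).
Proof.
move=> mf mg f1 g1.
have If : P.-integrable setT (EFin \o f) by exact: (bounded_integrable Pfin mf f1).
have Ig : P.-integrable setT (EFin \o g) by exact: (bounded_integrable Pfin mg g1).
have mfg : measurable_fun setT (fun w : Omega * Omega => f w.1 * g w.2).
  apply: measurable_funM.
    exact: (measurableT_comp mf measurable_fst).
  exact: (measurableT_comp mg measurable_snd).
have Ifg : (P \x P)%E.-integrable setT (EFin \o (fun w : Omega * Omega => f w.1 * g w.2)).
  apply: (bounded_integrable PPfin mfg (K := 1)) => w.
  by rewrite normrM mulr_ile1.
rewrite {1}/Rintegral -(integral12_prod_meas1 Ifg).
have Fg : (\int[P]_w (EFin \o g) w)%E \is a fin_num by exact: integrable_fin_num.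
pose fg (w : Omega * Omega) := f w.1 * g w.2; pose c := \int[P]_w g w.
have -> : (\int[P]_x fubini_F P (EFin \o fg) x = \int[P]_x ((EFin \o f) x * c%:E))%E.
  apply: eq_integral => x _; rewrite /fubini_F /= /fg /=.
  under eq_integral do rewrite EFinM.
  by rewrite (integralZl measurableT Ig) /c /Rintegral fineK.
by rewrite (integralZr measurableT If) fineM ?integrable_fin_num.
Qed.

Lemma has_charfun_product (f g : Omega -> R) a b :
  measurable_fun setT f -> measurable_fun setT g ->
  has_charfun P f a -> has_charfun P g b ->
  has_charfun (P \x P)%E (fun w : Omega * Omega => f w.1 + g w.2) (a * b).
Proof.
move=> mf mg [fc fs] [gc gs].
have mcf := measurable_cos_comp mf; have msf := measurable_sin_comp mf.
have mcg := measurable_cos_comp mg; have msg := measurable_sin_comp mg.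
have int (u v : Omega -> R) : measurable_fun setT u -> measurable_fun setT v ->
    (forall w, `|u w| <= 1) -> (forall w, `|v w| <= 1) ->
    (P \x P)%E.-integrable setT (EFin \o (fun w : Omega * Omega => u w.1 * v w.2)).
  move=> mu mv u1 v1; apply: (bounded_integrable PPfin (K := 1)) => [|w].
    apply: measurable_funM.
      exact: (measurableT_comp mu measurable_fst).
    exact: (measurableT_comp mv measurable_snd).
  by rewrite normrM mulr_ile1.
have c1 (u : Omega -> R) w : `|cos (u w)| <= 1 by exact: cos_max.
have s1 (u : Omega -> R) w : `|sin (u w)| <= 1 by exact: sin_max.
split.
- transitivity (\int[(P \x P)%E]_w (cos (f w.1) * cos (g w.2) - sin (f w.1) * sin (g w.2))).
    by apply: eq_Rintegral => w _; rewrite cosD.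
  rewrite (RintegralB measurableT (int _ _ mcf mcg (c1 f) (c1 g)) (int _ _ msf msg (s1 f) (s1 g))).
  rewrite (integral_product_bounded mcf mcg (c1 f) (c1 g)).
  by rewrite (integral_product_bounded msf msg (s1 f) (s1 g)) fc fs gc gs mul0r subr0.
- transitivity (\int[(P \x P)%E]_w (sin (f w.1) * cos (g w.2) + cos (f w.1) * sin (g w.2))).
    by apply: eq_Rintegral => w _; rewrite sinD.
  rewrite (RintegralD measurableT (int _ _ msf mcg (s1 f) (c1 g)) (int _ _ mcf msg (c1 f) (s1 g))).
  rewrite (integral_product_bounded msf mcg (s1 f) (c1 g)).
  by rewrite (integral_product_bounded mcf msg (c1 f) (s1 g)) fc fs gc gs mul0r mulr0 addr0.
Qed.

End product_law.

Section sas_laws.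
Context {dO : measure_display} {Omega : measurableType dO} {R : realType}.
Variable P : probability Omega R.
Context {m k : nat}.

Let measurable_mxdot_comp dT (T : measurableType dT) (U : T -> 'M[R]_(m, k)) A :
  measurable_fun setT U -> measurable_fun setT (fun w => mxdot A (U w)).
Proof. by move=> mU; exact: (measurableT_comp (measurable_mxdot A) mU). Qed.

Lemma eq_law_has_charfun d1 d2 (T1 : measurableType d1) (T2 : measurableType d2)
    (P1 : probability T1 R) (P2 : probability T2 R)
    (U : T1 -> 'M[R]_(m, k)) (V : T2 -> 'M[R]_(m, k)) (a : 'M[R]_(m, k) -> R) :
  measurable_fun setT U -> measurable_fun setT V ->
  (forall A, has_charfun P1 (fun w => mxdot A (U w)) (a A)) ->
  (forall A, has_charfun P2 (fun w => mxdot A (V w)) (a A)) ->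
  forall B, measurable B -> P1 [set w | B (U w)] = P2 [set w | B (V w)].
Proof.
move=> mU mV hU hV; apply: eq_law_fourier => // A.
  by have [-> _] := hU A; have [-> _] := hV A.
by have [_ ->] := hU A; have [_ ->] := hV A.
Qed.

(** A random matrix whose characteristic function is [expR (- a)] with [a] homogeneous of degree
[alpha] is symmetric since that function is real, and stable since the sum of independent
multiples has again a function of this form. *)
Lemma sas_vector_charfun (alpha : R) (V : Omega -> 'M[R]_(m, k)) (a : 'M[R]_(m, k) -> R) :
  0 < alpha -> measurable_fun setT V -> (forall A, 0 <= a A) ->
  (forall t A, a (t *: A) = `|t| `^ alpha * a A) ->
  (forall A, has_charfun P (fun w => mxdot A (V w)) (expR (- a A))) ->
  sas_vector P alpha V.
Proof.
move=> alpha0 mV a0 aZ hV; split => //.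
have mA A := measurable_mxdot_comp A mV.
have hZ t A : has_charfun P (fun w => t * mxdot A (V w)) (expR (- (`|t| `^ alpha * a A))).
  have := hV (t *: A); rewrite aZ; congr has_charfun.
  by apply/funext => w; rewrite mxdotZl.
have mN : measurable_fun setT (fun w => - V w).
  have := measurable_fun_mxB (@measurable_cst _ _ _ _ setT (0 : 'M[R]_(m, k))) mV.
  by under eq_fun do rewrite /= sub0r.
have mS (c : R) : measurable_fun setT (fun w => c *: V w).
  apply: measurable_fun_mxP => i j; under eq_fun do rewrite mxE.
  apply: measurable_funM => //.
  exact: (measurableT_comp (measurable_fun_coord i j) mV).
have mxdotZr c A B : mxdot A (c *: B) = c * mxdot A B :> R.
  by rewrite /mxdot -scalemxAr mxtraceZ.
have mxdotDr A B C : mxdot A (B + C) = mxdot A B + mxdot A C :> R.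
  by rewrite /mxdot mulmxDr mxtraceD.
case: ifPn => [/eqP alpha2 A|_]; last first.
  split.
    apply: (eq_law_has_charfun mN mV _ hV) => A.
    have := hZ (-1) A; rewrite normrN1 powR1 mul1r; congr has_charfun.
    by apply/funext => w; rewrite -[- V w]scaleN1r mxdotZr.
  move=> b c b0 c0; exists 0; set s := _ `^ alpha^-1.
  have s0 : 0 <= s by rewrite powR_ge0.
  have sE : s `^ alpha = b `^ alpha + c `^ alpha.
    by rewrite -powRrM mulVf ?gt_eqF// powRr1// addr_ge0 ?powR_ge0.
  have mV2 : measurable_fun setT (fun w : Omega * Omega => b *: V w.1 + c *: V w.2).
    apply: measurable_fun_mxP => i j; under eq_fun do rewrite mxE.
    apply: measurable_funD.
      exact: (measurableT_comp (measurable_fun_coord i j) (measurableT_comp (mS b) measurable_fst)).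
    exact: (measurableT_comp (measurable_fun_coord i j) (measurableT_comp (mS c) measurable_snd)).
  have msV : measurable_fun setT (fun w => s *: V w + 0).
    by under eq_fun do rewrite addr0; exact: mS.
  apply: (@eq_law_has_charfun _ _ _ _ (P \x P)%E P _ _ (fun A => expR (- (s `^ alpha * a A)))) => // A.
    have := has_charfun_product (measurable_funM (@measurable_cst _ _ _ _ setT b) (mA A))
      (measurable_funM (@measurable_cst _ _ _ _ setT c) (mA A)) (hZ b A) (hZ c A).
    rewrite -expRD -opprD -mulrDl !gtr0_norm// -sE; congr has_charfun.
    by apply/funext => w; rewrite mxdotDr !mxdotZr.
  have := hZ s A; rewrite ger0_norm//; congr has_charfun.
  by apply/funext => w; rewrite addr0 mxdotZr.
have t2 (t : R) : `|t| `^ alpha = t ^+ 2.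
  by rewrite alpha2 -[2]/(2%:R) powR_mulrn// real_normK// num_real.
have [aA|aA] := ltP 0 (a A).
  left; pose s := Num.sqrt (2 * a A).
  have s0 : 0 < s by rewrite sqrtr_gt0 mulr_gt0.
  exists s => // B mB; apply: (normal_law_charfun (mA A) s0) => // t.
  have := hZ t A; rewrite t2; congr (has_charfun P _ (expR (- _))).
  by rewrite sqr_sqrtr ?mulr_ge0//; field.
right.
have aA0 : a A = 0 by apply/le_anti; rewrite aA a0.
have tail e : 0 < e -> P [set w | (e < `|mxdot A (V w)|)%R] = 0%E.
  move=> e0; apply/eqP; rewrite eq_le measure_ge0 andbT.
  apply: le_trans (tail_bound alpha0 (lexx 0) e0 (mA A) _) _; last by rewrite !mulr0.
  move=> t t0; have [+ _] := hZ t A; rewrite aA0 !mulr0 => ->.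
  by [].
have mB e : measurable [set w | (e < `|mxdot A (V w)|)%R].
  apply: (measurable_gt (f := fun w => `|mxdot A (V w)|)).
  exact: (measurableT_comp (@normr_measurable R setT) (mA A)).
have mZ : measurable [set w | mxdot A (V w) = 0].
  by rewrite -[X in measurable X]setTI; exact: (mA A measurableT [set 0]).
rewrite -[LHS]/(P [set w | mxdot A (V w) = 0]) -[X in P X]setCK probability_setC; last first.
  exact: measurableC.
suff -> : P (~` [set w | mxdot A (V w) = 0]) = 0%E by rewrite sube0.
apply/eqP; rewrite eq_le measure_ge0 andbT.
have sub : ~` [set w | mxdot A (V w) = 0] `<=` \bigcup_n [set w | (n.+1%:R^-1 < `|mxdot A (V w)|)%R].
  move=> w /= /eqP w0; have : 0 < `|mxdot A (V w)| by rewrite normr_gt0.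
  move=> /ltr_add_invr[n]; rewrite add0r => hn; by exists n.
have := @measure_sigma_subadditive _ _ _ P _ (fun n => [set w | (n.+1%:R^-1 < `|mxdot A (V w)|)%R]) (fun n => mB _) (measurableC mZ) sub.
by rewrite eseries0// => n _ _; apply: tail; rewrite invr_gt0.
Qed.

End sas_laws.

(** * The moving-average field *)

Lemma scale_powR_cancel (R : realType) (r q alpha : R) (x : \bar R) : 0 < r -> 0 < alpha ->
  ((r `^ q)%:E * ((`|r `^ (- (q / alpha))| `^ alpha)%:E * x) = x)%E.
Proof.
move=> r0 alpha0; rewrite muleA -EFinM ger0_norm ?powR_ge0//.
rewrite -powRrM mulNr divfK ?gt_eqF// -powRD; last by rewrite (gt_eqF r0) implybT.
by rewrite subrr powRr0 mul1e.
Qed.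

Lemma mulr_div_addr1_le (R : realFieldType) (C e : R) : 0 <= C -> 0 < e ->
  C * (e / (C + 1)) <= e.
Proof.
move=> C0 e0; have C1 : 0 < C + 1 by rewrite ltr_wpDl.
by rewrite mulrA ler_pdivrMr// mulrC ler_pM2l// lerDl.
Qed.

Section field.
Context {R : realType} {d m : nat}.
Hypothesis d0 : (0 < d)%N.
Context {dO : measure_display} {Omega : measurableType dO} {P : probability Omega R}.
Variables (alpha : R) (E : 'M[R]_d) (D : 'M[R]_m).
Variables (tau : 'cV[R]_d -> R) (l : 'cV[R]_d -> 'cV[R]_d).
Variables (phi : 'cV[R]_d -> R) (beta H : R).
Hypotheses (alpha0 : 0 < alpha) (hE : positive_spectrum E) (hD : positive_spectrum D).
Hypothesis hpolar : polar_coordinates E tau l.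
Hypotheses (hbeta : 0 < beta) (hhomo : homogeneous E phi).
Hypothesis hadm : admissible tau beta phi.
Hypotheses (hH : is_max_Re D H) (hHbeta : H < beta).
Variables (M : set 'cV[R]_d -> {RV P >-> 'cV[R]_m}) (hM : sas_random_measure alpha M).
Let Q := moving_average_kernel alpha E D phi.
Variable X : 'cV[R]_d -> {RV P >-> 'cV[R]_m}.
Hypothesis hX : forall x, stochastic_integral alpha M (Q x) (X x).

Let has_charfun_eq Z (a b : \bar R) : a = b ->
  has_charfun P Z (expR (- fine a)) -> has_charfun P Z (expR (- fine b)).
Proof. by move=> ->. Qed.

Let mQ x : measurable_fun setT (Q x) := measurable_kernel alpha D hpolar hbeta hadm x.

Let combined (J : finType) (G : J -> 'M[R]_m) (theta : J -> 'cV[R]_m) : \bar R :=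
  (enorm (\sum_j (G j)^T *m theta j) `^ alpha)%:E.

Let combined_ge0 (J : finType) (G : J -> 'M[R]_m) theta : (0 <= combined G theta)%E.
Proof. by rewrite lee_fin powR_ge0. Qed.

Let measurable_combined (J : finType) (G : J -> 'cV[R]_d -> 'M[R]_m) theta :
  (forall j, measurable_fun setT (G j)) ->
  measurable_fun setT (fun u => combined (fun j => G j u) theta).
Proof.
move=> mG; apply: measurable_enorm_powR; apply: measurable_fun_mxP => i k.
under eq_fun do rewrite summxE.
apply: measurable_sum => j.
exact: (measurableT_comp (measurable_fun_coord i k) (measurable_fun_mulmxtr (theta j) (mG j))).
Qed.

Let exponent (J : finType) (G : J -> 'cV[R]_d -> 'M[R]_m) theta : R :=
  fine (\int[lebesgue_cV d]_u combined (fun j => G j u) theta)%E.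

Let charfun_field (J : finType) (t : J -> 'cV[R]_d) theta :
  has_charfun P (fun w => \sum_j dot (theta j) (X (t j) w))
    (expR (- exponent (fun j => Q (t j)) theta)).
Proof. exact: (charfun_integrals alpha0 hM (fun j => hX (t j))). Qed.

(** An increment is a difference of two stochastic integrals; doubling the index set reduces its
characteristic function to that of the integrals themselves. *)
Let charfun_increments (J : finType) (t s : J -> 'cV[R]_d) theta :
  has_charfun P (fun w => \sum_j dot (theta j) (X (t j) w - X (s j) w))
    (expR (- exponent (fun j u => Q (t j) u - Q (s j) u) theta)).
Proof.
pose ts (i : J + J) := match i with inl j => t j | inr j => s j end.
pose th (i : J + J) := match i with inl j => theta j | inr j => - theta j end.
have := charfun_field ts th.
have -> : (fun w => \sum_i dot (th i) (X (ts i) w)) =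
    (fun w => \sum_j dot (theta j) (X (t j) w - X (s j) w)).
  apply/funext => w; rewrite big_sumType /= -big_split /=; apply: eq_bigr => j _.
  by rewrite dotDr dotNr; congr (_ + _); rewrite dotC dotNr dotC.
move=> hc; apply: has_charfun_eq hc.
apply: eq_integral => u _; congr ((enorm _ `^ _)%:E).
rewrite big_sumType /= -big_split /=; apply: eq_bigr => j _.
have -> : (Q (t j) u - Q (s j) u)^T = (Q (t j) u)^T - (Q (s j) u)^T.
  by apply/matrixP => i i'; rewrite !mxE.
move: ((Q (t j) u)^T) ((Q (s j) u)^T) (theta j) => A B v.
by rewrite mulmxBl mulmxN.
Qed.

Let mxdot_joint (Y : 'cV[R]_d -> Omega -> 'cV[R]_m) k (t : 'I_k -> 'cV[R]_d) A w :
  mxdot A (joint Y t w) = \sum_j dot (col j A) (Y (t j) w).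
Proof.
rewrite mxdotE; apply: eq_bigr => j _; rewrite /dot; apply: eq_bigr => i _.
by rewrite !mxE.
Qed.

Let measurable_joint (Y : 'cV[R]_d -> Omega -> 'cV[R]_m) k (t : 'I_k -> 'cV[R]_d) :
  (forall x, measurable_fun setT (Y x)) -> measurable_fun setT (joint Y t).
Proof.
move=> mY; apply: measurable_fun_mxP => i j; under eq_fun do rewrite mxE.
exact: (measurableT_comp (measurable_fun_coord i 0) (mY (t j))).
Qed.

Let mX x : measurable_fun setT (X x).
Proof. exact: measurable_funPT. Qed.

Let exponent_scale (J : finType) (G : J -> 'cV[R]_d -> 'M[R]_m) theta (c : R) :
  (forall j, measurable_fun setT (G j)) ->
  (\int[lebesgue_cV d]_u combined (fun j => G j u) (fun j => c *: theta j) =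
   (`|c| `^ alpha)%:E * \int[lebesgue_cV d]_u combined (fun j => G j u) theta)%E.
Proof.
move=> mG; rewrite -(ge0_integralZl _ measurableT (measurable_combined theta mG)); last 2 first.
- by move=> u _; exact: combined_ge0.
- by rewrite lee_fin powR_ge0.
apply: eq_integral => u _; rewrite /combined -EFinM; congr EFin.
rewrite -powRM ?enorm_ge0// -enormZ; congr (enorm _ `^ _).
by rewrite scaler_sumr; apply: eq_bigr => j _; rewrite scalemxAr.
Qed.

Lemma moving_average_sas : sas_field P alpha X.
Proof.
move=> k t; pose a A := exponent (fun j => Q (t j)) (fun j : 'I_k => col j A).
apply: (sas_vector_charfun (a := a) alpha0).
- exact: (measurable_joint (Y := fun x => X x) t mX).
- move=> A; apply: fine_ge0; apply: integral_ge0 => u _; exact: combined_ge0.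
- move=> c A; rewrite /a /exponent.
  have -> : (fun j : 'I_k => col j (c *: A)) = (fun j => c *: col j A).
    by apply/funext => j; apply/colP => i; rewrite !mxE.
  have e := exponent_scale (G := fun j : 'I_k => Q (t j)) (fun j => col j A) c (fun j => mQ (t j)).
  apply: (etrans (congr1 fine e)).
  rewrite fineM// ge0_fin_numE; last by apply: integral_ge0 => u _; exact: combined_ge0.
  exact: (integral_combined_fin alpha0 (fun j => hX (t j))).
- move=> A; have := charfun_field t (fun j => col j A); congr has_charfun.
  by apply/funext => w; rewrite (mxdot_joint (fun x => X x)).
Qed.

Let eq_fdd_exponent (Y Z : 'cV[R]_d -> Omega -> 'cV[R]_m) :
  (forall x, measurable_fun setT (Y x)) -> (forall x, measurable_fun setT (Z x)) ->
  (forall k (t : 'I_k -> 'cV[R]_d) theta, exists a : R,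
    has_charfun P (fun w => \sum_j dot (theta j) (Y (t j) w)) a /\
    has_charfun P (fun w => \sum_j dot (theta j) (Z (t j) w)) a) ->
  eq_fdd P Y Z.
Proof.
move=> mY mZ h k t B mB.
have /choice[a ha] A := h k t (fun j => col j A).
apply: (eq_law_has_charfun (a := a) (measurable_joint t mY) (measurable_joint t mZ) _ _ mB) => A.
- have [+ _] := ha A; congr has_charfun.
  by apply/funext => w; rewrite mxdot_joint.
- have [_ +] := ha A; congr has_charfun.
  by apply/funext => w; rewrite mxdot_joint.
Qed.

(** The kernel of an increment is a translate of the kernel, and Lebesgue measure is invariant. *)
Lemma moving_average_stationary : stationary_increments P X.
Proof.
move=> h; apply: eq_fdd_exponent => [x|x|k t theta]; [|exact: mX|].
  exact: measurable_fun_mxB.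
exists (expR (- exponent (fun j => Q (t j)) theta)); split; last exact: charfun_field.
have := charfun_increments (fun j => t j + h) (fun=> h) theta.
move=> hc; apply: has_charfun_eq hc.
have mc : measurable_fun setT (fun u => combined (fun j => Q (t j) u) theta).
  by apply: measurable_combined => j; exact: mQ.
apply: etrans (ge0_integral_translate (- h) mc (fun u => combined_ge0 _ _)).
apply: eq_integral => u _; congr (combined _ theta).
by apply/funext => j; rewrite /Q kernel_shift.
Qed.

(** The change of variables [u = r^E v] produces the factor [r ^ tr E], which cancels the scalar part
of [r^(D - tr E / alpha)] in the power [alpha]. *)
Lemma moving_average_self_similar : operator_self_similar P E D X.
Proof.
move=> r r0; apply: eq_fdd_exponent => [x|x|k t theta]; first exact: mX.
  apply: measurable_fun_mulmx; exact: mX.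
exists (expR (- exponent (fun j => Q (mpow r E *m t j)) theta)); split.
  exact: (charfun_field (fun j => mpow r E *m t j)).
have := charfun_field t (fun j => (mpow r D)^T *m theta j).
have -> : (fun w => \sum_j dot ((mpow r D)^T *m theta j) (X (t j) w)) =
    (fun w => \sum_j dot (theta j) (mpow r D *m X (t j) w)).
  by apply/funext => w; apply: eq_bigr => j _; rewrite dot_mulmx.
move=> hc; apply: has_charfun_eq hc.
set A := D - (\tr E / alpha)%:M.
have mr : measurable_fun setT (fun u => combined (fun j => Q (mpow r E *m t j) u) theta).
  by apply: measurable_combined => j; exact: mQ.
have mA : measurable_fun setT (fun u => combined (fun j => mpow r A *m Q (t j) u) theta).
  by apply: measurable_combined => j; apply: measurable_fun_mulmx; exact: mQ.
have h1 := integral_kernel_scale d0 hpolar hhomo hadm (G := fun M => combined M theta) r0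
  (fun M => combined_ge0 M theta) mr mA.
pose c := r `^ (- (\tr E / alpha)).
have rA : mpow r A = c *: mpow r D.
  have -> : A = D + (- (\tr E / alpha))%:M by rewrite /A [(- _)%:M]raddfN.
  by rewrite mpow_shift.
have pt : (\int[lebesgue_cV d]_u combined (fun j => mpow r A *m Q (t j) u) theta =
    \int[lebesgue_cV d]_u combined (fun j => Q (t j) u) (fun j => c *: ((mpow r D)^T *m theta j)))%E.
  apply: eq_integral => u _; apply: (congr1 (fun v => (enorm v `^ alpha)%:E)).
  apply: eq_bigr => j _; move: (Q (t j) u) => B; rewrite rA.
  by rewrite trmx_mul [(c *: _)^T]linearZ /= -mulmxA -scalemxAl.
have e := exponent_scale (G := fun j => Q (t j)) (fun j => (mpow r D)^T *m theta j) c
  (fun j => mQ (t j)).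
have cx (x : \bar R) : ((r `^ \tr E)%:E * ((`|c| `^ alpha)%:E * x) = x)%E.
  exact: scale_powR_cancel.
exact: (esym (etrans h1 (etrans (congr1 (fun x => (r `^ \tr E)%:E * x)%E (etrans pt e)) (cx _)))).
Qed.

(** By the shift identity the increment between [x] and [y] has the kernel of lag [y - x], up to a
translation; its integral is small, and the tail bound converts this into probability. *)
Lemma moving_average_continuous : stochastically_continuous P X.
Proof.
move=> x e e0.
have [C [C0 CE]] : exists C : R, 0 <= C /\ @vector_tail_cst R m alpha e = C.
  by exists (@vector_tail_cst R m alpha e); split => //; exact: vector_tail_cst_ge0.
have C1 : 0 < C + 1 by rewrite ltr_wpDl.
apply: (@cvg_ereal0 R _ _ (nbhs_filter x)) => [y|e' e'0]; first exact: measure_ge0.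
have ec0 : 0 < e' / (C + 1) by rewrite divr_gt0.
pose S (z : 'cV[R]_d) : Prop :=
  (\int[lebesgue_cV d]_u (norm1 (Q z u) `^ alpha)%:E <= (e' / (C + 1))%:E)%E.
have hS : \forall z \near (0 : 'cV[R]_d), S z.
  exact: (kernel_integral_small d0 alpha0 hE hD hpolar hbeta hhomo hadm hH hHbeta ec0).
have := @near_sub R d x S hS; rewrite /S.
apply: filterS => y /= hy.
pose G u := Q y u - Q x u.
have GE u : G u = Q (y - x) (u - x) by rewrite /G /Q -kernel_shift subrK.
have IG : (\int[lebesgue_cV d]_u (norm1 (G u) `^ alpha)%:E =
    \int[lebesgue_cV d]_u (norm1 (Q (y - x) u) `^ alpha)%:E)%E.
  have mn : measurable_fun setT (fun u => (norm1 (Q (y - x) u) `^ alpha)%:E).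
    by apply: measurable_norm1_powR; exact: mQ.
  have n0 u : (0 <= (norm1 (Q (y - x) u) `^ alpha)%:E)%E by rewrite lee_fin powR_ge0.
  apply: etrans (ge0_integral_translate (- x) mn n0).
  by apply: eq_integral => u _; rewrite GE.
have mG : measurable_fun setT G by apply: measurable_fun_mxB; exact: mQ.
have mV : measurable_fun setT (fun w => X y w - X x w) by exact: measurable_fun_mxB.
have Goo : (\int[lebesgue_cV d]_u (norm1 (G u) `^ alpha)%:E < +oo)%E.
  by rewrite IG; apply: le_lt_trans hy _; rewrite ltry.
apply: le_trans (vector_tail (P := P) alpha0 mG mV e0 Goo _) _.
  move=> theta; have := charfun_increments (J := unit) (fun=> y) (fun=> x) (fun=> theta).
  have -> : (fun w => \sum_(j : unit) dot theta (X y w - X x w)) = (fun w => dot theta (X y w - X x w)).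
    by apply/funext => w; rewrite (big_pred1 tt)//; case.
  move=> hc; apply: has_charfun_eq hc.
  apply: eq_integral => u _; congr ((enorm _ `^ _)%:E).
  by rewrite (big_pred1 tt)//; case.
rewrite IG CE; apply: (@le_trans _ _ (C%:E * (e' / (C + 1))%:E)%E).
  by apply: lee_wpmul2l; [rewrite lee_fin|exact: hy].
rewrite -EFinM lee_fin; exact: mulr_div_addr1_le.
Qed.

End field.

Theorem theorem2p5 (R : realType) (d m : nat) (hd : (2 <= d)%N) (hm : (2 <= m)%N)
    (dO : measure_display) (Omega : measurableType dO) (P : probability Omega R)
    (alpha : R) (halpha : 0 < alpha <= 2)
    (E : 'M[R]_d) (hE : positive_spectrum E)
    (D : 'M[R]_m) (hD : positive_spectrum D)
    (tau : 'cV[R]_d -> R) (l : 'cV[R]_d -> 'cV[R]_d)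
    (hpolar : polar_coordinates E tau l)
    (phi : 'cV[R]_d -> R) (beta : R) (hbeta : 0 < beta)
    (hhomo : homogeneous E phi) (hadm : admissible tau beta phi)
    (H : R) (hH : is_max_Re D H) (hHbeta : H < beta)
    (M : set 'cV[R]_d -> {RV P >-> 'cV[R]_m})
    (hM : sas_random_measure alpha M) :
  let Q := moving_average_kernel alpha E D phi in
  (forall x, is_integrand alpha (Q x)) /\
  (exists X : 'cV[R]_d -> {RV P >-> 'cV[R]_m},
    forall x, stochastic_integral alpha M (Q x) (X x)) /\
  (forall X : 'cV[R]_d -> {RV P >-> 'cV[R]_m},
    (forall x, stochastic_integral alpha M (Q x) (X x)) ->
    [/\ stochastically_continuous P X,
        operator_self_similar P E D X,
        sas_field P alpha X &
        stationary_increments P X]).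

  Proof.
have d0 : (0 < d)%N by apply: leq_trans hd.
have /andP[alpha0 _] := halpha.
move=> Q.
have hQ x : is_integrand alpha (Q x).
  exact: (kernel_is_integrand d0 alpha0 hE hD hpolar hbeta hhomo hadm hH hHbeta x).
split => //; split.
  have /choice[X hX] x := stochastic_integral_exists alpha0 hM (hQ x).
  by exists X.
move=> X hX; split.
- exact: (moving_average_continuous d0 alpha0 hE hD hpolar hbeta hhomo hadm hH hHbeta hM hX).
- exact: (moving_average_self_similar d0 alpha0 hpolar hbeta hhomo hadm hM hX).
- exact: (moving_average_sas alpha0 hpolar hbeta hadm hM hX).
- exact: (moving_average_stationary alpha0 hpolar hbeta hadm hM hX).
Qed.
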